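(* Given any $p$ with $1 < p < 2$, one can find two vectors $\mathbf{a}, \mathbf{b} \in \ell^1(\mathbb{Z})$ such that $\mathbf{a}$ is cyclic in $\ell^p(\mathbb{Z})$ and $\mathbf{b}$ is not cyclic in $\ell^p(\mathbb{Z})$, but their Fourier transforms have an identical set of zeros: $\{t \in \mathbb{T} : \widehat{\mathbf{a}}(t) = 0\} = \{t \in \mathbb{T} : \widehat{\mathbf{b}}(t) = 0\}$.
   Context: $\mathbb{T} = \mathbb{R}/2\pi\mathbb{Z}$ is the circle group. For $\mathbf{c} = \{c_n\}_{n \in \mathbb{Z}} \in \ell^1(\mathbb{Z})$ (complex sequences), the Fourier transform is the continuous function $\widehat{\mathbf{c}}(t) := \sum_{n \in \mathbb{Z}} c_n e^{int}$ on $\mathbb{T}$. A vector $\mathbf{c} \in \ell^p(\mathbb{Z})$, $1 \le p < \infty$, is called cyclic in $\ell^p(\mathbb{Z})$ (with respect to translations) if the linear span of its translates $\{c_{n-m}\}_{n \in \mathbb{Z}}$, $m \in \mathbb{Z}$, is dense in $\ell^p(\mathbb{Z})$. *)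

(* Defs.v *)
From HB Require Import structures.
From mathcomp Require Import all_boot all_order all_algebra.
From mathcomp Require Import all_classical all_reals all_analysis.
From mathcomp Require Import complex.

Set Implicit Arguments.
Unset Strict Implicit.
Unset Printing Implicit Defensive.

Import Order.TTheory GRing.Theory Num.Theory.
Import numFieldNormedType.Exports.
Import ComplexField.

Local Open Scope classical_set_scope.
Local Open Scope ring_scope.
Local Open Scope complex_scope.
Local Open Scope quotient_scope.

Section Circle.
Variable R : realType.

Definition two_pi_int : {pred R} := [pred x | x / (2 * pi) \is a Num.int].

Lemma two_pi_int_zmod : zmod_closed two_pi_int.
Proof.
split=> [|x y]; rewrite !inE /=; first by rewrite mul0r rpred0.
by move=> hx hy; rewrite mulrBl rpredB.
Qed.

HB.instance Definition _ := GRing.isZmodClosed.Build R two_pi_int two_pi_int_zmod.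

Definition circle := Quotient.quot two_pi_int.

End Circle.

Section Lp.
Variable R : realType.
Implicit Types (p : R) (c x y : int -> R[i]).

(* [Normc.normc] is the modulus with values in R; the norm [`|z|] of z : R[i]
   is an element of R[i]. *)
Definition lpnorm p c : \bar R :=
  ((\esum_(n in [set: int]) ((Normc.normc (c n) `^ p)%:E)) `^ p^-1)%E.

Definition lp p : set (int -> R[i]) := [set c | (lpnorm p c < +oo)%E].

Definition translate (m : int) c : int -> R[i] := fun n => c (n - m).

Definition translates_span c : set (int -> R[i]) :=
  [set y | exists s : seq (R[i] * int),
     y = (fun n => \sum_(k <- s) k.1 * translate k.2 c n)].

(* Meant for c in [lp p], 1 <= p: then [translates_span c] is contained in
   [lp p], and this is its density for the distance of the norm. *)
Definition cyclic p c : Prop :=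
  forall x, lp p x -> forall eps : R, 0 < eps ->
    exists2 y, translates_span c y & (lpnorm p (fun n => (x n - y n)%R) < eps%:E)%E.

End Lp.

Section Fourier.
Variable R : realType.
Implicit Types (c : int -> R[i]) (x : R).

Definition expi x : R[i] := cos x +i* sin x.

Definition fourier_sum c x (N : nat) : R[i] :=
  \sum_(k < (2 * N).+1) c (k%:Z - N%:Z) * expi ((k%:Z - N%:Z)%:~R * x).

(* The two-sided series is the limit of its symmetric partial sums: the k-th
   term of [fourier_sum c x N] has index n = k - N, which runs over
   -N, ..., N. [(R[i])^o] carries the topology of the modulus. *)
Definition fourier_series c x : R[i] :=
  lim ((fourier_sum c x : nat -> (R[i])^o) @ \oo).

Definition fourier c (t : circle R) : R[i] := fourier_series c (repr t).

Lemma expi_two_pi x (m : int) : expi (x + 2 * pi * m%:~R) = expi x.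
Proof.
have nat_case y (k : nat) : expi (y + 2 * pi * k%:R) = expi y.
  have -> : y + 2 * pi * k%:R = y + pi *+ 2 *+ k.
    by rewrite (mulr_natr (2 * pi)) mulr_natl.
  by rewrite /expi (periodicn (@cosD2pi R)) (periodicn (@sinD2pi R)).
case: m => k; first exact: nat_case.
rewrite NegzE mulrNz mulrN -[in RHS](subrK (2 * pi * k.+1%:R) x) nat_case.
by [].
Qed.

Lemma fourier_pi c x : fourier c (\pi_(circle R) x) = fourier_series c x.
Proof.
rewrite /fourier; set y := repr _.
have : y == x %[mod circle R] by rewrite reprK.
rewrite -(Quotient.idealrBE (@two_pi_int R)).
case/intrP => m hm.
have pi0 : 2 * pi != 0 :> R by rewrite mulf_neq0 ?pnatr_eq0 ?gt_eqF ?pi_gt0.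
have -> : y = x + 2 * pi * m%:~R.
  by rewrite -hm mulrC divfK // addrC subrK.
rewrite /fourier_series; suff -> : fourier_sum c (x + 2 * pi * m%:~R) =
    fourier_sum c x by [].
apply/funext => N; apply: eq_bigr => k _; congr (_ * _).
by rewrite mulrDr mulrCA -intrM expi_two_pi.
Qed.

End Fourier.

(* Main.v *)
(* Everything is even and real: an even trigonometric polynomial is a
   polynomial in x = cos t, and its Fourier coefficients are its Chebyshev
   coefficients. Let q = p / (p - 1) > 2. We build polynomials a_n converging
   geometrically, in the Wiener algebra, to the transform of a, and polynomials
   S_n with mean >= 1/2 and bounded l^q coefficients such that S_n is tiny
   where |a_n| is not.

   In one step, with S small in mean square off {|a| <= d}, multiply S (after a
   cut-off) by a signed average f of the Riesz products
   prod_j (1 + sigma s phi T_{nu_j}), where phi = a / d, over nodes sigma in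
   [1/2, 1]; the nu_j are lacunary and the weights have moments
   1, 0, ..., 0 of orders 0, 1, ..., L. As N (s/2)^q << N s^2, one can take L of
   order N (s/2)^q, so that S f - S is small in l^q, while the mass of S f is
   concentrated where g = (1 / (N s)) sum_j T_{nu_j} is close to phi, that is,
   where a - d g is smaller than d by a fixed factor. The correction d g has a
   bounded Wiener norm relative to d and, as p > 1, an arbitrarily small l^p
   norm.

   A nonzero trigonometric polynomial is cyclic in l^p for p > 1; since a - a_n
   is l^p-small depending on a_n, the limit a is cyclic. The transform of b is a
   sum of w_n F_n with F_n a positive multiple of the square of the positive
   part of |a_n|^2 - r_n^2, where r_n is a multiple of the approximation rate:
   its zeros are those of a, and it is small where |a_m| is small. Hence S_m
   times the transform of b tends to 0 uniformly, and S_m, as a functional on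
   l^p, nearly annihilates all translates of b but not the unit vector. *)
Require Import Defs.
From mathcomp Require Import all_boot all_order all_algebra.
From mathcomp Require Import all_classical all_reals all_analysis.
From mathcomp Require Import complex.
From mathcomp Require Import ring lra zify.

Set Implicit Arguments.
Unset Strict Implicit.
Unset Printing Implicit Defensive.

Import Order.TTheory GRing.Theory Num.Theory.
Import numFieldNormedType.Exports.

Local Open Scope classical_set_scope.
Local Open Scope ring_scope.

(** * Chebyshev coefficients *)

Section Chebyshev.
Variable R : realType.
Implicit Types (P Q : {poly R}) (i j k n M : nat) (x t : R).

(** In the variable cos t, the mean of a polynomial over the circle is a finite average over
    equispaced points. All estimates thus become inequalities between polynomials on [-1, 1],
    without any integral. The Wiener norm of a correction is about d / s, so s has to be the same in
    all steps and only N can grow with the accuracy required. But for fixed s the change that one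
    Riesz product makes in l^q grows with N; hence the signed average, which cancels the orders 1,
    ..., L. Its cost is exponential in L: 8^L for a weight, 64^L for a mean square. The gain from
    concentration is (1 - s^2 / 200)^N, and it wins for a small fixed s because q > 2, that is p <
    2. The nodes keep away from 0 because the product with node sigma concentrates g near sigma phi,
    which is within 1/2 of phi when |phi| <= 1 and sigma >= 1/2. The tolerance 31/32 leaves room for
    the normalisation and for the second-order terms of an exponential moment bound. *)

Fixpoint cheb_pair n : {poly R} * {poly R} :=
  if n is n'.+1 then
    let: (u, v) := cheb_pair n' in (v, 'X * v *+ 2 - u) else (1, 'X).

Definition cheb n : {poly R} := (cheb_pair n).1.

Lemma cheb0 : cheb 0 = 1. Proof. by []. Qed.
Lemma cheb1 : cheb 1 = 'X. Proof. by []. Qed.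
Lemma chebSS n : cheb n.+2 = 'X * cheb n.+1 *+ 2 - cheb n.
Proof. by rewrite /cheb /=; case: (cheb_pair n). Qed.

Lemma cheb_ind2 (A : nat -> Prop) :
  A 0%N -> A 1%N -> (forall n, A n -> A n.+1 -> A n.+2) -> forall n, A n.
Proof.
move=> A0 A1 AS n; suff: A n /\ A n.+1 by case.
by elim: n => [|n [An An1]]; split=> //; apply: AS.
Qed.

Lemma cheb_cos n t : (cheb n).[cos t] = cos (n%:R * t).
Proof.
elim/cheb_ind2: n => [||n IH0 IH1].
- by rewrite cheb0 hornerC mul0r cos0.
- by rewrite cheb1 hornerX mul1r.
rewrite chebSS !hornerE IH0 IH1.
have -> : n.+2%:R * t = n.+1%:R * t + t by rewrite -[n.+2]addn1 natrD; ring.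
have -> : n%:R * t = n.+1%:R * t - t by rewrite -[n.+1]addn1 natrD; ring.
by rewrite cosB cosD; ring.
Qed.

Lemma chebM i j : (i <= j)%N ->
  cheb i * cheb j *+ 2 = cheb (j + i) + cheb (j - i).
Proof.
elim/cheb_ind2: i j => [||i IH0 IH1] j ij.
- by rewrite cheb0 mul1r addn0 subn0 mulr2n.
- case: j ij => // j _; rewrite cheb1 addn1 chebSS subn1 /=; ring.
have := IH1 j.+1; have := IH1 j (ltnW ij).
have := IH0 j (ltnW (ltnW ij)).
rewrite chebSS.
have -> : (j - i)%N = (j - i.+2).+2 by lia.
have -> : (j - i.+1)%N = (j - i.+2).+1 by lia.
have -> : (j + i.+2)%N = (j + i).+2 by lia.
have -> : (j + i.+1)%N = (j + i).+1 by lia.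
rewrite !chebSS => h0 h1 _.
have e : ('X * cheb i.+1 *+ 2 - cheb i) * cheb j *+ 2 =
  'X * (cheb i.+1 * cheb j *+ 2) *+ 2 - cheb i * cheb j *+ 2 by ring.
rewrite e h0 h1; ring.
Qed.

Definition ndist i j := ((i - j) + (j - i))%N.

Lemma chebM_dist i j : cheb i * cheb j *+ 2 = cheb (i + j) + cheb (ndist i j).
Proof.
rewrite /ndist; case: (leqP i j) => [ij|/ltnW ji].
  by rewrite chebM // addnC (eqP ij) add0n.
by rewrite mulrC chebM // (eqP ji) addn0.
Qed.

Lemma size_cheb n : size (cheb n) = n.+1.
Proof.
elim/cheb_ind2: n => [||n IH0 IH1]; rewrite ?size_poly1 ?size_polyX //.
have n0 : cheb n.+1 != 0 by rewrite -size_poly_eq0 IH1.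
rewrite chebSS -scaler_nat size_polyDl size_scale ?pnatr_eq0 // mulrC.
  by rewrite size_mulX // IH1.
by rewrite size_polyN IH0 size_mulX // IH1.
Qed.

Lemma cheb_neq0 n : cheb n != 0. Proof. by rewrite -size_poly_eq0 size_cheb. Qed.

Lemma cheb_expand n P : (size P <= n)%N ->
  exists b : nat -> R, P = \sum_(k < n) b k *: cheb k.
Proof.
elim: n P => [|n IH] P; first by rewrite leqn0 size_poly_eq0 => /eqP ->; exists (fun=> 0); rewrite big_ord0.
move=> sP; pose c := P`_n / lead_coef (cheb n).
have [|b hb] := IH (P - c *: cheb n).
  apply/leq_sizeP => j; rewrite leq_eqVlt => /predU1P[<-|nj].
    rewrite coefB coefZ /c /lead_coef size_cheb /= divfK ?subrr //.
    by have := cheb_neq0 n; rewrite -lead_coef_eq0 /lead_coef size_cheb.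
  rewrite coefB coefZ !nth_default ?mulr0 ?subrr ?size_cheb //.
  exact: leq_trans nj.
exists (fun k => if k == n then c else b k).
rewrite big_ord_recr /= eqxx (eq_bigr (fun k : 'I_n => b k *: cheb k)).
  by rewrite -hb subrK.
by move=> k _; rewrite ltn_eqF.
Qed.

(* [P.[cos t]] is a trigonometric polynomial of degree less than [size P], so its
   mean over the circle is its average over any M >= size P equispaced points. *)
Definition gridmean M P : R :=
  M%:R^-1 * \sum_(j < M) P.[cos (2 * pi * j%:R / M%:R)].

(** Multiplied by sin (h / 2), where h is the step between consecutive angles, the sum telescopes
    over a full period; 0 < k < M puts h / 2 strictly between 0 and pi, so that this factor does not
    vanish. *)
Lemma sum_cos_grid k M : (0 < k < M)%N ->
  \sum_(j < M) cos (k%:R * (2 * pi * j%:R / M%:R)) = 0 :> R.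
Proof.
move=> /andP[k0 kM]; have M0 : M%:R != 0 :> R by rewrite pnatr_eq0; lia.
pose h : R := 2 * pi * k%:R / M%:R.
have hs : 0 < sin (h / 2).
  apply: sin_gt0_pi; rewrite /h.
  have -> : 2 * pi * k%:R / M%:R / 2 = pi * (k%:R / M%:R) :> R by field.
  have Mp : 0 < M%:R :> R by rewrite ltr0n; lia.
  rewrite mulr_gt0 ?pi_gt0 ?divr_gt0 // ?ltr0n //=.
  by rewrite -[ltRHS]mulr1 ltr_pM2l ?pi_gt0 // ltr_pdivrMr // mul1r ltr_nat.
apply: (mulfI (lt0r_neq0 hs)); rewrite mulr0 mulr_sumr.
pose F (j : nat) : R := sin ((j%:R - 2^-1) * h) / 2.
have e (j : 'I_M) : true -> sin (h / 2) * cos (k%:R * (2 * pi * j%:R / M%:R)) = F j.+1 - F j.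
  move=> _; have -> : k%:R * (2 * pi * j%:R / M%:R) = j%:R * h by rewrite /h; field.
  rewrite /F.
  have -> : (j.+1%:R - 2^-1) * h = j%:R * h + h / 2 by rewrite -addn1 natrD; field.
  have -> : (j%:R - 2^-1) * h = j%:R * h - h / 2 by ring.
  by rewrite sinB sinD; field.
rewrite (eq_bigr _ e) -(big_mkord xpredT (fun j => F j.+1 - F j)) telescope_sumr //.
rewrite /F -mulrBl.
have -> : (M%:R - 2^-1) * h = - (h / 2) + pi *+ 2 *+ k.
  have e2 : M%:R * h = 2 * pi * k%:R by rewrite /h mulrC divfK.
  rewrite mulrBl e2 -[pi *+ 2 *+ k]mulr_natr -[pi *+ 2]mulr_natr.
  by rewrite (mulrC 2^-1); ring.
rewrite (periodicn (@sinD2pi R)) mulr0n sub0r mulNr.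
have -> : 2^-1 * h = h / 2 by rewrite mulrC.
by rewrite subrr mul0r.
Qed.

Lemma gridmean_cheb k M : (k < M)%N -> gridmean M (cheb k) = (k == 0%N)%:R.
Proof.
rewrite /gridmean => kM; under eq_bigr do rewrite cheb_cos.
case: k kM => [|k] kM.
  under eq_bigr do rewrite mul0r cos0.
  by rewrite sumr_const card_ord mulVf // pnatr_eq0; lia.
by rewrite sum_cos_grid // mulr0.
Qed.

Lemma gridmean_linear M a P Q :
  gridmean M (a *: P + Q) = a * gridmean M P + gridmean M Q.
Proof.
rewrite /gridmean mulrCA -mulrDr; congr (_ * _).
by rewrite mulr_sumr -big_split /=; apply: eq_bigr => j _; rewrite !hornerE.
Qed.

Lemma gridmean_sum M n (b : nat -> R) (F : nat -> {poly R}) :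
  gridmean M (\sum_(k < n) b k *: F k) = \sum_(k < n) b k * gridmean M (F k).
Proof.
elim: n => [|n IH].
  by rewrite !big_ord0 /gridmean big1 ?mulr0 // => j _; rewrite horner0.
by rewrite !big_ord_recr /= addrC gridmean_linear IH addrC.
Qed.

Lemma gridmean_const M N P : (size P <= M)%N -> (size P <= N)%N ->
  (0 < M)%N -> (0 < N)%N -> gridmean M P = gridmean N P.
Proof.
wlog MN : M N / (M <= N)%N.
  by move=> H h1 h2 h3 h4; case: (leqP M N) => [/H->|/ltnW/H->].
move=> PM _ M0 N0; have [b ->] := cheb_expand PM.
rewrite !gridmean_sum; apply: eq_bigr => k _.
by rewrite !gridmean_cheb // (leq_trans (ltn_ord k)).
Qed.

(** The additional point keeps the grid nonempty when P = 0. *)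
Definition mean P : R := gridmean (size P).+1 P.

Lemma meanE M P : (size P <= M)%N -> (0 < M)%N -> mean P = gridmean M P.
Proof. by move=> PM M0; apply: gridmean_const. Qed.

Lemma mean_linear a P Q : mean (a *: P + Q) = a * mean P + mean Q.
Proof.
pose M := (maxn (size P) (size Q)).+1.
rewrite !(@meanE M) ?gridmean_linear //; rewrite /M.
- by rewrite ltnW // ltnS leq_maxr.
- by rewrite ltnW // ltnS leq_maxl.
rewrite (leq_trans (size_polyD _ _)) // geq_max.
rewrite (leq_trans (size_scale_leq _ _)) /=.
  by rewrite ltnW // ltnS leq_maxr.
by rewrite ltnW // ltnS leq_maxl.
Qed.

Lemma meanD P Q : mean (P + Q) = mean P + mean Q.
Proof. by rewrite -[P]scale1r mean_linear mul1r scale1r. Qed.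
Lemma mean0 : mean 0 = 0.
Proof. by apply: (addrI (mean 0)); rewrite -meanD !addr0. Qed.
Lemma meanZ a P : mean (a *: P) = a * mean P.
Proof. by rewrite -[_ *: _]addr0 mean_linear mean0 addr0. Qed.
Lemma meanN P : mean (- P) = - mean P.
Proof. by rewrite -scaleN1r meanZ mulN1r. Qed.
Lemma meanB P Q : mean (P - Q) = mean P - mean Q.
Proof. by rewrite meanD meanN. Qed.
Lemma mean_sum I (r : seq I) (p : pred I) (F : I -> {poly R}) :
  mean (\sum_(i <- r | p i) F i) = \sum_(i <- r | p i) mean (F i).
Proof. exact: (big_morph _ meanD mean0). Qed.
Lemma meanMn P n : mean (P *+ n) = mean P *+ n.
Proof. by rewrite -scaler_nat meanZ mulr_natl. Qed.

Lemma mean_cheb k : mean (cheb k) = (k == 0%N)%:R.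
Proof. by rewrite (@meanE k.+1) ?size_cheb // gridmean_cheb. Qed.
Lemma meanC a : mean a%:P = a.
Proof. by rewrite -[a%:P]mulr1 mul_polyC meanZ -cheb0 mean_cheb mulr1. Qed.

Lemma mean_le P Q : (forall x, -1 <= x <= 1 -> P.[x] <= Q.[x]) ->
  mean P <= mean Q.
Proof.
move=> PQ; pose M := (maxn (size P) (size Q)).+1.
rewrite !(@meanE M) //; [|by rewrite /M; lia|by rewrite /M; lia].
rewrite /gridmean ler_wpM2l ?invr_ge0 ?ler0n // ler_sum // => j _.
by apply: PQ; rewrite cos_geN1 cos_le1.
Qed.

(* The k-th Fourier coefficient of t |-> [P.[cos t]]. *)
Definition ccoef P k : R := mean (P * cheb k).

Lemma ccoefD P Q k : ccoef (P + Q) k = ccoef P k + ccoef Q k.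
Proof. by rewrite /ccoef mulrDl meanD. Qed.
Lemma ccoefN P k : ccoef (- P) k = - ccoef P k.
Proof. by rewrite /ccoef mulNr meanN. Qed.
Lemma ccoefB P Q k : ccoef (P - Q) k = ccoef P k - ccoef Q k.
Proof. by rewrite ccoefD ccoefN. Qed.
Lemma ccoefZ a P k : ccoef (a *: P) k = a * ccoef P k.
Proof. by rewrite /ccoef -scalerAl meanZ. Qed.
Lemma ccoef_sum I (r : seq I) (p : pred I) (F : I -> {poly R}) k :
  ccoef (\sum_(i <- r | p i) F i) k = \sum_(i <- r | p i) ccoef (F i) k.
Proof. by rewrite /ccoef mulr_suml mean_sum. Qed.
Lemma ccoef0 P : ccoef P 0 = mean P.
Proof. by rewrite /ccoef cheb0 mulr1. Qed.

Lemma mean_chebM i j : mean (cheb i * cheb j) = ((i + j == 0)%N%:R + (i == j)%:R) / 2.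
Proof.
have := congr1 mean (chebM_dist i j); rewrite meanMn meanD !mean_cheb => e.
have -> : (i == j) = (ndist i j == 0)%N by rewrite /ndist; lia.
by rewrite -e -[_ *+ 2]mulr_natr mulfK // pnatr_eq0.
Qed.

Lemma ccoef_eq0 P k : (size P <= k)%N -> ccoef P k = 0.
Proof.
move=> /cheb_expand[b ->]; rewrite ccoef_sum big1 // => i _.
rewrite ccoefZ /ccoef mean_chebM.
have -> : (i + k == 0)%N = false by case: i => /= i; lia.
have -> : (i == k :> nat) = false by case: i => /= i; lia.
by rewrite addr0 mul0r mulr0.
Qed.

(** The doubling for k >= 1 accounts for the equal coefficients of index k and -k. *)
Lemma cheb_ccoef n P : (size P <= n)%N ->
  P = (mean P)%:P + \sum_(1 <= k < n) (ccoef P k *+ 2) *: cheb k.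
Proof.
move=> sP; have [b Pb] := cheb_expand sP.
have cb k : (k < n)%N -> ccoef P k = b k * ((k == 0)%N%:R + 1) / 2.
  move=> kn; rewrite Pb ccoef_sum (bigD1 (Ordinal kn)) //= big1 ?addr0.
    by rewrite ccoefZ /ccoef mean_chebM eqxx addn_eq0 andbb mulrA.
  move=> i /negPf; rewrite -val_eqE /= => ik.
  rewrite ccoefZ /ccoef mean_chebM ik.
  have -> : (i + k == 0)%N = false by move: ik; lia.
  by rewrite addr0 mul0r mulr0.
case: n Pb cb {sP} => [|n] Pb cb.
  by rewrite Pb !big_ord0 mean0 big_geq // addr0.
rewrite -ccoef0 cb // {1}Pb big_ord_recl /= big_add1 /= big_mkord.
rewrite cheb0 alg_polyC -mulrA divff ?mulr1 ?lt0r_neq0 //.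
congr (_ + _); apply: eq_bigr => i _; rewrite cb; last by rewrite /= ltnS.
by rewrite add0r mulr1 -[_ *+ 2]mulr_natr divfK // pnatr_eq0.
Qed.

Lemma parseval n P : (size P <= n)%N ->
  mean (P * P) = mean P ^+ 2 + (\sum_(1 <= k < n) ccoef P k ^+ 2) *+ 2.
Proof.
move=> sP; rewrite {2}(cheb_ccoef sP) mulrDr meanD.
rewrite mulrC mul_polyC meanZ -expr2; congr (_ + _).
rewrite mulr_sumr mean_sum -sumrMnl; apply: eq_bigr => k _.
by rewrite -scalerAr meanZ -/(ccoef P k) expr2 mulrnAl.
Qed.

Lemma bessel n P : \sum_(k < n) ccoef P k ^+ 2 <= mean (P * P).
Proof.
pose N := maxn n.+1 (size P).
apply: (@le_trans _ _ (\sum_(k < N) ccoef P k ^+ 2)).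
  rewrite -!(big_mkord xpredT (fun k => ccoef P k ^+ 2)).
  rewrite (@big_cat_nat _ _ _ n 0%N N) //=; last by rewrite /N; lia.
  by rewrite lerDl sumr_ge0 // => k _; rewrite sqr_ge0.
rewrite (@parseval N) ?leq_maxr //.
rewrite -!(big_mkord xpredT (fun k => ccoef P k ^+ 2)).
rewrite big_ltn; last by rewrite /N; lia.
rewrite ccoef0 lerD2l mulr2n lerDl sumr_ge0 // => k _.
by rewrite sqr_ge0.
Qed.

Definition supI_le P (B : R) := forall x, -1 <= x <= 1 -> `|P.[x]| <= B.

Lemma supI_ex P : exists2 B : R, 0 < B & supI_le P B.
Proof.
exists (1 + \sum_(i < size P) `|P`_i|).
  by rewrite ltr_wpDr // sumr_ge0 // => i _.
move=> x /andP[x1 x2]; rewrite horner_coef ler_wpDl // (le_trans (ler_norm_sum _ _ _)) //.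
apply: ler_sum => i _; rewrite normrM ler_piMr // normrX exprn_ile1 //.
by rewrite ler_norml x1.
Qed.

Lemma cheb_supI n : supI_le (cheb n) 1.
Proof.
move=> x hx; have <- : cos (acos x) = x by apply: acosK.
by rewrite cheb_cos cos_max.
Qed.

Lemma norm_mean P B : supI_le P B -> `|mean P| <= B.
Proof.
move=> PB; rewrite ler_norml; apply/andP; split.
  by rewrite -(meanC (- B)) mean_le // => x /PB; rewrite hornerC ler_norml => /andP[].
by rewrite -[leRHS](meanC B) mean_le // => x /PB; rewrite hornerC ler_norml => /andP[].
Qed.

Lemma norm_ccoef P B k : supI_le P B -> `|ccoef P k| <= B.
Proof.
move=> PB; apply: norm_mean => x hx; rewrite hornerM normrM.
by rewrite -[B]mulr1 ler_pM ?PB ?cheb_supI.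
Qed.

Lemma mean_sqr_le P B : supI_le P B -> mean (P * P) <= B ^+ 2.
Proof.
move=> PB; rewrite -(meanC (B ^+ 2)) mean_le // => x hx.
rewrite hornerM hornerC -expr2 -real_normK ?num_real // lerXn2r ?nnegrE ?PB //.
by rewrite (le_trans _ (PB x hx)).
Qed.

Lemma ccoef_cheb i j : ccoef (cheb i) j = ((i + j == 0)%N%:R + (i == j)%:R) / 2.
Proof. exact: mean_chebM. Qed.

Lemma ccoef_chebM nu P k :
  ccoef (cheb nu * P) k = (ccoef P (nu + k) + ccoef P (ndist nu k)) / 2.
Proof.
rewrite /ccoef mulrAC [X in mean X]mulrC -meanD -mulrDr -chebM_dist mulrnAr meanMn.
by rewrite -[_ *+ 2]mulr_natr mulfK ?pnatr_eq0.
Qed.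

End Chebyshev.

(** * Sequences with bounded l^r norm *)

Section RealSequences.
Variable R : realType.
Implicit Types (r : R) (x y : nat -> R).

Lemma powR_convex r (a b t : R) : 1 <= r -> 0 <= a -> 0 <= b -> 0 <= t <= 1 ->
  (t * a + (1 - t) * b) `^ r <= t * a `^ r + (1 - t) * b `^ r.
Proof.
move=> r1 a0 b0 t01; have [t0 t1] := andP t01.
have := convex_powR r1 (Itv01 t0 t1) (x := a) (y := b).
rewrite !inE /= !in_itv /= !andbT !convRE /=; exact.
Qed.

(** An l^r bound over the indices k >= 0 only, that is, over half of an even sequence. Stated on
    partial sums, it needs no infinite series and passes to coordinatewise limits. *)
Definition nle r x (A : R) :=
  forall K, \sum_(k < K) `|x k| `^ r <= A `^ r.

Lemma nle_ext r x y A : x =1 y -> nle r x A -> nle r y A.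
Proof. by move=> xy h K; under eq_bigr do rewrite -xy; apply: h. Qed.

Lemma nle_le r x A B : 0 <= r -> 0 <= A -> A <= B -> nle r x A -> nle r x B.
Proof.
move=> r0 A0 AB h K; apply: le_trans (h K) _.
by apply: ge0_ler_powR; rewrite // nnegrE // (le_trans A0).
Qed.

Lemma le_powR_inv r a b : 0 < r -> 0 <= a -> 0 <= b -> a `^ r <= b `^ r -> a <= b.
Proof.
move=> r0 a0 b0 h; rewrite leNgt; apply/negP => ba.
by have := gt0_ltr_powR r0 b0 a0 ba; rewrite ltNge h.
Qed.

Lemma nle_coef r x A k : 0 < r -> 0 <= A -> nle r x A -> `|x k| <= A.
Proof.
move=> r0 A0 h; apply: (le_powR_inv r0) => //; apply: le_trans (h k.+1).
by rewrite big_ord_recr /= lerDr sumr_ge0 // => i _; rewrite powR_ge0.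
Qed.

(** Minkowski's inequality: convexity of the r-th power is applied to the normalised sequences x / A
    and y / B with weights A / (A + B) and B / (A + B). *)
Lemma nleD r x y A B : 1 <= r -> 0 < A -> 0 < B ->
  nle r x A -> nle r y B -> nle r (fun k => x k + y k) (A + B).
Proof.
move=> r1 A0 B0 hx hy K; have r0 : 0 <= r by lra.
have AB : 0 < A + B by lra.
pose t := A / (A + B).
have t01 : 0 <= t <= 1.
  apply/andP; split; first by rewrite divr_ge0 ?ltW.
  by rewrite /t ler_pdivrMr //; lra.
have e1 : 1 - t = B / (A + B) by rewrite /t; field; rewrite gt_eqF.
have key k : `|x k + y k| `^ r <=
    (A + B) `^ r * (t * (`|x k| `^ r / A `^ r) + (1 - t) * (`|y k| `^ r / B `^ r)).
  have dv (u v : R) : 0 <= u -> 0 < v -> u `^ r / v `^ r = (u / v) `^ r.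
    move=> u0 v0; rewrite powRM ?invr_ge0 ?(ltW v0) //; congr (_ * _).
    by rewrite -(powR_inv1 (ltW v0)) -powRrM mulN1r powRN.
  rewrite !dv //.
  have u0 : 0 <= `|x k| / A by rewrite divr_ge0 // ltW.
  have v0 : 0 <= `|y k| / B by rewrite divr_ge0 // ltW.
  have c0 : 0 <= t * (`|x k| / A) + (1 - t) * (`|y k| / B).
    by have [t0 t1] := andP t01; rewrite addr_ge0 // mulr_ge0 //; lra.
  apply: (@le_trans _ _ ((A + B) `^ r * (t * (`|x k| / A) + (1 - t) * (`|y k| / B)) `^ r)).
    rewrite -powRM ?(ltW AB) //.
    apply: ge0_ler_powR; rewrite ?nnegrE // ?mulr_ge0 ?(ltW AB) //.
    have -> : (A + B) * (t * (`|x k| / A) + (1 - t) * (`|y k| / B)) = `|x k| + `|y k|.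
      by rewrite e1 /t; field; rewrite !gt_eqF.
    exact: ler_normD.
  by rewrite ler_pM2l ?powR_gt0 // powR_convex.
apply: le_trans (ler_sum _ (fun (k : 'I_K) _ => key k)) _.
rewrite -mulr_sumr -[leRHS]mulr1 ler_pM2l ?powR_gt0 // big_split /= -!mulr_sumr -!mulr_suml.
have h1 : (\sum_(i < K) `|x i| `^ r) / A `^ r <= 1 by rewrite ler_pdivrMr ?powR_gt0 // mul1r.
have h2 : (\sum_(i < K) `|y i| `^ r) / B `^ r <= 1 by rewrite ler_pdivrMr ?powR_gt0 // mul1r.
have [t0 t1] := andP t01.
have t2 : 0 <= 1 - t by lra.
apply: le_trans (lerD (ler_wpM2l t0 h1) (ler_wpM2l t2 h2)) _.
by rewrite !mulr1 addrC subrK.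
Qed.

Lemma nleZ r x A c : 0 <= c -> 0 <= A -> nle r x A -> nle r (fun k => c * x k) (c * A).
Proof.
move=> c0 A0 h K; rewrite powRM //.
under eq_bigr => i _ do rewrite normrM powRM ?normr_ge0 // (ger0_norm c0).
by rewrite -mulr_sumr ler_wpM2l ?powR_ge0.
Qed.

Lemma nleN r x A : nle r x A -> nle r (fun k => - x k) A.
Proof. by move=> h K; under eq_bigr do rewrite normrN; apply: h. Qed.

(** The factor 2 spares the continuity of the power: for finitely many k and J large, |b k - x k| is
    at most twice |g J k - x k|, trivially so when b k = x k. *)
Lemma nle_lim r (g : nat -> nat -> R) b x A : 0 < r -> 0 <= A ->
  (forall k, g ^~ k @ \oo --> (b k : R)) ->
  (\forall J \near \oo, nle r (fun k => g J k - x k) A) ->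
  nle r (fun k => b k - x k) (2 * A).
Proof.
move=> r0 A0 gb gA K.
have close : \forall J \near \oo, forall k : 'I_K, `|b k - x k| <= 2 * `|g J k - x k|.
  apply: filter_forall => k.
  have [->|bx] := eqVneq (b k) (x k); first by near=> J; rewrite subrr normr0 mulr_ge0.
  have p : 0 < `|b k - x k| / 2 by rewrite divr_gt0 // normr_gt0 subr_eq0.
  have /cvgrPdist_lt/(_ _ p) := gb k; apply: filterS => J hJ.
  have := ler_normD (b k - g J k) (g J k - x k); rewrite subrKA; lra.
near \oo => J.
have hJ : nle r (fun k => g J k - x k) A by near: J.
have cJ : forall k : 'I_K, `|b k - x k| <= 2 * `|g J k - x k| by near: J.
apply: (@le_trans _ _ (2 `^ r * \sum_(k < K) `|g J k - x k| `^ r)).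
  rewrite mulr_sumr; apply: ler_sum => k _; rewrite -powRM //.
  by apply: ge0_ler_powR; rewrite ?nnegrE ?mulr_ge0 // ltW.
by rewrite powRM // ler_pM2l ?powR_gt0.
Unshelve. all: by end_near. Qed.

Lemma coefs_limit (g : nat -> nat -> R) (e : nat -> R) :
  (forall J J' k, (J <= J')%N -> `|g J' k - g J k| <= e J) ->
  e @ \oo --> (0 : R) -> exists b : nat -> R, forall k, g ^~ k @ \oo --> b k.
Proof.
move=> ge e0; exists (fun k => lim (g ^~ k @ \oo)) => k.
apply/cauchy_cvgP/cauchy_ballP => eps eps0.
have e2 : 0 < eps / 2 by rewrite divr_gt0.
have /cvgrPdist_lt/(_ _ e2) [J _ hJ] := e0.
have hJJ := hJ J (leqnn J); rewrite /= sub0r normrN in hJJ.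
exists (g^~ k @` [set j | (J <= j)%N], g^~ k @` [set j | (J <= j)%N]).
  by split; exists J => // j /= jJ; exists j.
move=> [u v] /= [[j Jj <-] [i Ji <-]].
have h1 := ge J j k Jj; have h2 := ge J i k Ji.
rewrite /ball /=; have := ler_distD (g J k) (g j k) (g i k).
rewrite (distrC (g J k) (g i k)) => h3.
have := le_lt_trans (ler_norm _) hJJ; lra.
Qed.

Lemma ex_exprn_le (c eps : R) : 0 <= c -> c < 1 -> 0 < eps ->
  exists m0, forall m, (m0 <= m)%N -> c ^+ m <= eps.
Proof.
move=> c0 c1 e0; have cn : `|c| < 1 by rewrite ger0_norm.
have /cvgrPdist_lt/(_ _ e0) [m0 _ h] := cvg_expr cn.
exists m0 => m /h /=; rewrite sub0r normrN ger0_norm ?exprn_ge0 //.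
exact: ltW.
Qed.

End RealSequences.

(** * A signed measure on [1/2, 1] with vanishing moments *)

Section FiniteDifferences.
Variable R : realType.

(** The alternating binomial sum of (-1)^i 'C(n, i) h i. The general [zmodType] lets it act on
    numbers and on polynomials. *)
Fixpoint dif (V : zmodType) n (h : nat -> V) : V :=
  if n is m.+1 then dif m h - dif m (fun i => h i.+1) else h 0%N.

Lemma eq_dif (V : zmodType) n (h g : nat -> V) :
  (forall i, (i <= n)%N -> h i = g i) -> dif n h = dif n g.
Proof.
elim: n h g => [|n IH] h g hg /=; first exact: hg.
by congr (_ - _); apply: IH => i ni; apply: hg; lia.
Qed.

Lemma dif_morph (V W : zmodType) (f : V -> W) n h :
  {morph f : x y / x - y} -> f (dif n h) = dif n (f \o h).
Proof. by move=> fB; elim: n h => [//|n IH] h /=; rewrite fB !IH. Qed.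

Lemma difD (V : zmodType) n (h g : nat -> V) :
  dif n (fun i => h i + g i) = dif n h + dif n g.
Proof.
elim: n h g => [//|n IH] h g /=; rewrite !IH opprD.
by rewrite addrACA.
Qed.

Lemma dif0 (V : zmodType) n : dif n (fun=> 0 : V) = 0.
Proof. by elim: n => [//|n /= ->]; rewrite subrr. Qed.

Lemma dif_sum (V : zmodType) n K (h : nat -> nat -> V) :
  dif n (fun i => \sum_(k < K) h k i) = \sum_(k < K) dif n (h k).
Proof.
elim: K => [|K IH].
  by rewrite big_ord0 -[RHS](dif0 V n); apply: eq_dif => i _; rewrite big_ord0.
rewrite big_ord_recr /= -IH -difD; apply: eq_dif => i _.
by rewrite big_ord_recr.
Qed.

Lemma dif_pow n k (c : R) : (k < n)%N -> dif n (fun i => (c + i%:R) ^+ k) = 0.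
Proof.
elim: n k => [//|n IH] k kn /=.
apply/eqP; rewrite subr_eq0 eq_sym; apply/eqP.
rewrite (@eq_dif _ _ (fun i => (c + i.+1%:R) ^+ k)
  (fun i => (c + i%:R) ^+ k + \sum_(j < k) (c + i%:R) ^+ j *+ 'C(k, j))); last first.
  move=> i _; rewrite -natr1 addrA [RHS]addrC.
  by rewrite addrC exprDn big_ord_recr /= subnn expr0 mul1r binn mulr1n;
     congr (_ + _); apply: eq_bigr => j _; rewrite expr1n mul1r.
rewrite difD (@dif_sum _ n k (fun j i => (c + i%:R) ^+ j *+ 'C(k, j))) big1 ?addr0 // => j _.
have -> : (fun i : nat => (c + i%:R) ^+ j *+ 'C(k, j)) =
          (fun x : R => x *+ 'C(k, j)) \o (fun i => (c + i%:R) ^+ j) by [].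
rewrite -(@dif_morph _ _ (fun x : R => x *+ 'C(k, j))); last by move=> x y; rewrite mulrnBl.
by rewrite IH ?mul0rn //; have := ltn_ord j; lia.
Qed.

(** A partial fraction expansion; it yields the normaliser [mixZ] in closed form. *)
Lemma dif_inv n (c : R) : 0 < c ->
  dif n (fun i => (c + i%:R)^-1) = n`!%:R / \prod_(j < n.+1) (c + j%:R).
Proof.
elim: n c => [|n IH] c c0 /=; first by rewrite big_ord1 addr0 div1r.
rewrite IH //; have c1 : 0 < c + 1 by lra.
rewrite (@eq_dif _ _ (fun i => (c + i.+1%:R)^-1) (fun i => (c + 1 + i%:R)^-1)); last first.
  by move=> i _; rewrite -addrA (addrC 1) natr1.
rewrite IH // big_ord_recl [X in _ - _ / X]big_ord_recr [in RHS]big_ord_recl [X in _ = _ / (_ * X)]big_ord_recr /=.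
rewrite (eq_bigr (fun i : 'I_n => c + 1 + i%:R)); last first.
  by move=> i _; rewrite /bump /= -addrA (addrC 1) natr1.
have p0 : \prod_(i < n) (c + 1 + i%:R) != 0.
  by rewrite gt_eqF // prodr_gt0 // => i _; rewrite ltr_wpDr.
have n0 : c + n.+1%:R != 0 by rewrite gt_eqF // ltr_wpDr.
rewrite /bump /= add1n addr0 -addrA (addrC 1) natr1 factS natrM.
move: n0; rewrite -natr1 => n0; field.
by rewrite n0 p0 gt_eqF.
Qed.

Lemma norm_dif n (h : nat -> R) B : (forall i, (i <= n)%N -> `|h i| <= B) ->
  `|dif n h| <= 2 ^+ n * B.
Proof.
elim: n h => [|n IH] h hB /=; first by rewrite mul1r hB.
rewrite (le_trans (ler_normB _ _)) // exprS -mulrA mulr_natl mulr2n lerD //.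
  by apply: IH => i ni; apply: hB; lia.
by apply: IH => i ni; apply: hB; lia.
Qed.

(** Each difference costs a factor 4 in mean square, by (u - v)^2 <= 2 u^2 + 2 v^2. *)
Lemma mean_sqr_dif n (h : nat -> {poly R}) (U : {poly R}) B :
  (forall x, -1 <= x <= 1 -> 0 <= U.[x]) ->
  (forall i, (i <= n)%N -> mean (U * (h i * h i)) <= B) ->
  mean (U * (dif n h * dif n h)) <= 4 ^+ n * B.
Proof.
move=> U0; elim: n h => [|n IH] h hB /=; first by rewrite mul1r hB.
set u := dif n h; set v := dif n _.
apply: (@le_trans _ _ (mean ((U * (u * u) + U * (v * v)) *+ 2))).
  apply: mean_le => x hx; rewrite -subr_ge0 -hornerN -hornerD.
  have -> : (U * (u * u) + U * (v * v)) *+ 2 - U * ((u - v) * (u - v)) = U * ((u + v) * (u + v)) by ring.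
  by rewrite !hornerM mulr_ge0 ?U0 // -expr2 sqr_ge0.
rewrite meanMn meanD.
have h1 : mean (U * (u * u)) <= 4 ^+ n * B by apply: IH => i ni; apply: hB; lia.
have h2 : mean (U * (v * v)) <= 4 ^+ n * B by apply: IH => i ni; apply: hB; lia.
by rewrite exprS; move: h1 h2; set X := 4 ^+ n * B; rewrite mulr2n -mulrA -/X; lra.
Qed.

Lemma fact_double_le n : ((n + n)`! <= 4 ^ n * (n`! * n`!))%N.
Proof.
elim: n => [//|n IH].
rewrite addSn addnS !factS expnS.
have : (4 * ((n + n)`! * (n.+1 * n.+1)) <= 4 * (4 ^ n * (n`! * n`!) * (n.+1 * n.+1)))%N.
  by rewrite leq_pmul2l // leq_pmul2r.
nia.
Qed.

Definition node L (i : nat) : R := (L%:R + i%:R) / (2 * L%:R).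

Definition mixZ L : R := dif L (fun i => (node L i)^-1).

(* The moments of the signed weights proportional to (-1)^i 'C(L, i) / node i:
   the moments of orders 1, ..., L vanish, being L-th differences of
   polynomials of degree less than L. *)
Definition mixm L (k : nat) : R := (mixZ L)^-1 * dif L (fun i => (node L i)^-1 * node L i ^+ k).

Lemma node_bounds L i : (0 < L)%N -> (i <= L)%N -> 1 / 2 <= node L i <= 1.
Proof.
move=> L0 iL; have Lp : 0 < L%:R :> R by rewrite ltr0n.
have h1 : i%:R <= L%:R :> R by rewrite ler_nat.
have h0 : 0 <= i%:R :> R by rewrite ler0n.
rewrite /node; apply/andP; split.
  by rewrite ler_pdivlMr; lra.
by rewrite ler_pdivrMr; lra.
Qed.

(** The normaliser equals 2 / 'C(2L, L), and the central binomial coefficient is at most 4^L.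
    Dividing by it is therefore only exponentially expensive in L. *)
Lemma mixZ_ge L : (0 < L)%N -> 2 / 4 ^+ L <= mixZ L.
Proof.
move=> L0; have Lp : 0 < L%:R :> R by rewrite ltr0n.
have -> : mixZ L = 2 * L%:R * dif L (fun i => (L%:R + i%:R)^-1).
  transitivity (dif L ((fun x : R => 2 * L%:R * x) \o (fun i => (L%:R + i%:R)^-1))).
    by apply: eq_dif => i _; rewrite /node /= invf_div.
  by rewrite -(@dif_morph _ _ (fun x : R => 2 * L%:R * x)) // => x y; rewrite mulrBr.
rewrite dif_inv // big_ord_recl /= addr0.
have pe n : L`!%:R * \prod_(i < n) (L%:R + (bump 0 i)%:R) = (L + n)`!%:R :> R.
  elim: n => [|n IH]; first by rewrite big_ord0 mulr1 addn0.
  by rewrite big_ord_recr /= mulrA IH addnS factS natrM -natrD mulrC /bump /= add1n addnS.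
have p0 : 0 < \prod_(i < L) (L%:R + (bump 0 i)%:R) :> R.
  by apply: prodr_gt0 => i _; rewrite ltr_wpDr.
set P := \prod_(i < L) _ in p0 pe *.
have {}pe : P = (L + L)`!%:R / L`!%:R.
  by rewrite -pe mulrAC divff ?mul1r // pnatr_eq0 -lt0n fact_gt0.
have -> : 2 * L%:R * (L`!%:R / (L%:R * P)) = 2 * (L`!%:R / P) :> R.
  by field; rewrite !gt_eqF.
rewrite ler_pM2l // pe invf_div mulrA ler_pdivlMr ?ltr0n ?fact_gt0 //.
rewrite mulrC ler_pdivrMr ?exprn_gt0 // -natrX -!natrM ler_nat.
by have := fact_double_le L; lia.
Qed.

Lemma mixZ_gt0 L : (0 < L)%N -> 0 < mixZ L.
Proof. by move=> /mixZ_ge; apply: lt_le_trans; rewrite divr_gt0 ?exprn_gt0. Qed.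

Lemma invmixZ_le L : (0 < L)%N -> (mixZ L)^-1 <= 4 ^+ L / 2.
Proof.
move=> L0; rewrite -[leRHS]invrK lef_pV2 ?posrE ?mixZ_gt0 //.
by rewrite invf_div mixZ_ge.
Qed.

Lemma mixm0 L : (0 < L)%N -> mixm L 0 = 1.
Proof.
move=> L0; rewrite /mixm (@eq_dif _ _ _ (fun i => (node L i)^-1)).
  by rewrite -/(mixZ L) mulVf // gt_eqF // mixZ_gt0.
by move=> i _; rewrite expr0 mulr1.
Qed.

Lemma node_pred L i k : (0 < L)%N -> (i <= L)%N -> (node L i)^-1 * node L i ^+ k.+1 = node L i ^+ k.
Proof.
move=> L0 iL; rewrite exprS mulrA mulVf ?mul1r // gt_eqF //.
by have := node_bounds L0 iL; lra.
Qed.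

Lemma mixm_eq0 L k : (0 < L)%N -> (0 < k <= L)%N -> mixm L k = 0.
Proof.
case: k => // k L0 /= kL; rewrite /mixm (@eq_dif _ _ _ (fun i => node L i ^+ k)).
  rewrite (@eq_dif _ _ _ ((fun x : R => x * (2 * L%:R) ^- k) \o (fun i => (L%:R + i%:R) ^+ k))).
    rewrite -(@dif_morph _ _ (fun x : R => x * (2 * L%:R) ^- k)).
      by rewrite dif_pow // mul0r mulr0.
    by move=> x y; rewrite mulrBl.
  by move=> i _; rewrite /node /= expr_div_n.
by move=> i iL; rewrite node_pred.
Qed.

Lemma norm_mixm L k : (0 < L)%N -> `|mixm L k| <= 8 ^+ L.
Proof.
move=> L0; case: k => [|k].
  by rewrite mixm0 // normr1 exprn_ege1 // ler1n.
rewrite /mixm normrM gtr0_norm ?invr_gt0 ?mixZ_gt0 //.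
apply: (@le_trans _ _ ((4 ^+ L / 2) * (2 ^+ L * 1))).
  rewrite ler_pM // ?invr_ge0 ?(ltW (mixZ_gt0 L0)) ?invmixZ_le //.
  apply: norm_dif => i iL; rewrite node_pred // normrX.
  have [h1 h2] := andP (node_bounds L0 iL).
  by rewrite exprn_ile1 // ger0_norm //; lra.
have -> : 8 = 4 * 2 :> R by ring.
rewrite exprMn; have : 0 <= 4 ^+ L * 2 ^+ L :> R by rewrite mulr_ge0 // exprn_ge0.
lra.
Qed.

End FiniteDifferences.

(** * Polynomial cut-offs *)

Section CutPoly.
Variable R : realType.

Lemma bernoulli_le (u : R) k : 0 <= u <= 1 -> 1 - k%:R * u <= (1 - u) ^+ k.
Proof.
move=> /andP[u0 u1]; elim: k => [|k IH]; first by rewrite mul0r subr0.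
rewrite exprS.
have h : (1 - u) * (1 - k%:R * u) <= (1 - u) * (1 - u) ^+ k by rewrite ler_wpM2l // subr_ge0.
apply: le_trans h; have : 0 <= k%:R * u * u by rewrite !mulr_ge0.
rewrite -natr1; lra.
Qed.

Lemma bernoulli_ge (u : R) k : 0 <= u <= 1 -> (1 - u) ^+ k * (1 + k%:R * u) <= 1.
Proof.
move=> /andP[u0 u1]; elim: k => [|k IH]; first by rewrite mul0r addr0 mulr1.
have p0 : 0 <= (1 - u) ^+ k by rewrite exprn_ge0 // subr_ge0.
apply: le_trans IH; rewrite exprS -subr_ge0 -natr1.
have -> : (1 - u) ^+ k * (1 + k%:R * u) - (1 - u) * (1 - u) ^+ k * (1 + (k%:R + 1) * u) =
   (1 - u) ^+ k * ((k%:R + 1) * u * u) by ring.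
by rewrite !mulr_ge0 // addr_ge0.
Qed.

(** The polynomial is (1 - y^m)^k with y = (a / A)^2 and A a bound of |a|. By Bernoulli's inequality
    it is near 1 where k y^m is small, and near 0 where k y^m is large. The values of y^m at |a| = d
    and |a| = d' have ratio (d / d')^(2m), so for m large one k, about the inverse of eta times the
    larger value, serves both regions. *)
Lemma cut_poly (a : {poly R}) (d d' eta : R) : 0 < d -> d < d' -> 0 < eta ->
  exists Q : {poly R}, forall x, -1 <= x <= 1 ->
    [/\ 0 <= Q.[x] <= 1, `|a.[x]| <= d -> 1 - eta <= Q.[x] &
        d' <= `|a.[x]| -> Q.[x] <= eta].
Proof.
move=> d0 dd' eta0; have d'0 : 0 < d' by lra.
have [A0 A0p hA0] := supI_ex a.
pose A := A0 + d'; have A_gt0 : 0 < A by rewrite /A; lra.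
pose t := (d / d') ^+ 2; pose y1 := (d / A) ^+ 2; pose y2 := (d' / A) ^+ 2.
have sq_lt1 (u v : R) : 0 < u -> u < v -> 0 <= (u / v) ^+ 2 < 1.
  move=> u0 uv; have v0 : 0 < v by lra.
  by rewrite sqr_ge0 expr_lt1 ?divr_ge0 ?ltW // ltr_pdivrMr // mul1r.
have /andP[t0 t1] : 0 <= t < 1 by apply: sq_lt1.
have /andP[y10 y11] : 0 <= y1 < 1 by apply: sq_lt1 => //; rewrite /A; lra.
have e2 : 0 < eta / 2 by rewrite divr_gt0.
have [m1 hm1] := ex_exprn_le y10 y11 e2.
have [m2 hm2] := ex_exprn_le t0 t1 (mulr_gt0 e2 eta0).
pose m := maxn m1 m2.
have y2p : 0 < y2 ^+ m by rewrite exprn_gt0 // exprn_gt0 // divr_gt0.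
have ep : 0 < eta * y2 ^+ m by rewrite mulr_gt0.
pose k := (Num.truncn (eta * y2 ^+ m)^-1).+1.
have k1 : (eta * y2 ^+ m)^-1 <= k%:R by rewrite ltW // truncnS_gt.
have k2 : k%:R <= (eta * y2 ^+ m)^-1 + 1.
  by rewrite /k -natr1 lerD2r truncn_le // invr_ge0 ltW.
have ty : y1 ^+ m = t ^+ m * y2 ^+ m.
  by rewrite -exprMn /y1 /t /y2 -exprMn; congr ((_ ^+ _) ^+ _); field; rewrite !gt_eqF.
have ky1 : k%:R * y1 ^+ m <= eta.
  have h1 : y1 ^+ m <= eta / 2 by apply: hm1; rewrite leq_maxl.
  have h2 : t ^+ m <= eta / 2 * eta by apply: hm2; rewrite leq_maxr.
  have h0 : 0 <= y1 ^+ m by rewrite exprn_ge0.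
  apply: le_trans (ler_wpM2r h0 k2) _; rewrite mulrDl mul1r.
  have -> : (eta * y2 ^+ m)^-1 * y1 ^+ m = t ^+ m / eta.
    by rewrite ty; field; rewrite !gt_eqF.
  have : t ^+ m / eta <= eta / 2 by rewrite ler_pdivrMr.
  lra.
exists ((1 - ((A^-1 *: a) ^+ 2) ^+ m) ^+ k) => x hx.
rewrite !hornerE.
set y := (_ * _) ^+ 2.
have yE : y = (`|a.[x]| / A) ^+ 2 by rewrite /y mulrC !exprMn -normrX ger0_norm ?sqr_ge0.
have aA : `|a.[x]| <= A by rewrite (le_trans (hA0 x hx)) // /A; lra.
have y01 : 0 <= y <= 1.
  rewrite yE sqr_ge0 expr_le1 //; last by rewrite divr_ge0 // ltW.
  by rewrite ler_pdivrMr ?mul1r.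
have [y0 yl1] := andP y01.
have ym : 0 <= y ^+ m <= 1 by rewrite exprn_ge0 // exprn_ile1.
have [ym0 ym1] := andP ym.
split.
- by rewrite exprn_ge0 ?subr_ge0 // exprn_ile1 ?subr_ge0 // gerBl.
- move=> ad; apply: le_trans (bernoulli_le k ym).
  rewrite lerD2l lerN2 (le_trans _ ky1) // ler_wpM2l // lerXn2r ?nnegrE //.
  by rewrite yE lerXn2r ?nnegrE ?divr_ge0 ?(ltW d0) ?(ltW d'0) ?(ltW A_gt0) // ler_pM2r ?invr_gt0.
- move=> da.
  have h2 : y2 ^+ m <= y ^+ m.
    rewrite lerXn2r ?nnegrE ?sqr_ge0 // yE lerXn2r ?nnegrE ?divr_ge0 ?(ltW d'0) ?(ltW A_gt0) //.
    by rewrite ler_pM2r ?invr_gt0.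
  have h3 : 1 <= eta * (1 + k%:R * y ^+ m).
    apply: (@le_trans _ _ (eta * (k%:R * y2 ^+ m))).
      by have := ler_wpM2l (ltW ep) k1; rewrite mulfV ?gt_eqF // mulrA (mulrAC eta) -mulrA.
    rewrite ler_pM2l // (le_trans (ler_wpM2l (ler0n R k) h2)) //; lra.
  have pos : 0 < 1 + k%:R * y ^+ m by rewrite ltr_pwDl // mulr_ge0.
  rewrite -(ler_pM2r pos); apply: le_trans h3; exact: bernoulli_ge.
Qed.

End CutPoly.

(** * Riesz products *)

Section RieszProducts.
Variable R : realType.
Implicit Types (U V phi : {poly R}) (m : nat -> R).

Lemma size_mul_le (P Q : {poly R}) a b :
  (size P <= a)%N -> (size Q <= b)%N -> (size (P * Q)%R <= a + b)%N.
Proof. by move=> Pa Qb; have := size_polyMleq P Q; lia. Qed.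

Lemma size_add_le (P Q : {poly R}) a :
  (size P <= a)%N -> (size Q <= a)%N -> (size (P + Q)%R <= a)%N.
Proof. by move=> Pa Qb; rewrite (leq_trans (size_polyD _ _)) // geq_max Pa. Qed.

Lemma size_scale_le c (P : {poly R}) a : (size P <= a)%N -> (size (c *: P)%R <= a)%N.
Proof. by move=> Pa; rewrite (leq_trans (size_scale_leq _ _)). Qed.

Lemma sum_dist_le nu K (g : nat -> R) b : (forall k, 0 <= g k) ->
  (forall K, \sum_(k < K) g k <= b) -> \sum_(k < K) g (ndist nu k) <= 2 * b.
Proof.
move=> g0 gb; apply: (@le_trans _ _ (\sum_(k < nu + K) g (ndist nu k))).
  rewrite -!(big_mkord xpredT (fun k => g (ndist nu k))).
  rewrite (@big_cat_nat _ _ _ K 0%N (nu + K)) ?leq_addl //=.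
  by rewrite lerDl sumr_ge0.
rewrite big_split_ord /= mulr_natl mulr2n lerD //.
  rewrite (reindex_inj rev_ord_inj) /=.
  apply: le_trans (gb nu.+1); rewrite big_ord_recl /= ler_wpDl //.
  apply: ler_sum => k _; rewrite /ndist /bump /=.
  by have := ltn_ord k; rewrite le_eqVlt => kn; apply/orP; left; apply/eqP; congr g; lia.
apply: le_trans (gb K); apply: ler_sum => k _.
by rewrite le_eqVlt; apply/orP; left; apply/eqP; congr g; rewrite /ndist; lia.
Qed.

(** The frequencies of A lie below d and those of T_nu B above, so the q-th powers add. The halved
    coefficients of B occur on both sides of nu, whence 2 (s / 2)^q. *)
Lemma qsum_split q s nu d (A B : {poly R}) al be : 0 < q -> 0 <= s ->
  (size A <= d)%N -> (size B <= d)%N -> (2 * d <= nu)%N ->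
  (forall K, \sum_(k < K) `|ccoef A k| `^ q <= al) ->
  (forall K, \sum_(k < K) `|ccoef B k| `^ q <= be) ->
  forall K, \sum_(k < K) `|ccoef (A + s *: (cheb R nu * B)) k| `^ q <= al + 2 * (s / 2) `^ q * be.
Proof.
move=> q0 s0 sA sB dnu hA hB K.
have key k : `|ccoef (A + s *: (cheb R nu * B)) k| `^ q <=
   `|ccoef A k| `^ q + (s / 2) `^ q * `|ccoef B (ndist nu k)| `^ q.
  rewrite ccoefD ccoefZ ccoef_chebM (ccoef_eq0 (P := B) (k := (nu + k)%N)); last by lia.
  rewrite add0r; case: (ltnP k d) => kd.
    rewrite (ccoef_eq0 (P := B)) ?mul0r ?mulr0 ?addr0; last by rewrite /ndist; lia.
    by rewrite lerDl mulr_ge0 ?powR_ge0.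
  rewrite (ccoef_eq0 (P := A)); last by lia.
  have -> : s * (ccoef B (ndist nu k) / 2) = (s / 2) * ccoef B (ndist nu k) by ring.
  rewrite add0r normrM powRM // ger0_norm; last by rewrite divr_ge0.
  by rewrite lerDr powR_ge0.
apply: le_trans (ler_sum _ (fun (k : 'I_K) _ => key k)) _.
rewrite big_split /=; apply: lerD; first exact: hA.
rewrite -mulr_sumr -mulrA mulrCA ler_wpM2l ?powR_ge0 //.
exact: (@sum_dist_le nu K (fun k => `|ccoef B k| `^ q)).
Qed.

(* The sum, over the subsets A of {0, ..., n - 1}, of
   [m #|A| * \prod_(j in A) psi j]. *)
Fixpoint symm (psi : nat -> {poly R}) n m : {poly R} :=
  if n is n'.+1 then symm psi n' m + psi n' * symm psi n' (fun k => m k.+1)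
  else (m 0%N)%:P.

Lemma eq_symm psi n m m' : m =1 m' -> symm psi n m = symm psi n m'.
Proof.
elim: n m m' => [|n IH] m m' h /=; first by rewrite h.
by rewrite (IH _ _ h) (IH (fun k => m k.+1) (fun k => m' k.+1)).
Qed.

Lemma symmB psi n m m' : symm psi n (fun k => m k - m' k) = symm psi n m - symm psi n m'.
Proof.
elim: n m m' => [|n IH] m m' /=; first by rewrite polyCB.
by rewrite IH (IH (fun k => m k.+1)); ring.
Qed.

Lemma symmZ psi n c m : symm psi n (fun k => c * m k) = c *: symm psi n m.
Proof.
elim: n m => [|n IH] m /=; first by rewrite polyCM mul_polyC.
by rewrite IH (IH (fun k => m k.+1)) scalerDr scalerAr.
Qed.

Lemma symm_pow psi n c : symm psi n (fun k => c ^+ k) = \prod_(j < n) (1 + c *: psi j).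
Proof.
elim: n => [|n IH] /=; first by rewrite big_ord0 expr0.
rewrite (@eq_symm _ _ (fun k => c ^+ k.+1) (fun k => c * c ^+ k)); last by move=> k; rewrite exprS.
by rewrite symmZ IH big_ord_recr /= mulrDr mulr1 -!scalerAr [psi n * _]mulrC.
Qed.

Lemma symm_dif psi n L (h : nat -> nat -> R) :
  symm psi n (fun k => dif L (fun i => h i k)) = dif L (fun i => symm psi n (h i)).
Proof.
elim: L h => [//|L IH] h /=; rewrite -(IH h) -(IH (fun i => h i.+1)) -symmB.
exact: eq_symm.
Qed.

Lemma symm_delta psi n : symm psi n (fun k => (k == 0%N)%:R) = 1.
Proof.
have s0 l m : (forall k, m k = 0) -> symm psi l m = 0.
  by elim: l m => [|l IH] m m0 /=; rewrite ?m0 // !IH ?mulr0 ?addr0.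
by elim: n => [//|n /= ->]; rewrite s0 ?mulr0 ?addr0.
Qed.

Definition lacunary d (nu : nat -> nat) N := forall n, (n < N)%N -> (4 * (d + \sum_(j < n) nu j) <= nu n)%N.

Lemma lacunary_ex d N : exists nu, lacunary d nu N.
Proof.
(* The frequencies below n add up to d (5^n - 1), so the required inequality is an equality. *)
exists (fun j => 4 * d * 5 ^ j)%N => n _.
have -> : (\sum_(j < n) 4 * d * 5 ^ j = d * (5 ^ n - 1))%N.
  elim: n => [|n IH]; first by rewrite big_ord0 subnn muln0.
  have := expn_gt0 5 n; rewrite big_ord_recr IH expnS /= => h; nia.
have := expn_gt0 5 n; nia.
Qed.

(** The factor of highest frequency is peeled off by [qsum_split]. Its part carrying T_nu has one
    more power of [phi] and shifted weights, hence a bound multiplied by r; the induction is on a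
    statement with a free power of [phi] and free weights. Each factor thus contributes 1 + r 2 (s /
    2)^q. *)
Lemma symm_qsum q s be mu (r : R) U phi (nu : nat -> nat) N d :
  0 < q -> 0 <= s -> 0 <= mu -> 0 <= r -> 0 <= be ->
  lacunary d nu N -> (size U + N * size phi <= d)%N ->
  (forall i, (i <= N)%N -> forall K, \sum_(k < K) `|ccoef (U * phi ^+ i) k| `^ q <= be) ->
  forall m, (forall k, `|m k| `^ q <= mu * r ^+ k) ->
  forall K, \sum_(k < K) `|ccoef (U * symm (fun j => s *: (phi * cheb R (nu j))) N m) k| `^ q
    <= mu * be * (1 + r * (2 * (s / 2) `^ q)) ^+ N.
Proof.
move=> q0 s0 mu0 r0 be0 lac sd hU m hm.
set psi := fun j => _.
have size_pow i : (size (U * phi ^+ i)%R <= size U + i * size phi)%N.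
  elim: i => [|i IH]; first by rewrite expr0 mulr1 mul0n addn0.
  by rewrite exprSr mulrA mulSn (addnC (size phi)) addnA; apply: size_mul_le.
have size_symm n i m' : (size (U * phi ^+ i * symm psi n m')%R <=
    size U + (i + n) * size phi + \sum_(j < n) nu j)%N.
  elim: n i m' => [|n IH] i m' /=.
    rewrite big_ord0 !addn0 mulrC mul_polyC; exact: size_scale_le.
  rewrite mulrDr; apply: size_add_le.
    by apply: leq_trans (IH _ _) _; rewrite big_ord_recr /=; nia.
  have -> : U * phi ^+ i * (psi n * symm psi n (fun k => m' k.+1)) =
     s *: (cheb R (nu n) * (U * phi ^+ i.+1 * symm psi n (fun k => m' k.+1))).
    by rewrite /psi -!scalerAl -!scalerAr exprSr; congr (_ *: _); ring.
  apply: size_scale_le; apply: leq_trans (size_polyMleq _ _) _; rewrite size_cheb.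
  by have := IH i.+1 (fun k => m' k.+1); rewrite big_ord_recr /=; nia.
set y := 2 * _; have y0 : 0 <= y by rewrite mulr_ge0 ?powR_ge0.
suff: forall n i m' mu', 0 <= mu' -> (i + n <= N)%N -> (forall k, `|m' k| `^ q <= mu' * r ^+ k) ->
  forall K, \sum_(k < K) `|ccoef (U * phi ^+ i * symm psi n m') k| `^ q <= mu' * be * (1 + r * y) ^+ n.
  by move=> /(_ N 0%N m mu mu0 (leqnn _) hm); rewrite expr0 mulr1.
elim=> [|n IH] i m' mu' mu'0 inN hm' K /=.
  rewrite mulrC mul_polyC expr0 mulr1.
  under eq_bigr => k _ do rewrite ccoefZ normrM powRM //.
  rewrite -mulr_sumr ler_pM ?powR_ge0 ?sumr_ge0 //.
  - by have := hm' 0%N; rewrite expr0 mulr1.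
  - by apply: hU; lia.
have -> : U * phi ^+ i * (symm psi n m' + psi n * symm psi n (fun k => m' k.+1)) =
   U * phi ^+ i * symm psi n m' +
     s *: (cheb R (nu n) * (U * phi ^+ i.+1 * symm psi n (fun k => m' k.+1))).
  rewrite mulrDr /psi -!scalerAl -!scalerAr exprSr; congr (_ + _ *: _); ring.
have nN : (n < N)%N by lia.
have lacn := lac n nN.
apply: (le_trans (@qsum_split q s (nu n) (d + \sum_(j < n) nu j) _ _
  (mu' * be * (1 + r * y) ^+ n) (mu' * r * be * (1 + r * y) ^+ n) q0 s0 _ _ _ _ _ K)).
- by apply: leq_trans (size_symm _ _ _) _; nia.
- by apply: leq_trans (size_symm _ _ _) _; nia.
- by lia.
- by apply: IH => //; lia.
- apply: IH; [by rewrite mulr_ge0 | by lia |].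
  by move=> k; rewrite (le_trans (hm' k.+1)) // exprS mulrA.
rewrite -/y exprS le_eqVlt; apply/orP; left; apply/eqP; ring.
Qed.

Lemma mean_chebX1 V nu : (size V <= nu)%N -> mean (V * cheb R nu) = 0.
Proof. by move=> h; rewrite -/(ccoef V nu) ccoef_eq0. Qed.

Lemma cheb_sqr nu : cheb R nu ^+ 2 = 2^-1 *: (cheb R (nu + nu) + 1).
Proof.
have := chebM_dist R nu nu; rewrite /ndist subnn cheb0 -scaler_nat -expr2 => <-.
by rewrite scalerA mulVf ?scale1r // pnatr_eq0.
Qed.

Lemma cheb_cube nu : cheb R nu ^+ 3 = 4^-1 *: (cheb R (nu + (nu + nu)) + 3 *: cheb R nu).
Proof.
have := chebM_dist R nu (nu + nu).
have -> : ndist nu (nu + nu) = nu by rewrite /ndist; lia.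
rewrite exprS cheb_sqr -scaler_nat => e.
have -> : cheb R (nu + (nu + nu)) = 2 *: (cheb R nu * cheb R (nu + nu)) - cheb R nu.
  by rewrite e addrK.
rewrite -scalerAr mulrDr mulr1 -!mul_polyC.
have -> : (2^-1)%:P = (4^-1)%:P * 2%:P :> {poly R} by rewrite -polyCM; congr (_%:P); field.
have -> : 3%:P = 2%:P + 1 :> {poly R} by rewrite -polyCD; congr (_%:P); ring.
ring.
Qed.

Lemma cheb_four nu :
  cheb R nu ^+ 4 = 8^-1 *: (cheb R (nu + nu + (nu + nu)) + 4 *: cheb R (nu + nu) + 3%:P).
Proof.
have Y : cheb R (nu + nu + (nu + nu)) = cheb R (nu + nu) ^+ 2 *+ 2 - 1.
  by rewrite cheb_sqr -scaler_nat scalerA divff ?scale1r ?addrK.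
rewrite (exprM _ 2 2) cheb_sqr Y -!mul_polyC.
set h := (2^-1)%:P; have e : h * 2 = 1.
  by rewrite -[2]/(2%:R) -polyC_natr -polyCM -polyC1; congr (_%:P); field.
have -> : (8^-1)%:P = h ^+ 3 by rewrite -rmorphXn; congr (_%:P); field.
have -> : 4%:P = 4 :> {poly R} by rewrite polyC_natr.
have -> : 3%:P = 3 :> {poly R} by rewrite polyC_natr.
set X := cheb R _.
have -> : h ^+ 3 * (X ^+ 2 *+ 2 - 1 + 4 * X + 3) = h ^+ 2 * (h * 2) * (X + 1) ^+ 2 by ring.
by rewrite e mulr1 exprMn.
Qed.

Lemma mean_chebX V nu : (size V <= nu)%N ->
  [/\ mean (V * cheb R nu) = 0, mean (V * cheb R nu ^+ 2) = mean V / 2,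
      mean (V * cheb R nu ^+ 3) = 0 & mean (V * cheb R nu ^+ 4) = 3 / 8 * mean V].
Proof.
move=> h; split; first exact: mean_chebX1.
- rewrite cheb_sqr -scalerAr meanZ mulrDr meanD mean_chebX1 ?mulr1 ?add0r; last by lia.
  by rewrite mulrC.
- rewrite cheb_cube -scalerAr meanZ mulrDr meanD -scalerAr meanZ !mean_chebX1 //; last by lia.
  by rewrite mulr0 addr0 mulr0.
have z1 : mean (V * cheb R (nu + nu)) = 0 by apply: mean_chebX1; lia.
have z2 : mean (V * cheb R (nu + nu + (nu + nu))) = 0 by apply: mean_chebX1; lia.
rewrite cheb_four -scalerAr meanZ !mulrDr !meanD -scalerAr meanZ z1 z2.
rewrite mulr0 !add0r [V * _]mulrC mul_polyC meanZ mulrA; congr (_ * _); by field.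
Qed.

(** Lacunarity acts as independence: what multiplies a power of the last T_nu has degree below nu,
    so that T, T^2, T^3, T^4 may be replaced by their averages 0, 1/2, 0, 3/8, one frequency after
    the other. *)
Lemma mean_lacunary_prod (p : nat -> {poly R}) w (nu : nat -> nat) N d V :
  (forall l, (l <= 4)%N -> (size (p l) <= w)%N) ->
  lacunary d nu N -> (size V + N * w <= d)%N ->
  mean (V * \prod_(j < N) \sum_(l < 5) p l * cheb R (nu j) ^+ l) =
  mean (V * (p 0%N + 2^-1 *: p 2%N + (3 / 8) *: p 4%N) ^+ N).
Proof.
move=> sp lac; set avg := p 0%N + _ + _.
have savg : (size avg <= w)%N.
  by apply: size_add_le; [apply: size_add_le|]; rewrite ?size_scale_le ?sp.
have sF j : (size (\sum_(l < 5) p l * cheb R (nu j) ^+ l)%R <= w + 4 * nu j)%N.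
  apply: (leq_trans (size_sum _ _ _)); apply/bigmax_leqP => l _.
  have hs : (size (cheb R (nu j) ^+ l)%R <= 4 * nu j + 1)%N.
    have h := size_poly_exp_leq (cheb R (nu j)) l; rewrite size_cheb in h.
    by have := ltn_ord l; nia.
  have := size_polyMleq (p l) (cheb R (nu j) ^+ l); have := sp l (ltn_ord l); lia.
have sprod n W : (size (W * \prod_(j < n) \sum_(l < 5) p l * cheb R (nu j) ^+ l)%R <=
    size W + n * w + 4 * \sum_(j < n) nu j)%N.
  elim: n => [|n IH]; first by rewrite !big_ord0 mulr1; lia.
  rewrite [\prod_(j < n.+1) _]big_ord_recr [(\sum_(j < n.+1) _)%N]big_ord_recr /= mulrA.
  by apply: leq_trans (size_mul_le IH (sF n)) _; move: (\sum_(j < n) nu j)%N (size W) (nu n) => a b c; nia.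
suff: forall n (W : {poly R}), (n <= N)%N -> (size W + n * w <= d)%N ->
   mean (W * \prod_(j < n) \sum_(l < 5) p l * cheb R (nu j) ^+ l) = mean (W * avg ^+ n).
  by apply.
elim=> [|n IH] W nN sW; first by rewrite big_ord0 expr0.
rewrite big_ord_recr /= mulrA.
set W' := W * \prod_(j < n) _.
have sW' l : (l <= 4)%N -> (size (W' * p l)%R <= nu n)%N.
  move=> l4; apply: leq_trans (size_mul_le (sprod n W) (sp l l4)) _.
  have := lac n nN; nia.
rewrite mulr_sumr mean_sum.
rewrite (eq_bigr (fun l : 'I_5 => mean (W' * p l * cheb R (nu n) ^+ l))); last by move=> l _; rewrite mulrA.
rewrite !big_ord_recl big_ord0 /= /bump /= expr0 mulr1 expr1.
have [-> _ _ _] := mean_chebX (sW' 1%N isT).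
have [_ -> _ _] := mean_chebX (sW' 2%N isT).
have [_ _ -> _] := mean_chebX (sW' 3%N isT).
have [_ _ _ ->] := mean_chebX (sW' 4%N isT).
rewrite exprS mulrA -IH; [|lia|by have := size_mul_le (leqnn (size W)) savg; lia].
have -> : mean (W * avg * \prod_(j < n) \sum_(l < 5) p l * cheb R (nu j) ^+ l) =
    mean (W' * p 0%N) + 2^-1 * mean (W' * p 2%N) + 3 / 8 * mean (W' * p 4%N).
  rewrite [W * avg * _]mulrAC -/W'.
  have -> : W' * avg = W' * p 0%N + 2^-1 *: (W' * p 2%N) + (3 / 8) *: (W' * p 4%N).
    by rewrite !mulrDr -!scalerAr.
  by rewrite !meanD !meanZ.
by field.
Qed.

(* exp (- Y) >= (1 - Y / 4)^4, and the product of this quartic with the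
   right-hand side is at least 1. *)
Lemma expR_le_quad (Y : R) : `|Y| <= 1 / 25 -> expR Y <= 1 + Y + 13 / 20 * Y ^+ 2.
Proof.
rewrite ler_norml => /andP[Y1 Y2].
pose v := Y / 4; pose u := 1 - v.
have Yv : Y = 4 * v by rewrite /v; field.
have v1 : -1 / 100 <= v by rewrite /v; lra.
have v2 : v <= 1 / 100 by rewrite /v; lra.
have u0 : 0 < u by rewrite /u; lra.
have h : u ^+ 4 <= expR (- Y).
  have -> : - Y = (- v) * 4%:R by rewrite /v; field.
  rewrite expRM_natr lerXn2r ?nnegrE ?expR_ge0 ?(ltW u0) //.
  exact: expR_ge1Dx.
have e : expR Y * expR (- Y) = 1 by rewrite expRN mulfV // gt_eqF ?expR_gt0.
have k : 1 <= u ^+ 4 * (1 + Y + 13 / 20 * Y ^+ 2).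
  have -> : u ^+ 4 * (1 + Y + 13 / 20 * Y ^+ 2) = 1 + v ^+ 2 * ((2 - 108 * v +
     v ^+ 2 * (237 - 188 * v + 52 * v ^+ 2)) / 5).
    by rewrite Yv /u; field.
  have sq0 : 0 <= v ^+ 2 by rewrite sqr_ge0.
  have k2 : 0 <= v ^+ 2 * (237 - 188 * v + 52 * v ^+ 2).
    by apply: mulr_ge0; [exact: sq0 | clear -v2 sq0; clearbody v; lra].
  rewrite lerDl; apply: mulr_ge0; [exact: sq0 | apply: divr_ge0; last by []].
  by clear -v2 k2; clearbody v; lra.
have w0 : 0 <= 1 + Y + 13 / 20 * Y ^+ 2 by have : 0 <= Y ^+ 2 by [rewrite sqr_ge0]; lra.
rewrite -[leLHS]mulr1 (le_trans (ler_wpM2l (expR_ge0 _) k)) // mulrA ler_piMl // -e.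
by rewrite ler_wpM2l ?expR_ge0.
Qed.

Lemma prod_quad_ge1 n (Y : 'I_n -> R) : (forall j, `|Y j| <= 1 / 25) ->
  0 <= \sum_j Y j -> 1 <= \prod_j (1 + Y j + 13 / 20 * Y j ^+ 2).
Proof.
move=> hY sY; apply: (@le_trans _ _ (\prod_j expR (Y j))).
  by rewrite -expR_sum -[leLHS](@expR0 R) ler_expR.
by apply: ler_prod => j _; rewrite expR_ge0 expR_le_quad.
Qed.

(* The average over a full period of
   [(1 + sigma s w cos)^2 (1 + Y + 13/20 Y^2)], [Y = s cos - s^2 (w + 31/32)]. *)
Definition avgfac (s sigma w : R) : R :=
  let z := w + 31 / 32 in let u := sigma * s * w in
  let e0 := 1 - s ^+ 2 * z + 13 / 20 * s ^+ 4 * z ^+ 2 in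
  let e1 := s - 13 / 10 * s ^+ 3 * z in
  let e2 := 13 / 20 * s ^+ 2 in
  e0 + (e2 + 2 * u * e1 + u ^+ 2 * e0) / 2 + 3 / 8 * (u ^+ 2 * e2).

Lemma norm_mul_le (x y a b : R) : `|x| <= a -> `|y| <= b -> `|x * y| <= a * b.
Proof. by move=> xa yb; rewrite normrM ler_pM. Qed.

(** The exponential moment estimate for one frequency. With v = sigma w and z = w + 31/32, the
    coefficient of s^2 is v^2 / 2 + v - z + 13/40: the mean of the squared factor, its tilt, the
    threshold, and the quadratic term of the weight. It is negative enough to absorb the terms of
    order s^4. *)
Lemma avgfac_bounds s sigma w : 0 < s <= 1 / 32 -> 1 / 2 <= sigma <= 1 -> -1 <= w <= 1 ->
  0 <= avgfac s sigma w <= 1 - s ^+ 2 / 200.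
Proof.
move=> /andP[s0 s1] /andP[g0 g1] /andP[w0 w1].
pose t := s ^+ 2.
have t0 : 0 <= t by rewrite sqr_ge0.
have t1 : t <= 1 / 1000.
  apply: (@le_trans _ _ ((1 / 32) ^+ 2)); last by lra.
  by rewrite lerXn2r ?nnegrE //; lra.
pose z := w + 31 / 32; pose v := sigma * w.
pose A := v ^+ 2 / 2 + v - z + 13 / 40.
pose B := 13 / 20 * z ^+ 2 - 13 / 10 * (v * z) - (v ^+ 2 * z) / 2 +
  13 / 40 * (t * (v ^+ 2 * z ^+ 2)) + 39 / 160 * v ^+ 2.
have -> : avgfac s sigma w = 1 + t * A + t * (t * B).
  by rewrite /avgfac /A /B /t /v /z; field.
have wn : `|w| <= 1 by rewrite ler_norml w0.
have vn : `|v| <= 1 * 1 by apply: norm_mul_le => //; rewrite ger0_norm //; lra.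
have zn : `|z| <= 2 by rewrite ler_norml /z; lra.
have vv := norm_mul_le vn vn; have zz := norm_mul_le zn zn; have vz := norm_mul_le vn zn.
have vvz := norm_mul_le vv zn; have vvzz := norm_mul_le vv zz.
have tn : `|t| <= 1 / 1000 by rewrite ger0_norm.
have tvvzz := norm_mul_le tn vvzz.
rewrite -!expr2 in vv zz vvz vvzz tvvzz.
(* From v - w <= 1 - sigma and v^2 <= sigma^2, A is at most sigma^2 / 2 - sigma + 1/32 + 13/40. On
   [1/2, 1] this is largest at sigma = 1/2, where it equals -3/160; here the lower end of the nodes
   and the tolerance 31/32 meet. *)
have A1 : A <= - (3 / 160).
  have h1 : v ^+ 2 <= sigma ^+ 2.
    rewrite /v exprMn ler_piMr ?sqr_ge0 // -real_normK ?num_real //.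
    by rewrite expr_le1.
  have h2 : v - w <= 1 - sigma.
    have : 0 <= (1 - sigma) * (1 + w) by clear -g1 w0; rewrite mulr_ge0 //; lra.
    by clear; rewrite /v; lra.
  have h3 : 0 <= (sigma - 1 / 2) * (3 / 2 - sigma) by clear -g0 g1; rewrite mulr_ge0 //; lra.
  by clear -h1 h2 h3; rewrite !expr2 in h1; rewrite /A /z expr2; lra.
have A2 : -4 <= A.
  by have : 0 <= v ^+ 2; [rewrite sqr_ge0|move: vn zn; rewrite /A !ler_norml; clear; lra].
have B1 : `|B| <= 10 by move: vv zz vz vvz tvvzz; rewrite /B !ler_norml; clear; lra.
have tB := norm_mul_le tn B1; move: tB; rewrite ler_norml => /andP[C1 C2].
have D1 : t * (A + t * B) <= t * (- (1 / 200)) by rewrite ler_wpM2l //; clear -A1 C2; lra.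
have D2 : t * (- 5) <= t * (A + t * B) by rewrite ler_wpM2l //; clear -A2 C1; lra.
by rewrite -/t; clear -t1 D1 D2; apply/andP; split; lra.
Qed.

End RieszProducts.

(** * Averages of Riesz products *)

Section Mixture.
Variable R : realType.
Implicit Types (S U phi : {poly R}) (s : R).

Lemma horner_one (x : R) : (1 : {poly R}).[x] = 1.
Proof. by rewrite -polyC1 hornerC. Qed.

Local Notation hornerW := (hornerD, hornerN, hornerM, hornerZ, hornerC, horner_exp,
  hornerMn, horner_one).

Definition rpsi s phi (nu : nat -> nat) j : {poly R} := s *: (phi * cheb R (nu j)).

Definition riesz s phi nu N (sigma : R) : {poly R} :=
  \prod_(j < N) (1 + sigma *: rpsi s phi nu j).

Definition mixture s phi nu N L : {poly R} := symm (rpsi s phi nu) N (mixm R L).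

Lemma mixtureE s phi nu N L : mixture s phi nu N L =
  (mixZ R L)^-1 *: dif L (fun i => (node R L i)^-1 *: riesz s phi nu N (node R L i)).
Proof.
rewrite /mixture /mixm symmZ symm_dif; congr (_ *: _); apply: eq_dif => i _.
by rewrite symmZ symm_pow.
Qed.

(** 64^L is 16^L from the squared normaliser times 4^L from squaring an L-th difference. The inverse
    nodes, at most 2, are offset by the halves in [invmixZ_le]. *)
Lemma mean_mixture_sqr s phi nu N L U b : (0 < L)%N ->
  (forall x, -1 <= x <= 1 -> 0 <= U.[x]) -> 0 <= b ->
  (forall i, (i <= L)%N ->
    mean (U * (riesz s phi nu N (node R L i) * riesz s phi nu N (node R L i))) <= b) ->
  mean (U * (mixture s phi nu N L * mixture s phi nu N L)) <= 64 ^+ L * b.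
Proof.
move=> L0 U0 b0 h; rewrite mixtureE; set D := dif L _.
have -> : U * ((mixZ R L)^-1 *: D * ((mixZ R L)^-1 *: D)) = (mixZ R L)^-1 ^+ 2 *: (U * (D * D)).
  by rewrite -!scalerAl -!scalerAr scalerA expr2.
rewrite meanZ.
apply: (@le_trans _ _ ((4 ^+ L / 2) ^+ 2 * (4 ^+ L * (4 * b)))); last first.
  have -> : 64 = 4 * 4 * 4 :> R by ring.
  rewrite !exprMn le_eqVlt; apply/orP; left; apply/eqP; by field.
have z0 := ltW (mixZ_gt0 R L0).
apply: (@le_trans _ _ ((mixZ R L)^-1 ^+ 2 * (4 ^+ L * (4 * b)))); last first.
  apply: ler_wpM2r; first by rewrite !mulr_ge0 // exprn_ge0.
  by rewrite lerXn2r ?nnegrE ?invr_ge0 ?invmixZ_le // divr_ge0 // exprn_ge0.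
apply: ler_wpM2l; first by rewrite exprn_ge0 // invr_ge0.
apply: mean_sqr_dif => // i iL.
rewrite -!scalerAl -!scalerAr !scalerA meanZ.
have [n0 _] := andP (node_bounds R L0 iL).
have n1 : 0 <= (node R L i)^-1 <= 2.
  have np : 0 < node R L i by lra.
  rewrite invr_ge0 (ltW np) /= -[leRHS]invrK lef_pV2 ?posrE //; lra.
have [n2 n3] := andP n1.
apply: ler_pM => //; first by rewrite mulr_ge0.
- rewrite -(meanC 0); apply: mean_le => x hx; rewrite hornerC !hornerM mulr_ge0 ?U0 //.
  by rewrite -expr2 sqr_ge0.
- by have -> : 4 = 2 * 2 :> R by [ring]; apply: ler_pM.
- by rewrite h.
Qed.

(** A crude pointwise bound; it serves where |phi| > 1, where the truncated multiplier can be made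
    small enough to absorb it. *)
Lemma norm_mixture s phi nu N L x c : (0 < L)%N -> 0 <= s -> -1 <= x <= 1 ->
  `|phi.[x]| <= c -> `|(mixture s phi nu N L).[x]| <= 8 ^+ L * (1 + s * c) ^+ N.
Proof.
move=> L0 s0 hx hc; have c0 : 0 <= c by rewrite (le_trans _ hc).
rewrite mixtureE hornerZ normrM ger0_norm ?invr_ge0 ?(ltW (mixZ_gt0 R L0)) //.
rewrite (@dif_morph _ _ (fun P => P.[x])); last by move=> P Q; rewrite !hornerE.
apply: (@le_trans _ _ ((4 ^+ L / 2) * (2 ^+ L * (2 * (1 + s * c) ^+ N)))); last first.
  have -> : 8 = 4 * 2 :> R by ring.
  rewrite exprMn le_eqVlt; apply/orP; left; apply/eqP; by field.
apply: ler_pM => //; rewrite ?invr_ge0 ?(ltW (mixZ_gt0 R L0)) ?invmixZ_le //.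
apply: norm_dif => i iL /=; have [n0 n1] := andP (node_bounds R L0 iL).
have np : 0 < node R L i by lra.
rewrite hornerZ normrM; apply: ler_pM => //.
  rewrite ger0_norm ?invr_ge0 ?(ltW np) // -[leRHS]invrK lef_pV2 ?posrE //; lra.
rewrite /riesz horner_prod normr_prod.
apply: (@le_trans _ _ (\prod_(j < N) (1 + s * c))); last by rewrite prodr_const card_ord.
apply: ler_prod => j _; rewrite normr_ge0 /=.
move: (node R L i) n0 n1 np => sg n0 n1 np.
rewrite /rpsi !hornerW (le_trans (ler_normD _ _)) // normr1 lerD2l.
rewrite !normrM (ger0_norm s0) (gtr0_norm np) -[leRHS]mul1r; apply: ler_pM => //.
- exact: ltW.
- by rewrite !mulr_ge0.
apply: ler_wpM2l => //; rewrite -[leRHS]mulr1; apply: ler_pM => //.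
exact: cheb_supI.
Qed.

(** Subtracting U removes the order 0, and the orders 1, ..., L have weight 0. Beyond L the weights
    are at most 8^L, so their q-th powers are at most (8^L)^q rr^(k - L), the geometric form that
    [symm_qsum] requires. *)
Lemma mixture_qnorm q s be phi nu N L d (rr : R) U :
  0 < q -> 0 <= s -> 1 <= rr -> 0 <= be -> (0 < L)%N ->
  lacunary d nu N -> (size U + N * size phi <= d)%N ->
  (forall i, (i <= N)%N -> forall K, \sum_(k < K) `|ccoef (U * phi ^+ i) k| `^ q <= be) ->
  forall K, \sum_(k < K) `|ccoef (U * mixture s phi nu N L - U) k| `^ q <=
    (8 ^+ L) `^ q / rr ^+ L * be * (1 + rr * (2 * (s / 2) `^ q)) ^+ N.
Proof.
move=> q0 s0 r1 be0 L0 lac sd hU K.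
have r0 : 0 < rr by lra.
have -> : U * mixture s phi nu N L - U =
  U * symm (fun j => s *: (phi * cheb R (nu j))) N (fun k => mixm R L k - (k == 0%N)%:R).
  by rewrite symmB symm_delta mulrBr mulr1.
apply: (symm_qsum q0 s0 _ (ltW r0) be0 lac sd hU).
  by rewrite divr_ge0 ?powR_ge0 // exprn_ge0 // ltW.
move=> k.
have rhs0 : 0 <= (8 ^+ L) `^ q / rr ^+ L * rr ^+ k.
  by rewrite mulr_ge0 ?divr_ge0 ?powR_ge0 ?exprn_ge0 // ltW.
case: k rhs0 => [|k] rhs0; first by rewrite mixm0 // subrr normr0 powR0 // gt_eqF.
rewrite subr0; case: (leqP k.+1 L) => kL.
  by rewrite mixm_eq0 // normr0 powR0 // gt_eqF.
apply: (@le_trans _ _ ((8 ^+ L) `^ q)).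
  by apply: ge0_ler_powR; rewrite ?nnegrE ?exprn_ge0 ?norm_mixm // ltW.
rewrite -mulrA ler_peMr ?powR_ge0 // -(subnK (ltnW kL)) exprD mulrCA mulVf ?mulr1.
  by rewrite exprn_ege1.
by rewrite gt_eqF // exprn_gt0.
Qed.

(* [quadw] dominates exp (quadY), so that [wprod] is at least 1 where the sum of
   the exponents is nonnegative; ell is 1 or -1. *)
Definition quadY s ell phi (T : {poly R}) : {poly R} :=
  ell%:P * s%:P * T - s%:P ^+ 2 * (ell%:P * phi + (31 / 32)%:P).
Definition quadw s ell phi T : {poly R} :=
  1 + quadY s ell phi T + (13 / 20)%:P * quadY s ell phi T ^+ 2.
Definition wprod s ell phi (nu : nat -> nat) N : {poly R} :=
  \prod_(j < N) quadw s ell phi (cheb R (nu j)).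

(* The coefficients, as a polynomial of degree 4 in T, of
   (1 + sigma s phi T)^2 [quadw s ell phi T]. *)
Definition pfac s sigma ell phi : seq {poly R} :=
  let z := ell%:P * phi + (31 / 32)%:P in
  let u := sigma%:P * s%:P * phi in
  let k := (13 / 20)%:P in
  let e0 := 1 - s%:P ^+ 2 * z + k * s%:P ^+ 4 * z ^+ 2 in
  let e1 := ell%:P * s%:P - 2 * k * ell%:P * s%:P ^+ 3 * z in
  let e2 := k * ell%:P ^+ 2 * s%:P ^+ 2 in
  [:: e0; e1 + 2 * u * e0; e2 + 2 * u * e1 + u ^+ 2 * e0;
      2 * u * e2 + u ^+ 2 * e1; u ^+ 2 * e2].

Lemma pfacE s sigma ell phi T :
  (1 + sigma *: (s *: (phi * T))) * (1 + sigma *: (s *: (phi * T))) * quadw s ell phi T =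
  \sum_(l < 5) nth 0 (pfac s sigma ell phi) l * T ^+ l.
Proof.
rewrite !big_ord_recl big_ord0 /= /bump /= /quadw /quadY -!mul_polyC.
move: sigma%:P s%:P ell%:P (13 / 20)%:P (31 / 32)%:P => G S E K X; ring.
Qed.

(* The averages of T, T^2, T^3, T^4 for T = cos are 0, 1/2, 0, 3/8. *)
Definition avgpoly s sigma ell phi : {poly R} :=
  let p := nth 0 (pfac s sigma ell phi) in
  p 0%N + 2^-1 *: p 2%N + (3 / 8) *: p 4%N.

Lemma avgpolyE s sigma ell phi x : ell = 1 \/ ell = -1 ->
  (avgpoly s sigma ell phi).[x] = avgfac s sigma (ell * phi.[x]).
Proof.
rewrite /avgpoly /avgfac /= => -[] ->; rewrite !hornerW.
all: by field.
Qed.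

Lemma mean_riesz_wprod s phi nu N sigma ell d w U :
  lacunary d nu N ->
  (forall l, (l <= 4)%N -> (size (nth 0 (pfac s sigma ell phi) l)%R <= w)%N) ->
  (size U + N * w <= d)%N ->
  mean (U * (riesz s phi nu N sigma * riesz s phi nu N sigma * wprod s ell phi nu N)) =
  mean (U * avgpoly s sigma ell phi ^+ N).
Proof.
move=> lac sp sU; rewrite -(mean_lacunary_prod sp lac sU); congr (mean (U * _)).
by rewrite /riesz /wprod -!big_split /=; apply: eq_bigr => j _; rewrite pfacE.
Qed.

Lemma wprod_ge0 s ell phi nu N x : 0 <= (wprod s ell phi nu N).[x].
Proof.
rewrite /wprod horner_prod prodr_ge0 // => j _.
rewrite /quadw; move: (quadY _ _ _ _) => Q; rewrite !hornerW; set Y := Q.[x].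
have : 0 <= (1 + Y / 2) ^+ 2 by rewrite sqr_ge0.
have : 0 <= Y ^+ 2 by rewrite sqr_ge0.
rewrite !expr2; lra.
Qed.

Definition lacmean s (nu : nat -> nat) N : {poly R} :=
  (N%:R * s)^-1 *: \sum_(j < N) cheb R (nu j).

(** The exponents add up to N s^2 (ell (g - phi) - 31/32), g being the lacunary mean. So [wprod]
    dominates the indicator of a one-sided deviation of g from phi, and ell selects the side. *)
Lemma wprod_ge1 s ell phi nu N x : 0 < s <= 1 / 32 -> ell = 1 \/ ell = -1 -> (0 < N)%N ->
  -1 <= x <= 1 -> `|phi.[x]| <= 1 ->
  31 / 32 < ell * ((lacmean s nu N).[x] - phi.[x]) -> 1 <= (wprod s ell phi nu N).[x].
Proof.
move=> /andP[s0 s1] hell N0 hx hphi hbad.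
have en : `|ell| = 1 by case: hell => ->; rewrite ?normrN normr1.
rewrite /wprod horner_prod.
pose Y (j : 'I_N) := (quadY s ell phi (cheb R (nu j))).[x].
rewrite (eq_bigr (fun j => 1 + Y j + 13 / 20 * Y j ^+ 2)); last first.
  by move=> j _; rewrite /Y /quadw; move: (quadY _ _ _ _) => Q; rewrite !hornerW.
have YE j : Y j = s * (ell * (cheb R (nu j)).[x]) - s ^+ 2 * (ell * phi.[x] + 31 / 32).
  by rewrite /Y /quadY !hornerW; ring.
apply: prod_quad_ge1.
  move=> j; rewrite YE; have h1 : `|ell * (cheb R (nu j)).[x]| <= 1.
    by rewrite normrM en mul1r cheb_supI.
  have h2 : `|ell * phi.[x] + 31 / 32| <= 2.
    rewrite (le_trans (ler_normD _ _)) // normrM en mul1r (ger0_norm (x := 31 / 32)); lra.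
  have sn : `|s| <= 1 / 32 by rewrite gtr0_norm.
  have ssn := norm_mul_le sn sn; rewrite -expr2 in ssn.
  have h3 := norm_mul_le sn h1; have h4 := norm_mul_le ssn h2.
  by rewrite (le_trans (ler_normB _ _)) //; lra.
rewrite (eq_bigr _ (fun j _ => YE j)) sumrB -!mulr_sumr sumr_const card_ord.
have gE : s * (\sum_(i < N) (cheb R (nu i)).[x]) = s ^+ 2 * (lacmean s nu N).[x] *+ N.
  rewrite /lacmean hornerZ horner_sum -mulr_natr; field.
  by rewrite pnatr_eq0 -lt0n N0 gt_eqF.
rewrite (_ : _ - _ = s ^+ 2 * (ell * ((lacmean s nu N).[x] - phi.[x]) - 31 / 32) *+ N).
  by rewrite mulrn_wge0 // mulr_ge0 ?sqr_ge0 //; lra.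
by rewrite mulrCA gE !mulrnAr -mulrnBl; congr (_ *+ _); ring.
Qed.

Lemma lacunary_lt d nu N i j : (0 < d)%N -> lacunary d nu N -> (i < j)%N -> (j < N)%N -> (nu i < nu j)%N.
Proof.
move=> d0 lac ij jN; have := lac j jN.
have -> : (\sum_(k < j) nu k = nu i + \sum_(k < j | k != Ordinal ij) nu k)%N by rewrite (bigD1 (Ordinal ij)).
lia.
Qed.

Lemma lacmean_nle1 s nu N : 0 < s -> (0 < N)%N -> nle 1 (ccoef (lacmean s nu N)) (1 / s).
Proof.
move=> s0 N0 K; rewrite (@powRr1 _ (1 / s)) ?divr_ge0 ?(ltW s0) //.
have Np : 0 < N%:R :> R by rewrite ltr0n.
apply: (@le_trans _ _ ((N%:R * s)^-1 * \sum_(j < N) 1)); last first.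
  by rewrite sumr_const card_ord le_eqVlt; apply/orP; left; apply/eqP; field; rewrite !gt_eqF.
under eq_bigr do rewrite powRr1 // /lacmean ccoefZ ccoef_sum normrM ger0_norm ?invr_ge0 ?mulr_ge0 ?(ltW s0) //.
rewrite -mulr_sumr ler_wpM2l ?invr_ge0 ?mulr_ge0 ?(ltW s0) //.
apply: le_trans (ler_sum _ (fun (k : 'I_K) _ => ler_norm_sum _ _ _)) _.
rewrite exchange_big /=; apply: ler_sum => j _.
under eq_bigr do rewrite ccoef_cheb.
have [nuK|nuK] := ltnP (nu j) K.
  rewrite (bigD1 (Ordinal nuK)) //= big1 => [|k /negPf kn]; last first.
    have kn' : (nu j == k) = false by rewrite -kn -val_eqE /= eq_sym.
    have -> : (nu j + k == 0)%N = false by move: kn'; lia.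
    by rewrite kn' addr0 mul0r normr0.
  rewrite eqxx addr0; case: (_ == 0%N); rewrite ger0_norm //=; lra.
rewrite big1 // => k _; have kK := ltn_ord k.
have -> : (nu j + k == 0)%N = false by lia.
have -> : (nu j == k) = false by lia.
by rewrite addr0 mul0r normr0.
Qed.

(** The frequencies are distinct and positive, so there are N coefficients, each equal to 1 / (2 N
    s). *)
Lemma lacmean_nlep p s nu N d eps : 0 < p -> 0 < s -> 0 < eps -> (0 < N)%N -> (0 < d)%N ->
  lacunary d nu N -> N%:R * (1 / (2 * N%:R * s)) `^ p <= eps `^ p ->
  nle p (ccoef (lacmean s nu N)) eps.
Proof.
move=> p0 s0 e0 N0 d0 lac hN K; apply: le_trans hN.
have Np : 0 < N%:R :> R by rewrite ltr0n.
have inj (i j : 'I_N) : nu i = nu j -> i = j.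
  move=> e; apply: val_inj => /=; case: (ltngtP i j) => // h.
    by have := lacunary_lt d0 lac h (ltn_ord j); rewrite e ltnn.
  by have := lacunary_lt d0 lac h (ltn_ord i); rewrite e ltnn.
have nu0 (j : 'I_N) : (0 < nu j)%N by have := lac j (ltn_ord j); lia.
pose c : R := 1 / (2 * N%:R * s).
apply: (@le_trans _ _ (\sum_(k < K) \sum_(j < N) (nu j == k)%:R * c `^ p)); last first.
  rewrite exchange_big /= [leRHS](_ : _ = \sum_(j < N) c `^ p); last first.
    by rewrite sumr_const card_ord mulr_natl.
  apply: ler_sum => j _.
  have [nuK|nuK] := ltnP (nu j) K.
    rewrite (bigD1 (Ordinal nuK)) //= big1 => [|k /negPf kn]; first by rewrite eqxx mul1r addr0 /c.
    by rewrite [nu j == k]eq_sym -[(k == nu j :> nat)]/(k == Ordinal nuK) kn mul0r.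
  rewrite big1 ?powR_ge0 // => k _; have kK := ltn_ord k.
  have -> : (nu j == k) = false by lia.
  by rewrite mul0r.
apply: ler_sum => k _.
have cE j : ccoef (cheb R (nu (j : 'I_N))) k = (nu j == k)%:R / 2.
  rewrite ccoef_cheb; have -> : (nu j + k == 0)%N = false by have := nu0 j; lia.
  by rewrite add0r.
rewrite /lacmean ccoefZ ccoef_sum; under eq_bigr do rewrite cE.
have [[j /eqP hj]|none] := pselect (exists j : 'I_N, nu j == k).
  rewrite (bigD1 j) //= big1 => [|i ij]; last first.
    rewrite (_ : (nu i == k) = false) ?mul0r //; apply/negP => /eqP hi.
    by move/eqP: ij; apply; apply: inj; rewrite hi hj.
  rewrite hj eqxx addr0 (bigD1 j) //= hj eqxx !mul1r.
  rewrite -[leLHS]addr0 lerD ?sumr_ge0 //; last by move=> i _; rewrite mulr_ge0 ?powR_ge0.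
  rewrite le_eqVlt; apply/orP; left; apply/eqP; congr (_ `^ _).
  rewrite ger0_norm; first by rewrite /c; field; rewrite !gt_eqF.
  by rewrite mulr_ge0 // ?invr_ge0 ?mulr_ge0 ?(ltW s0).
rewrite big1 ?mulr0 ?normr0 ?powR0 ?gt_eqF // ?sumr_ge0 // => j _.
  by rewrite mulr_ge0 ?powR_ge0.
rewrite (_ : (nu j == k) = false) ?mul0r //; apply/negP => h.
by apply: none; exists j.
Qed.

Lemma mean_lacmean s nu N d : (0 < d)%N -> lacunary d nu N -> mean (lacmean s nu N) = 0.
Proof.
move=> d0 lac; rewrite /lacmean meanZ mean_sum big1 ?mulr0 // => j _.
rewrite mean_cheb; have -> : (nu j == 0)%N = false by have := lac j (ltn_ord j); lia.
by [].
Qed.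

End Mixture.

(** * Choice of the scale, of the number of frequencies and of the order of cancellation *)

Section OneStep.
Variable R : realType.
Implicit Types (p q s : R) (S a W : {poly R}).

Lemma powRDp (x a b : R) : 0 < x -> x `^ (a + b) = x `^ a * x `^ b.
Proof. by move=> x0; rewrite powRD // (gt_eqF x0) implybT. Qed.

Lemma powR_exprn (x a : R) n : 0 <= x -> (x ^+ n) `^ a = (x `^ a) ^+ n.
Proof.
move=> x0; elim: n => [|n IH]; first by rewrite !expr0 powR1.
by rewrite !exprS powRM ?IH // exprn_ge0.
Qed.

(* The weights of the mixture are at most 8^L and vanish in the orders
   1, ..., L, so the k-th one is at most (8^L)^q R^(k - L) in q-th power for any
   R >= 1; [qbase] is a value of R making (8^L)^q R^(-L) absorb the other
   factors. *)
Definition qbase q : R := 8 `^ q * (2 * expR 1).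
Definition qrate q s : R := qbase q * (2 * (s / 2) `^ q).

Lemma expR1_ge2 : 2 <= expR 1 :> R.
Proof. by have := expR_ge1Dx (1 : R); lra. Qed.

Lemma qbase_ge1 q : 0 < q -> 1 <= qbase q.
Proof.
move=> q0; have h : 1 <= 8 `^ q :> R.
  by have := @ler_powR R 8 (ler1n _ _) _ _ (ltW q0); rewrite powRr0.
by have e := expR1_ge2; rewrite /qbase mulr_ege1 //; lra.
Qed.

Lemma scale_ex q : 2 < q ->
  exists2 s : R, 0 < s <= 1 / 32 & 6 * qrate q s <= s ^+ 2 / (20 * 20).
Proof.
move=> q2; have q0 : 0 < q by lra.
have b0 : 0 < qbase q by have := qbase_ge1 q0; lra.
pose y := (1 / ((60 * 40) * qbase q)) `^ (q - 2)^-1.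
have y0 : 0 < y by rewrite powR_gt0 // divr_gt0 // mulr_gt0.
exists (2 * Num.min (1 / 64) y).
  have : 0 < Num.min (1 / 64) y by rewrite lt_min y0 andbT; lra.
  have : Num.min (1 / 64) y <= 1 / 64 by rewrite ge_min lexx.
  lra.
set m := Num.min _ _.
have m0 : 0 < m by rewrite lt_min y0 andbT; lra.
have my : m <= y by rewrite ge_min lexx orbT.
rewrite /qrate; have -> : 2 * m / 2 = m by field.
have q20 : 0 < q - 2 by lra.
have c0 : 0 < 1 / (60 * 40 * qbase q) by rewrite divr_gt0 // !mulr_gt0.
have h : m `^ (q - 2) <= 1 / (60 * 40 * qbase q).
  apply: (@le_trans _ _ (y `^ (q - 2))).
    by apply: ge0_ler_powR; rewrite ?nnegrE ?(ltW q20) ?(ltW m0) ?(ltW y0).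
  by rewrite /y -powRrM mulVf ?gt_eqF // powRr1 // ltW.
have -> : m `^ q = m ^+ 2 * m `^ (q - 2).
  rewrite -(powR_mulrn 2 (ltW m0)) -powRDp //.
  by congr (_ `^ _); ring.
have h2 : qbase q * m `^ (q - 2) <= 1 / (60 * 40).
  apply: le_trans (ler_wpM2l (ltW b0) h) _.
  by rewrite le_eqVlt; apply/orP; left; apply/eqP; field; rewrite gt_eqF.
have m2 : 0 <= m ^+ 2 by rewrite sqr_ge0.
have := ler_wpM2l m2 h2.
have -> : (2 * m) ^+ 2 = 4 * m ^+ 2 by ring.
have -> : 6 * (qbase q * (2 * (m ^+ 2 * m `^ (q - 2)))) = 12 * (m ^+ 2 * (qbase q * m `^ (q - 2))) by ring.
lra.
Qed.

(** 64 = 2^6 gives 64^L <= exp (6 L) <= exp (6 r N + 6), which uses up at most half of the decay exp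
    (- s^2 N / 200), apart from the constant exp 6. *)
Lemma freq_mean s r B e N L : 0 < s <= 1 / 32 -> 6 * r <= s ^+ 2 / (20 * 20) -> 0 < B -> 0 < e ->
  L%:R <= r * N%:R + 1 ->
  expR (- (s ^+ 2 / (20 * 20))) ^+ N <= e / (expR 6 * B ^+ 2) ->
  64 ^+ L * (B ^+ 2 * (1 - s ^+ 2 / 200) ^+ N) <= e.
Proof.
move=> /andP[s0 s1] hs B0 e0 L2 hN.
have e2 := expR1_ge2; have B2 : 0 < B ^+ 2 by rewrite exprn_gt0.
have h64 : 64 ^+ L <= expR (6 * L%:R) :> R.
  rewrite expRM_natr lerXn2r ?nnegrE ?expR_ge0 //.
  have -> : 6 = 1 * 6%:R :> R by ring.
  have -> : 64 = 2 ^+ 6 :> R by ring.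
  by rewrite expRM_natr lerXn2r ?nnegrE ?expR_ge0.
have s2 : 0 <= 1 - s ^+ 2 / 200.
  have : s ^+ 2 <= 1 by rewrite expr_le1 ?(ltW s0) //; lra.
  lra.
have hrho : (1 - s ^+ 2 / 200) ^+ N <= expR (- (s ^+ 2 / 200) * N%:R).
  rewrite expRM_natr lerXn2r ?nnegrE ?expR_ge0 //.
  exact: expR_ge1Dx.
move: (1 - s ^+ 2 / 200) s2 hrho => rho rho0 hrho.
apply: (@le_trans _ _ (expR (6 * L%:R) * (B ^+ 2 * expR (- (s ^+ 2 / 200) * N%:R)))).
  apply: ler_pM => //.
  - by rewrite mulr_ge0 ?sqr_ge0 // exprn_ge0.
  - by rewrite ler_pM2l.
rewrite mulrCA -expRD.
apply: (@le_trans _ _ (B ^+ 2 * (expR 6 * expR (- (s ^+ 2 / (20 * 20))) ^+ N))).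
  rewrite ler_pM2l // -expRM_natr -expRD ler_expR.
  have h : 6 * r * N%:R <= s ^+ 2 / (20 * 20) * N%:R by rewrite ler_wpM2r.
  by clear -h L2; lra.
have c0 : 0 < expR 6 * B ^+ 2 by rewrite mulr_gt0 // expR_gt0.
rewrite mulrA (mulrC (B ^+ 2)) (le_trans (ler_wpM2l (ltW c0) hN)) //.
by rewrite mulrC divfK // gt_eqF.
Qed.

(** (1 + r)^N <= exp (r N) <= exp L, so the power L of [qbase q] cancels (8^L)^q and this
    exponential, and 2^(-L) remains. *)
Lemma freq_qnorm q r B eps N L : 0 < q -> 0 < r -> 0 < B ->
  r * N%:R <= L%:R -> (1 / 2) ^+ L <= eps `^ q / B `^ q ->
  (8 ^+ L) `^ q / qbase q ^+ L * B `^ q * (1 + r) ^+ N <= eps `^ q.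
Proof.
move=> q0 r0 B0 L1 hm.
rewrite /qbase exprMn.
rewrite powR_exprn //.
move: (8 `^ q) (powR_gt0 q (ltr0n R 8 : 0 < 8)) => E E0.
have h8 : 0 < E ^+ L by rewrite exprn_gt0.
have hE : (1 + r) ^+ N <= expR 1 ^+ L.
  rewrite -expRM_natr mul1r; apply: (@le_trans _ _ (expR (r * N%:R))).
    rewrite expRM_natr lerXn2r ?nnegrE ?expR_ge0 //; first by lra.
    exact: expR_ge1Dx.
  by rewrite ler_expR.
move: (expR 1) (expR_gt0 (1 : R)) hE => X X0 hE.
have hE0 : 0 < X ^+ L by rewrite exprn_gt0.
have b0 : 0 < B `^ q by rewrite powR_gt0.
apply: (@le_trans _ _ (E ^+ L / (E ^+ L * (2 * X) ^+ L) * B `^ q * X ^+ L)).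
  apply: ler_wpM2l => //.
  by rewrite mulr_ge0 ?powR_ge0 // divr_ge0 ?(ltW h8) // mulr_ge0 ?(ltW h8) // exprn_ge0 // mulr_ge0 // ltW.
have -> : E ^+ L / (E ^+ L * (2 * X) ^+ L) * B `^ q * X ^+ L = (1 / 2) ^+ L * B `^ q.
  rewrite exprMn expr_div_n expr1n; move: (2 ^+ L) (exprn_gt0 L (ltr0n R 2 : 0 < 2)) => Y Y0.
  by field; rewrite !gt_eqF.
by rewrite -ler_pdivlMr.
Qed.

(** The left-hand side is N^(1 - p) (2 s)^(-p), which tends to 0 with s fixed because p > 1. *)
Lemma freq_pnorm p s eps N : 1 < p -> 0 < s -> 0 < eps -> (0 < N)%N ->
  ((2 * s * eps) `^ (- p)) `^ (p - 1)^-1 <= N%:R ->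
  N%:R * (1 / (2 * N%:R * s)) `^ p <= eps `^ p.
Proof.
move=> p1 s0 eps0 N0' hN.
have N0 : 0 < N%:R :> R by rewrite ltr0n.
have p0 : 0 < p - 1 by lra.
have sp : 0 < 2 * s by rewrite mulr_gt0.
set T := (2 * s * eps) `^ (- p) in hN.
have T0 : 0 < T by rewrite powR_gt0 // mulr_gt0.
have hT : T <= N%:R `^ (p - 1).
  have := @ge0_ler_powR R (p - 1) (ltW p0) _ _ _ _ hN.
  rewrite !nnegrE -powRrM mulVf ?gt_eqF // powRr1 ?(ltW T0) //.
  by apply; rewrite ?powR_ge0 // ltW.
have -> : 1 / (2 * N%:R * s) = N%:R^-1 * (2 * s)^-1 by field; rewrite !gt_eqF.
rewrite powRM ?invr_ge0 ?(ltW N0) ?(ltW sp) // mulrA.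
have inv (u : R) : 0 < u -> u^-1 `^ p = u `^ (- p).
  by move=> u0; rewrite -(powR_inv1 (ltW u0)) -powRrM mulN1r.
rewrite !inv //.
have -> : N%:R * N%:R `^ (- p) = (N%:R `^ (p - 1))^-1.
  rewrite -powRN -{1}(powRr1 (ltW N0)) -powRDp //.
  by congr (_ `^ _); ring.
rewrite ler_pdivrMl ?powR_gt0 //.
have -> : (2 * s) `^ (- p) = T * eps `^ p.
  rewrite /T (powRM _ (ltW sp) (ltW eps0)) -mulrA -powRDp //.
  by rewrite addNr powRr0 mulr1.
by rewrite ler_wpM2r ?powR_ge0.
Qed.

Lemma frequencies_ex p q s B e eps : 1 < p -> 2 < q -> 0 < s <= 1 / 32 ->
  6 * qrate q s <= s ^+ 2 / (20 * 20) -> 0 < B -> 0 < e -> 0 < eps ->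
  exists N L, [/\ (0 < N)%N, (0 < L)%N,
    64 ^+ L * (B ^+ 2 * (1 - s ^+ 2 / 200) ^+ N) <= e,
    (8 ^+ L) `^ q / qbase q ^+ L * B `^ q * (1 + qrate q s) ^+ N <= eps `^ q &
    N%:R * (1 / (2 * N%:R * s)) `^ p <= eps `^ p].
Proof.
move=> p1 q2 s01 hs B0 e0 eps0; have [s0 s1] := andP s01.
have q0 : 0 < q by lra.
have b0 : 0 < qbase q by have := qbase_ge1 q0; lra.
have r0 : 0 < qrate q s by rewrite !mulr_gt0 // powR_gt0 // divr_gt0.
move: (qrate q s) hs r0 => r hs r0.
pose rho := expR (- (s ^+ 2 / (20 * 20))).
have rho0 : 0 <= rho by rewrite expR_ge0.
have rho1 : rho < 1 by rewrite expR_lt1 oppr_lt0 divr_gt0 // ?exprn_gt0 // mulr_gt0.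
have c0 : 0 < expR 6 * B ^+ 2 :> R by rewrite mulr_gt0 ?expR_gt0 // exprn_gt0.
have [N1 hN1] := ex_exprn_le rho0 rho1 (divr_gt0 e0 c0).
have d0 : 0 < eps `^ q / B `^ q by rewrite divr_gt0 ?powR_gt0.
have h0 : 0 <= 1 / 2 :> R by lra.
have h1 : 1 / 2 < 1 :> R by lra.
have [m0 hm0] := ex_exprn_le h0 h1 d0.
pose N2 := (Num.truncn (m0%:R / r)).+1.
pose N3 := (Num.truncn (((2 * s * eps) `^ (- p)) `^ (p - 1)^-1)).+1.
have hN3 : ((2 * s * eps) `^ (- p)) `^ (p - 1)^-1 < N3%:R by apply: truncnS_gt.
have hN2 : m0%:R / r < N2%:R by apply: truncnS_gt.
have N30 : (0 < N3)%N by [].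
move: N2 N3 hN2 hN3 N30 => N2 N3 hN2 hN3 N30.
pose N := (N1 + N2 + N3)%N.
have NN1 : (N1 <= N)%N by rewrite /N -addnA leq_addr.
have NN2 : (N2 <= N)%N by rewrite /N addnAC leq_addl.
have NN3 : (N3 <= N)%N by rewrite leq_addl.
have N0 : (0 < N)%N := leq_trans N30 NN3.
move: N NN1 NN2 NN3 N0 => N NN1 NN2 NN3 N0.
pose L := (Num.truncn (r * N%:R)).+1.
have rN0 : 0 <= r * N%:R by rewrite mulr_ge0 // ltW.
have L1 : r * N%:R <= L%:R by rewrite ltW // truncnS_gt.
have L2 : L%:R <= r * N%:R + 1 by rewrite /L -natr1 lerD2r truncn_le.
have L0 : (0 < L)%N by [].
move: L L0 L1 L2 => L L0 L1 L2; exists N, L.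
have H1 := freq_mean s01 hs B0 e0 L2 (hN1 _ NN1).
have NN3' : N3%:R <= N%:R :> R by rewrite ler_nat.
have H3 := freq_pnorm p1 s0 eps0 N0 (le_trans (ltW hN3) NN3').
have mL : (m0 <= L)%N.
  rewrite -(ler_nat R); apply: le_trans L1.
  move: hN2; rewrite ltr_pdivrMr // => h; apply: (le_trans (ltW h)).
  by rewrite mulrC ler_pM2l // ler_nat.
have H2 := freq_qnorm q0 r0 B0 L1 (hm0 _ mL).
by split.
Qed.

Lemma small_ex (y : R) (xs : seq R) : 0 < y -> all (fun x => 0 <= x) xs ->
  exists2 eta : R, 0 < eta <= 1 & forall x, x \in xs -> eta * x <= y.
Proof.
move=> y0 xs0; pose D := 1 + y + \sum_(x <- xs) x.
have S0 : 0 <= \sum_(x <- xs) x by rewrite big_seq sumr_ge0 // => x /(allP xs0).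
have D0 : 0 < D by rewrite /D; lra.
exists (y / D); first by rewrite divr_gt0 //= ler_pdivrMr // /D; lra.
move=> x xxs; rewrite mulrAC ler_pdivrMr // ler_pM2l //.
have : x <= \sum_(x <- xs) x.
  rewrite (big_rem x) //= lerDl big_seq sumr_ge0 // => z /mem_rem zxs.
  exact: (allP xs0).
rewrite /D; lra.
Qed.

(** Stands for a bound e on the integral of S^2 over {|a| > d}. Only means of polynomials are
    available, so a nonnegative polynomial majorant replaces the integral. *)
Definition dominated S a (d e : R) := exists2 W : {poly R},
  mean W <= e & forall x, -1 <= x <= 1 ->
    0 <= W.[x] /\ (d < `|a.[x]| -> S.[x] ^+ 2 <= W.[x]).

Definition bnd (P : {poly R}) : R := projT1 (cid2 (supI_ex P)).
Lemma bnd_gt0 P : 0 < bnd P. Proof. by rewrite /bnd; case: cid2. Qed.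
Lemma bndP P : supI_le P (bnd P). Proof. by rewrite /bnd; case: cid2. Qed.

(** The inclusion of l^2 in l^q: |c|^q = |c|^(q - 2) c^2, where |c| <= B, and Bessel's
    inequality. *)
Lemma sum_qpow_le_mean q (P : {poly R}) B : 2 <= q -> 0 <= B -> mean (P * P) <= B ^+ 2 ->
  forall K, \sum_(k < K) `|ccoef P k| `^ q <= B `^ q.
Proof.
move=> q2 B0 PB K.
have qq (u : R) : 0 <= u -> u `^ q = u `^ (q - 2) * u ^+ 2.
  move=> u0; rewrite -(powR_mulrn 2 u0) -powRD; first by congr (_ `^ _); ring.
  by apply/implyP => /eqP; lra.
have le_B k : `|ccoef P k| <= B.
  rewrite -(@ler_pXn2r _ 2) ?nnegrE // real_normK ?num_real //.
  apply: le_trans PB; apply: le_trans (bessel k.+1 P).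
  by rewrite big_ord_recr lerDr sumr_ge0 // => i _; rewrite sqr_ge0.
apply: (@le_trans _ _ (B `^ (q - 2) * \sum_(k < K) ccoef P k ^+ 2)).
  rewrite mulr_sumr; apply: ler_sum => k _; rewrite qq // real_normK ?num_real //.
  by rewrite ler_wpM2r ?sqr_ge0 //; apply: ge0_ler_powR; rewrite ?nnegrE //; lra.
rewrite qq // ler_wpM2l ?powR_ge0 //.
by apply: le_trans (bessel _ _) _.
Qed.

Lemma sum_qpow_le q (P : {poly R}) B : 2 <= q -> 0 <= B -> supI_le P B ->
  forall K, \sum_(k < K) `|ccoef P k| `^ q <= B `^ q.
Proof. by move=> q2 B0 PB; apply: sum_qpow_le_mean => //; apply: mean_sqr_le. Qed.

End OneStep.

(** * One step of the construction *)

Section RieszStep.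
Variable R : realType.
Implicit Types (p q s : R) (S a W : {poly R}).

(** Where |a| <= d the cut-off is near 1, so S - S' is small pointwise. Elsewhere |S - S'| <= |S|,
    whose square is controlled by the majorant. *)
Lemma truncate_ex S a (d d' e B eta : R) : 0 < d -> d < d' -> 0 < eta <= 1 ->
  dominated S a d e -> supI_le S B ->
  exists S', [/\ supI_le S' B,
    forall x, -1 <= x <= 1 -> d' <= `|a.[x]| -> `|S'.[x]| <= eta * B &
    mean ((S - S') * (S - S')) <= e + eta * B ^+ 2].
Proof.
move=> d0 dd' /andP[eta0 eta1] [W We hW] SB.
have B0 : 0 <= B.
  by apply: le_trans (SB 0 _); rewrite ?normr_ge0 // lerN10 ler01.
have [Q hQ] := cut_poly a d0 dd' eta0.
exists (S * Q); split.
- move=> x hx; have [/andP[Q0 Q1] _ _] := hQ x hx.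
  rewrite hornerM normrM -[B]mulr1; apply: ler_pM => //; first exact: SB.
  by rewrite ger0_norm.
- move=> x hx ad; have [/andP[Q0 Q1] _ h] := hQ x hx.
  rewrite hornerM normrM mulrC; apply: ler_pM => //; last exact: SB.
  by rewrite ger0_norm // h.
- apply: (@le_trans _ _ (mean (W + (eta * B ^+ 2)%:P))); last first.
    by rewrite meanD meanC lerD2r.
  apply: mean_le => x hx; have [/andP[Q0 Q1] hQ1 _] := hQ x hx.
  have [W0 hW1] := hW x hx.
  rewrite !(hornerD, hornerM, hornerN, hornerC).
  set t := S.[x] in hW1 *; set c := Q.[x] in Q0 Q1 hQ1 *.
  have -> : (t - t * c) * (t - t * c) = t ^+ 2 * (1 - c) ^+ 2 by ring.
  have c2 : (1 - c) ^+ 2 <= 1 by rewrite expr_le1 // ?subr_ge0 //; lra.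
  have eB : 0 <= eta * B ^+ 2 by rewrite mulr_ge0 ?sqr_ge0 // ltW.
  have [ad|ad] := ltP d `|a.[x]|.
    apply: (@le_trans _ _ (t ^+ 2)); first by rewrite ler_piMr ?sqr_ge0.
    by have := hW1 ad; lra.
  have c1 : (1 - c) ^+ 2 <= eta.
    have h := hQ1 ad; rewrite expr2; apply: (@le_trans _ _ (eta * 1)); last by rewrite mulr1.
    by apply: ler_pM; rewrite ?subr_ge0 //; lra.
  have t2 : t ^+ 2 <= B ^+ 2.
    by rewrite -real_normK ?num_real // lerXn2r ?nnegrE // SB.
  have : t ^+ 2 * (1 - c) ^+ 2 <= B ^+ 2 * eta by apply: ler_pM; rewrite ?sqr_ge0.
  by rewrite (mulrC (B ^+ 2)); lra.
Qed.

(** After averaging out the frequencies, [avgfac_bounds] applies where |phi| <= 1. Where |phi| > 1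
    the averaged factor is only known to be at most M, but there S carries a factor eta, to be
    chosen after M and N. *)
Lemma mean_bad_le s phi nu N L sg ell d w S (B M eta : R) :
  0 < s <= 1 / 32 -> (0 < L)%N -> 0 <= B -> 0 < eta <= 1 ->
  ell = 1 \/ ell = -1 -> 1 / 2 <= sg <= 1 -> lacunary d nu N ->
  (forall l, (l <= 4)%N -> (size (nth 0 (pfac s sg ell phi) l)%R <= w)%N) ->
  (size (S * S)%R + N * w <= d)%N ->
  (forall x, -1 <= x <= 1 -> `|(avgpoly s sg ell phi).[x]| <= M) ->
  supI_le S B ->
  (forall x, -1 <= x <= 1 -> 1 < `|phi.[x]| -> `|S.[x]| <= eta * B) ->
  mean (S * S * wprod s ell phi nu N * (riesz s phi nu N sg * riesz s phi nu N sg)) <=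
    B ^+ 2 * (1 - s ^+ 2 / 200) ^+ N + eta * (B ^+ 2 * M ^+ N).
Proof.
move=> s01 L0 B0 /andP[eta0 eta1] hell hsg lac sp sS hM SB Soff.
have avg v := @avgfac_bounds _ _ _ v s01 hsg.
have rho0 : 0 <= 1 - s ^+ 2 / 200.
  have [s0 s1] := andP s01; have : s ^+ 2 <= 1 by rewrite expr_le1 ?(ltW s0) //; lra.
  by clear; lra.
move: (1 - s ^+ 2 / 200) rho0 avg => rho rho0 avg.
rewrite -mulrA [wprod _ _ _ _ _ * _]mulrC (mean_riesz_wprod lac sp sS).
set b := (_ + _); rewrite -(meanC b); apply: mean_le => x hx.
have M0 : 0 <= M by rewrite (le_trans _ (hM x hx)).
have p1 : 0 <= B ^+ 2 * rho ^+ N by rewrite mulr_ge0 ?sqr_ge0 // exprn_ge0.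
have p2 : 0 <= eta * (B ^+ 2 * M ^+ N) by rewrite !mulr_ge0 ?sqr_ge0 ?exprn_ge0 // ltW.
rewrite hornerC hornerM horner_exp hornerM /b -expr2.
have [ph|ph] := leP `|phi.[x]| 1.
  have hw : -1 <= ell * phi.[x] <= 1.
    by rewrite -ler_norml normrM; case: hell => ->; rewrite ?normrN normr1 mul1r.
  have := avg _ hw; rewrite -avgpolyE // => /andP[a0 a1].
  apply: (@le_trans _ _ (B ^+ 2 * rho ^+ N)); last by rewrite lerDl.
  apply: ler_pM; rewrite ?sqr_ge0 ?exprn_ge0 //.
    by rewrite -real_normK ?num_real // lerXn2r ?nnegrE // SB.
  by rewrite lerXn2r ?nnegrE.
apply: (@le_trans _ _ (eta * B ^+ 2 * M ^+ N)); last by rewrite -mulrA lerDr.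
apply: (le_trans (ler_norm _)); rewrite normrM !normrX; apply: ler_pM; rewrite ?exprn_ge0 //.
  apply: (@le_trans _ _ ((eta * B) ^+ 2)).
    by rewrite lerXn2r ?nnegrE ?mulr_ge0 ?(ltW eta0) // Soff.
  rewrite exprMn ler_wpM2r ?sqr_ge0 // expr2 ler_piMr //; exact: ltW.
by rewrite lerXn2r ?nnegrE // hM.
Qed.

Lemma supI_mul_pow S phi (B Phi eta : R) N i : (i <= N)%N -> 0 <= B -> 1 <= Phi ->
  supI_le S B -> supI_le phi Phi ->
  (forall x, -1 <= x <= 1 -> 1 < `|phi.[x]| -> `|S.[x]| <= eta * B) ->
  eta * Phi ^+ N <= 1 -> supI_le (S * phi ^+ i) B.
Proof.
move=> iN B0 P1 SB pP Soff hN x hx; rewrite hornerM horner_exp normrM normrX.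
have [ph|ph] := leP `|phi.[x]| 1.
  by rewrite -[B]mulr1; apply: ler_pM => //; rewrite ?exprn_ge0 ?exprn_ile1 // SB.
apply: (@le_trans _ _ (eta * B * Phi ^+ N)); last first.
  by rewrite mulrAC -[leRHS]mul1r ler_wpM2r.
apply: ler_pM; rewrite ?exprn_ge0 ?Soff //.
apply: (@le_trans _ _ (Phi ^+ i)); last by rewrite ler_weXn2l.
by rewrite lerXn2r ?nnegrE ?pP //; lra.
Qed.

Definition pfac_size s sg ell phi : nat :=
  \max_(l < 5) size (nth 0 (pfac s sg ell phi) l)%R.

Lemma pfac_sizeP s sg ell (phi : {poly R}) l : (l <= 4)%N ->
  (size (nth 0 (pfac s sg ell phi) l)%R <= pfac_size s sg ell phi)%N.
Proof.
move=> l4; have l5 : (l < 5)%N by [].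
exact: (@leq_bigmax _ (fun l : 'I_5 => size (nth 0 (pfac s sg ell phi) l)%R) (Ordinal l5)).
Qed.

(** The cut-off needs a gap between d and d1 = 64/63 d, and phi is a / d1. The tolerance 31/32 on g
    - phi then becomes 31/32 d1 = 62/63 d for a - d1 g, so the level still contracts. *)
Lemma riesz_step p q s : 1 < p -> 2 < q -> 0 < s <= 1 / 32 ->
  6 * qrate q s <= s ^+ 2 / (20 * 20) ->
  forall S a (d e e' eps : R), 0 < d -> 0 < e -> 0 < e' -> 0 < eps -> dominated S a d e ->
  exists S' S2 g : {poly R},
  [/\ forall x, -1 <= x <= 1 -> 64 / 63 * d <= `|a.[x]| -> `|S'.[x]| <= eps,
      mean ((S - S') * (S - S')) <= 2 * e &
      nle q (ccoef (S2 - S')) eps] /\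
  [/\ nle 1 (ccoef g) (1 / s), nle p (ccoef g) eps, mean g = 0 &
      dominated S2 (a - (64 / 63 * d) *: g) (62 / 63 * d) e'].
Proof.
move=> p1 q2 s01 hs S a d e e' eps d0 e0 e'0 eps0 Sdom.
have [s0 s1] := andP s01.
pose B := bnd S; have B0 : 0 < B by apply: bnd_gt0.
have SB : supI_le S B by apply: bndP.
move: B B0 SB => B B0 SB.
pose d1 := 64 / 63 * d.
have d10 : 0 < d1 by rewrite mulr_gt0 // divr_gt0.
have dd1 : d < d1 by rewrite /d1; lra.
have d2E : 62 / 63 * d = 31 / 32 * d1 by rewrite /d1; field.
rewrite d2E -/d1; move: d1 d10 dd1 {d2E} => d1 d10 dd1.
pose phi := d1^-1 *: a; pose Phi := 1 + bnd phi.
have Phi1 : 1 <= Phi by rewrite /Phi; have := bnd_gt0 phi; lra.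
have phiP : supI_le phi Phi.
  by move=> x hx; apply: (le_trans (bndP _ hx)); rewrite /Phi; lra.
have e8 : 0 < e' / 8 by rewrite divr_gt0.
have [N [L [N0 L0 H1 H2 H3]]] := frequencies_ex p1 q2 s01 hs B0 e8 eps0.
(* One bound of the averaged factor for all nodes and both signs, valid also where |phi| > 1. *)
pose M := \sum_(i < L.+1) (bnd (avgpoly s (node R L i) 1 phi) + bnd (avgpoly s (node R L i) (-1) phi)).
have MP i ell : (i <= L)%N -> ell = 1 \/ ell = -1 ->
    forall x, -1 <= x <= 1 -> `|(avgpoly s (node R L i) ell phi).[x]| <= M.
  move=> iL hell x hx; have iL1 : (i < L.+1)%N by [].
  apply: (@le_trans _ _ (bnd (avgpoly s (node R L i) 1 phi) + bnd (avgpoly s (node R L i) (-1) phi))).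
    have b1 := bnd_gt0 (avgpoly s (node R L i) 1 phi).
    have b2 := bnd_gt0 (avgpoly s (node R L i) (-1) phi).
    by case: hell => ->; apply: (le_trans (bndP _ hx)); rewrite ?lerDl ?lerDr ltW.
  rewrite /M (bigD1 (Ordinal iL1)) //= lerDl sumr_ge0 // => j _.
  by rewrite addr_ge0 // ltW // bnd_gt0.
have M0 : 0 <= M.
  apply: le_trans (MP 0%N 1 (leq0n _) (or_introl erefl) 0 _); rewrite ?normr_ge0 //.
  by rewrite lerN10 ler01.
pose F := B * (8 ^+ L * (1 + s * Phi) ^+ N).
have [y [y0 ye y1 y8 yee]] : exists y, [/\ 0 < y, y <= eps, y <= 1, y <= e' / 8 & y <= e].
  exists (Num.min (Num.min eps 1) (Num.min (e' / 8) e)).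
  by split; rewrite ?lt_min ?ge_min ?eps0 ?e8 ?e0 ?ltr01 ?lexx ?orbT.
have q4 : 0 <= Phi ^+ N by rewrite exprn_ge0 // (le_trans _ Phi1).
have q5 : 0 <= 64 ^+ L * (B ^+ 2 * M ^+ N) by rewrite !mulr_ge0 ?exprn_ge0 ?(ltW B0).
(* N and L depend on the bound B of S and on the accuracies, not on the cut-off. So eta may be taken
   after them and absorb all the powers; the frequencies come last, since they depend on the degree
   of the truncated multiplier. *)
have [] := @small_ex R y [:: B; Phi ^+ N; 64 ^+ L * (B ^+ 2 * M ^+ N); F ^+ 2; B ^+ 2] y0.
  by rewrite /= (ltW B0) q4 q5 !sqr_ge0.
move=> eta eta01 hxs; have [eta0 eta1] := andP eta01.
have c1 : eta * B <= eps by apply: le_trans ye; apply: hxs; rewrite !inE eqxx.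
have c2 : eta * Phi ^+ N <= 1 by apply: le_trans y1; apply: hxs; rewrite !inE eqxx ?orbT.
have c3 : eta * (64 ^+ L * (B ^+ 2 * M ^+ N)) <= e' / 8.
  by apply: le_trans y8; apply: hxs; rewrite !inE eqxx ?orbT.
have c4 : eta * F ^+ 2 <= e' / 8 by apply: le_trans y8; apply: hxs; rewrite !inE eqxx ?orbT.
have c5 : eta * B ^+ 2 <= e by apply: le_trans yee; apply: hxs; rewrite !inE eqxx ?orbT.
have [S' [S'B S'off S'mean]] := truncate_ex d0 dd1 eta01 Sdom SB.
have phiE x : phi.[x] = a.[x] / d1 by rewrite /phi hornerZ mulrC.
have offphi x : -1 <= x <= 1 -> 1 < `|phi.[x]| -> `|S'.[x]| <= eta * B.
  move=> hx; rewrite phiE normrM normfV (gtr0_norm d10) ltr_pdivlMr // mul1r => /ltW.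
  exact: S'off.
pose w := (\max_(i < L.+1) maxn (pfac_size s (node R L i) 1 phi) (pfac_size s (node R L i) (-1) phi))%N.
have wP i ell : (i <= L)%N -> ell = 1 \/ ell = -1 -> forall l, (l <= 4)%N ->
    (size (nth 0 (pfac s (node R L i) ell phi) l)%R <= w)%N.
  move=> iL hell l l4; have iL1 : (i < L.+1)%N by [].
  apply: (leq_trans (pfac_sizeP _ _ _ _ l4)).
  apply: leq_trans (@leq_bigmax _ (fun i : 'I_L.+1 => maxn (pfac_size s (node R L i) 1 phi) (pfac_size s (node R L i) (-1) phi)) (Ordinal iL1)).
  by case: hell => ->; rewrite ?leq_maxl ?leq_maxr.
pose dg := (size S' + N * size phi + size (S' * S')%R + N * w + 1)%N.
have [nu lac] := lacunary_ex dg N.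
have dg0 : (0 < dg)%N by rewrite /dg addn1.
have sdg1 : (size S' + N * size phi <= dg)%N by rewrite /dg -!addnA !leq_add2l leq_addr.
have sdg2 : (size (S' * S')%R + N * w <= dg)%N by rewrite /dg addn1 leqW // -!addnA addnA leq_addl.
pose f := mixture s phi nu N L; pose g := lacmean s nu N.
exists S', (S' * f), g; split; split.
- by move=> x hx h; apply: le_trans c1; apply: S'off.
- by apply: (le_trans S'mean); clear -c5; lra.
- move=> K; apply: le_trans H2.
  apply: (@mixture_qnorm R q s (B `^ q) phi nu N L dg (qbase q) S') => //.
  + by clear -q2; lra.
  + exact: ltW.
  + by apply: qbase_ge1; clear -q2; lra.
  + exact: powR_ge0.
  + move=> i iN; apply: sum_qpow_le; [exact: ltW | exact: ltW |].
    exact: (supI_mul_pow iN (ltW B0) Phi1 S'B phiP offphi c2).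
- exact: lacmean_nle1.
- apply: (lacmean_nlep _ s0 eps0 N0 dg0 lac H3); clear -p1; lra.
- exact: (mean_lacmean _ dg0 lac).
have rho0 : 0 <= 1 - s ^+ 2 / 200.
  have : s ^+ 2 <= 1 by rewrite expr_le1 ?(ltW s0) //; clear -s1; lra.
  by clear; lra.
have bad ell : ell = 1 \/ ell = -1 ->
    mean (S' * S' * wprod s ell phi nu N * (f * f)) <= e' / 4.
  move=> hell.
  have avg i : (i < L.+1)%N -> _ := fun iL => mean_bad_le s01 L0 (ltW B0) eta01 hell
    (node_bounds R L0 iL) lac (wP i ell iL hell) sdg2 (MP i ell iL hell) S'B offphi.
  move: (1 - s ^+ 2 / 200) rho0 H1 avg => rho rho0 H1 avg.
  apply: (@le_trans _ _ (64 ^+ L * (B ^+ 2 * rho ^+ N + eta * (B ^+ 2 * M ^+ N)))).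
    apply: mean_mixture_sqr => //.
    + by move=> x hx; rewrite !hornerM mulr_ge0 ?wprod_ge0 // -expr2 sqr_ge0.
    + apply: addr_ge0; first by rewrite mulr_ge0 ?sqr_ge0 // exprn_ge0.
      by rewrite !mulr_ge0 ?sqr_ge0 ?exprn_ge0 // ltW.
  by rewrite mulrDr [64 ^+ L * (eta * _)]mulrCA; clear -H1 c3; lra.
(* The two products dominate the square of S' f where phi - g is large with either sign and |phi| <=
   1; the constant takes care of the points with |phi| > 1. *)
exists (S' * S' * wprod s 1 phi nu N * (f * f) + S' * S' * wprod s (-1) phi nu N * (f * f) + (e' / 2)%:P).
  rewrite !meanD meanC; have := bad 1 (or_introl erefl); have := bad (-1) (or_intror erefl).
  by clear; lra.
move=> x hx.
set w1 := wprod s 1 phi nu N; set w2 := wprod s (-1) phi nu N.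
have w10 : 0 <= w1.[x] by apply: wprod_ge0.
have w20 : 0 <= w2.[x] by apply: wprod_ge0.
have vE : (S' * S' * w1 * (f * f) + S' * S' * w2 * (f * f) + (e' / 2)%:P).[x] =
    (S' * f).[x] ^+ 2 * w1.[x] + (S' * f).[x] ^+ 2 * w2.[x] + e' / 2.
  by rewrite !(hornerD, hornerM, hornerC); ring.
rewrite vE; set t := (S' * f).[x].
have t1 : 0 <= t ^+ 2 * w1.[x] by rewrite mulr_ge0 ?sqr_ge0.
have t2 : 0 <= t ^+ 2 * w2.[x] by rewrite mulr_ge0 ?sqr_ge0.
split; first by clear -t1 t2 e'0; lra.
have -> : (a - d1 *: g).[x] = d1 * (phi.[x] - g.[x]).
  by rewrite hornerD hornerN hornerZ phiE; field; rewrite gt_eqF.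
rewrite normrM (gtr0_norm d10) mulrC ltr_pM2l // => hbad.
have [ph|ph] := leP `|phi.[x]| 1; last first.
  have tF : `|t| <= eta * F.
    rewrite /t hornerM normrM /F mulrA; apply: ler_pM => //; first exact: offphi.
    by apply: norm_mixture => //; [exact: ltW | exact: phiP].
  have F0 : 0 <= F by rewrite !mulr_ge0 ?exprn_ge0 ?(ltW B0) // addr_ge0 // mulr_ge0 ?(ltW s0) //; apply: le_trans Phi1.
  have : t ^+ 2 <= eta * F ^+ 2.
    rewrite -real_normK ?num_real //; apply: (@le_trans _ _ ((eta * F) ^+ 2)).
      by rewrite lerXn2r ?nnegrE // mulr_ge0 // ltW.
    by rewrite exprMn ler_wpM2r ?sqr_ge0 // expr2 ler_piMr // ltW.
  by clear -t1 t2 c4 e'0; lra.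
have [hpos|hneg] := leP 0 (phi.[x] - g.[x]).
  rewrite (ger0_norm hpos) in hbad.
  have : 1 <= w2.[x].
    apply: (wprod_ge1 s01 (or_intror erefl) N0 hx ph); rewrite mulN1r opprB; exact: hbad.
  by move=> h; have := ler_wpM2l (sqr_ge0 t) h; rewrite mulr1; clear -t1 e'0; lra.
rewrite (ltr0_norm hneg) opprB in hbad.
have : 1 <= w1.[x] by apply: (wprod_ge1 s01 (or_introl erefl) N0 hx ph); rewrite mul1r.
by move=> h; have := ler_wpM2l (sqr_ge0 t) h; rewrite mulr1; clear -t2 e'0; lra.
Qed.

End RieszStep.

Local Open Scope complex_scope.

(** * Cosine series *)

Section CosineSeries.
Variable R : realType.
Implicit Types (be ga : nat -> R) (x : R).

(** The multiplicity is 1 for k = 0 and 2 otherwise: the terms of index k and -k of the even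
    two-sided series are taken together. *)
Definition cterm be x (k : nat) : R := (be k *+ (k != 0%N).+1) * (cheb R k).[x].

Definition cseries be x : R := limn (series (cterm be x)).

Lemma norm_cterm be x k : -1 <= x <= 1 -> `|cterm be x k| <= 2 * `|be k|.
Proof.
move=> hx; rewrite /cterm normrM -[leRHS]mulr1; apply: ler_pM => //; last exact: cheb_supI.
rewrite normrMn -[X in X <= _]mulr_natl; apply: ler_wpM2r => //.
by rewrite ler_nat; case: k.
Qed.

Lemma nle1_sum be (M : R) n : 0 <= M -> nle 1 be M -> \sum_(k < n) `|be k| <= M.
Proof.
move=> M0 h; have := h n; rewrite (powRr1 M0) => hn; apply: le_trans hn.
by apply: ler_sum => k _; rewrite powRr1.
Qed.

Lemma cseries_cvg be (M : R) x : 0 <= M -> nle 1 be M -> -1 <= x <= 1 ->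
  cvgn (series (cterm be x)).
Proof.
move=> M0 h hx; apply: normed_cvg.
pose u k := `|cterm be x k|; rewrite -[X in X @ _]/(series u).
have inc n : series u n <= series u n.+1 by rewrite seriesSr lerDl /u normr_ge0.
apply: nondecreasing_is_cvgn; first exact/nondecreasing_seqP.
exists (2 * M) => _ [n _ <-]; rewrite /series /= big_mkord.
apply: (@le_trans _ _ (\sum_(k < n) 2 * `|be k|)).
  by apply: ler_sum => k _; apply: norm_cterm.
by rewrite -mulr_sumr ler_wpM2l // nle1_sum.
Qed.

Lemma cseries_norm be (M : R) x : 0 <= M -> nle 1 be M -> -1 <= x <= 1 ->
  `|cseries be x| <= 2 * M.
Proof.
move=> M0 h hx; have cv := cseries_cvg M0 h hx.
have bd n : `|series (cterm be x) n| <= 2 * M.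
  rewrite /series /= big_mkord (le_trans (ler_norm_sum _ _ _)) //.
  apply: (@le_trans _ _ (\sum_(k < n) 2 * `|be k|)).
    by apply: ler_sum => k _; apply: norm_cterm.
  by rewrite -mulr_sumr ler_wpM2l // nle1_sum.
rewrite ler_norml; apply/andP; split.
  by apply: limr_ge => //; near=> n; have := bd n; rewrite ler_norml => /andP[].
by apply: limr_le => //; near=> n; have := bd n; rewrite ler_norml => /andP[].
Unshelve. all: by end_near. Qed.

Lemma cseries_sub be ga (M A : R) x : 0 <= M -> 0 <= A -> nle 1 be M -> nle 1 ga A ->
  -1 <= x <= 1 -> cseries (fun k => be k - ga k) x = cseries be x - cseries ga x.
Proof.
move=> M0 A0 hb hg hx; have cb := cseries_cvg M0 hb hx; have cg := cseries_cvg A0 hg hx.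
rewrite /cseries -(limB cb cg).
have -> // : series (cterm (fun k => be k - ga k) x) =
    (fun n => series (cterm be x) n - series (cterm ga x) n).
apply/funext => n; rewrite /series /= -sumrB; apply: eq_bigr => k _.
by rewrite /cterm mulrnBl mulrBl.
Qed.

Lemma cseries_diff be ga (M A e : R) x : 0 <= M -> 0 <= A -> 0 <= e ->
  nle 1 be M -> nle 1 ga A ->
  nle 1 (fun k => be k - ga k) e -> -1 <= x <= 1 -> `|cseries be x - cseries ga x| <= 2 * e.
Proof.
by move=> M0 A0 e0 hb hg he hx; rewrite -(cseries_sub M0 A0 hb hg hx); apply: cseries_norm.
Qed.

Lemma cseries_eventually be x (c : R) n : (forall m, (n <= m)%N -> series (cterm be x) m = c) ->
  cseries be x = c.
Proof.
move=> h; apply: cvg_lim => //; apply: cvg_near_cst; by exists n => // m /= /h.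
Qed.

Lemma cseries_poly (P : {poly R}) x : cseries (ccoef P) x = P.[x].
Proof.
apply: (@cseries_eventually _ _ _ (size P).+1) => m sm.
have sP : (size P <= m)%N by exact: ltnW.
rewrite {2}(cheb_ccoef sP) /series /= hornerD hornerC.
rewrite big_ltn; last by case: m sm sP.
rewrite /cterm ccoef0 eqxx mulr1n cheb0 -[(1 : {poly R})]polyC1 hornerC mulr1; congr (_ + _).
rewrite horner_sum; rewrite !big_seq; apply: eq_bigr => k.
by rewrite mem_index_iota hornerZ => /andP[]; case: k.
Qed.

Definition trunc_poly be n : {poly R} :=
  \sum_(k < n) (be k *+ (k != 0%N :> nat).+1) *: cheb R k.

Lemma trunc_poly_coef be n k : (k < n)%N -> ccoef (trunc_poly be n) k = be k.
Proof.
move=> kn; rewrite /trunc_poly ccoef_sum (bigD1 (Ordinal kn)) //= big1 ?addr0.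
  rewrite ccoefZ ccoef_cheb eqxx; case: k kn => [|k] kn /=.
    by rewrite mulr1n; field.
  by rewrite -mulr_natr; field.
move=> j /negPf jk; rewrite ccoefZ ccoef_cheb.
have jk' : (j == k :> nat) = false by rewrite -jk -val_eqE.
rewrite jk' addr0; have -> : (j + k == 0)%N = false by move: jk'; lia.
by rewrite mul0r mulr0.
Qed.

Definition emb be : int -> R[i] := fun n => (be `|n|%N)%:C.

Lemma fourier_sumS (c : int -> R[i]) x N : fourier_sum c x N.+1 =
  c (- N.+1%:Z) * expi ((- N.+1%:Z)%:~R * x) + fourier_sum c x N + c N.+1%:Z * expi (N.+1%:Z%:~R * x).
Proof.
rewrite /fourier_sum -!(big_mkord xpredT (fun k => c (k%:Z - _%:Z) * expi ((k%:Z - _%:Z)%:~R * x))).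
have -> : ((2 * N.+1).+1 = ((2 * N).+1).+2)%N by lia.
rewrite big_nat_recl // big_nat_recr //= addrA; congr (_ + _ + _).
- by rewrite sub0r.
- by apply: eq_bigr => k _; have -> : k.+1%:Z - N.+1%:Z = k%:Z - N%:Z by lia.
- by have -> : ((2 * N).+2)%:Z - N.+1%:Z = N.+1%:Z by lia.
Qed.

Lemma expi_conj_sum x (b : R) : b%:C * expi (- x) + b%:C * expi x = (b *+ 2 * cos x)%:C.
Proof.
rewrite /expi cosN sinN; simpc.
by apply/eqP; rewrite eq_complex /= mulr2n mulrDl; apply/andP; split; apply/eqP; ring.
Qed.

Lemma fourier_sum_emb be x N :
  fourier_sum (emb be) x N = (series (cterm be (cos x)) N.+1)%:C.
Proof.
elim: N => [|N IH].
  rewrite /fourier_sum /series /= big_mkord !big_ord1 /emb /cterm.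
  rewrite /= subrr mulr0z mul0r /expi cos0 sin0 cheb0 -[(1 : {poly R})]polyC1 hornerC mulr1 mulr1n.
  by apply/eqP; rewrite eq_complex /=; apply/andP; split; apply/eqP; ring.
rewrite fourier_sumS IH [series _ N.+2]/series /= big_nat_recr //= -/(series _ N.+1) rmorphD /=.
rewrite addrAC addrC; congr (_ + _).
rewrite /emb /cterm /= -!pmulrn cheb_cos.
have -> : ((- N.+1%:Z)%:~R : R) = - N.+1%:R by rewrite mulrNz -pmulrn.
by rewrite mulNr expi_conj_sum.
Qed.

Lemma fourier_series_emb be (M : R) x : 0 <= M -> nle 1 be M ->
  fourier_series (emb be) x = (cseries be (cos x))%:C.
Proof.
move=> M0 hb; have hx : -1 <= cos x <= 1 by rewrite cos_geN1 cos_le1.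
have cv := cseries_cvg M0 hb hx.
rewrite /fourier_series; apply: (@cvg_lim (R[i])^o) => //.
apply/cvgrPdist_lt => eps eps0.
(* In the order of [R[i]], a positive element has imaginary part 0. *)
have [er ei] : 0 < complex.Re eps /\ complex.Im eps = 0.
  by move: eps0; rewrite ltcE /= => /andP[/eqP -> ->].
have /cvgrPdist_lt/(_ _ er) [n0 _ h0] := cv.
exists n0 => // n /= n0n; rewrite fourier_sum_emb.
have := h0 n.+1 (leqW n0n); rewrite -/(cseries be (cos x)).
set u := cseries _ _; set v := series _ _ => /= huv.
have -> : (u%:C - v%:C : R[i]) = (u - v)%:C by rewrite rmorphB.
have -> : `|(u - v)%:C| = `|u - v|%:C :> R[i] by rewrite normc_def /= expr0n addr0 sqrtr_sqr.
by rewrite ltcE /= ei eqxx.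
Qed.

End CosineSeries.

(** * Geometric tails of sequences of coefficients *)

Section Telescoping.
Variable R : realType.
Implicit Types (r : R) (g : nat -> nat -> R) (e E : nat -> R).

Lemma telescope_nle r g e E : 1 <= r -> (forall j, 0 < e j) ->
  (forall j, nle r (fun k => g j.+1 k - g j k) (e j)) ->
  (forall J n, \sum_(i < n) e (J + i)%N <= E J) ->
  forall J J', (J <= J')%N -> nle r (fun k => g J' k - g J k) (E J).
Proof.
move=> r1 e0 he hE J J' JJ'; have r0 : 0 <= r by lra.
have E0 : 0 <= E J by have := hE J 0%N; rewrite big_ord0.
rewrite -(subnKC JJ'); case: (J' - J)%N => [|n].
  by move=> K; rewrite addn0 big1 ?powR_ge0 // => k _; rewrite subrr normr0 powR0 // gt_eqF //; lra.
apply: nle_le (hE J n.+1) _ => //; first by rewrite sumr_ge0 // => i _; apply: ltW.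
elim: n => [|n IH].
  by rewrite big_ord1 addn0 addn1; apply: he.
rewrite big_ord_recr /=; apply: (@nle_ext _ _ (fun k => (g (J + n.+1)%N k - g J k) + (g (J + n.+2)%N k - g (J + n.+1)%N k))).
  by move=> k; ring.
apply: nleD => //.
- by rewrite big_ord_recl /= addn0 ltr_wpDr // sumr_ge0 // => i _; apply: ltW.
- by rewrite (addnS J n.+1); apply: he.
Qed.

Lemma geometric_tail (c : R) J n : 0 <= c -> \sum_(i < n) c / 2 ^+ (J + i) <= 2 * c / 2 ^+ J.
Proof.
move=> c0; suff -> : \sum_(i < n) c / 2 ^+ (J + i) = 2 * c / 2 ^+ J - 2 * c / 2 ^+ (J + n).
  by rewrite gerBl divr_ge0 ?mulr_ge0 ?exprn_ge0.
elim: n => [|n IH]; first by rewrite big_ord0 addn0 subrr.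
rewrite big_ord_recr /= IH addnS exprS; field.
by rewrite !gt_eqF // exprn_gt0.
Qed.

Lemma geometric_cvg0 (c : R) : (fun J => c / 2 ^+ J) @ \oo --> (0 : R).
Proof.
have h : `|1 / 2 : R| < 1 by rewrite ger0_norm; lra.
have -> : (fun J => c / 2 ^+ J) = (fun J => c * (1 / 2) ^+ J).
  by apply/funext => J; rewrite expr_div_n expr1n mul1r.
by rewrite -[X in _ --> X](mulr0 c); apply: cvgM; [exact: cvg_cst | exact: cvg_expr].
Qed.

End Telescoping.

(** * The squared positive part of a polynomial has an absolutely convergent series *)

Section Bernstein.
Variable R : realType.
Implicit Types (h : nat -> R) (u : R) (v : {poly R}).

(** De Casteljau's recursion for the Bernstein operator, the sum of 'C(n, k) u^k (1 - u)^(n - k) h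
    k. The general ring lets u be a number or a polynomial. *)
Fixpoint bern (V : comNzRingType) (u : V) n (h : nat -> V) : V :=
  if n is m.+1 then (1 - u) * bern u m h + u * bern u m (fun k => h k.+1) else h 0%N.

Lemma bern_le u n h h' : 0 <= u <= 1 -> (forall k, h k <= h' k) ->
  bern u n h <= bern u n h'.
Proof.
move=> /andP[u0 u1]; elim: n h h' => [|n IH] h h' hh /=; first exact: hh.
by apply: lerD; apply: ler_wpM2l; rewrite ?subr_ge0 //; apply: IH.
Qed.

Lemma eq_bern u n h h' : h =1 h' -> bern u n h = bern u n h'.
Proof.
elim: n h h' => [|n IH] h h' hh /=; first exact: hh.
by rewrite (IH _ _ hh) (IH (fun k => h k.+1) (fun k => h' k.+1)).
Qed.

Lemma bern_affine u n h h' (a b c : R) :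
  bern u n (fun k => a * h k + b * h' k + c) = a * bern u n h + b * bern u n h' + c.
Proof.
elim: n h h' => [//|n IH] h h' /=.
by rewrite (IH h h') (IH (fun k => h k.+1) (fun k => h' k.+1)); ring.
Qed.

Lemma bern_id u n (c : R) : bern u n (fun k => k%:R - c) = n%:R * u - c.
Proof.
elim: n c => [|n IH] c /=; first by rewrite mul0r.
rewrite (eq_bern u n (h := fun k => k.+1%:R - c) (h' := fun k => k%:R - (c - 1))); last by move=> k; rewrite -natr1; ring.
by rewrite !IH -natr1; ring.
Qed.

Lemma bern_sqr u n (c : R) :
  bern u n (fun k => (k%:R - c) ^+ 2) = (n%:R * u - c) ^+ 2 + n%:R * u * (1 - u).
Proof.
elim: n c => [|n IH] c /=; first by ring.
rewrite (eq_bern u n (h := fun k => (k.+1%:R - c) ^+ 2) (h' := fun k => (k%:R - (c - 1)) ^+ 2)); last by move=> k; rewrite -natr1; ring.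
by rewrite !IH -natr1; ring.
Qed.

(** Squaring makes the derivative Lipschitz, so that degree n approximates within 1/n. For degrees
    of order 4^j, Cauchy-Schwarz loses a factor of order 2^j and leaves a summable 2^(-j). *)
Definition possq (y : R) : R := (Num.max 0 y) ^+ 2.

Lemma possq_taylor (y z : R) :
  0 <= possq z - possq y - 2 * Num.max 0 y * (z - y) <= (z - y) ^+ 2.
Proof.
rewrite /possq; have [y0|/ltW y0] := leP y 0; have [z0|/ltW z0] := leP z 0.
- by rewrite expr0n mulr0 mul0r !subr0 lexx sqr_ge0.
- rewrite expr0n mulr0 mul0r !subr0 sqr_ge0 /=.
  have : 0 <= - y * (2 * z - y) by rewrite mulr_ge0 //; lra.
  by rewrite !expr2; lra.
- have : 0 <= y * (y - 2 * z) by rewrite mulr_ge0 //; lra.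
  have : 0 <= z ^+ 2 by rewrite sqr_ge0.
  by rewrite expr0n !expr2 /=; lra.
- have -> : z ^+ 2 - y ^+ 2 - 2 * y * (z - y) = (z - y) ^+ 2 by ring.
  by rewrite sqr_ge0 lexx.
Qed.

(** The Bernstein operator is monotone, exact on affine functions and of variance u (1 - u) / n. It
    is applied to the tangent line at u - 1/2 and to the tangent line plus a square, which enclose
    [possq]. *)
Lemma bern_possq u n : 0 <= u <= 1 -> (0 < n)%N ->
  0 <= bern u n (fun k => possq (k%:R / n%:R - 1 / 2)) - possq (u - 1 / 2) <= n%:R^-1.
Proof.
move=> u01 n0; have [u0 u1] := andP u01.
have np : 0 < n%:R :> R by rewrite ltr0n.
set c := possq (u - 1 / 2); pose m := Num.max 0 (u - 1 / 2).
pose lin (k : nat) : R := k%:R - n%:R * u.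
pose sq (k : nat) : R := (k%:R - n%:R * u) ^+ 2.
have tay k := possq_taylor (u - 1 / 2) (k%:R / n%:R - 1 / 2).
have dE k : k%:R / n%:R - 1 / 2 - (u - 1 / 2) = lin k / n%:R.
  by rewrite /lin; field; rewrite gt_eqF.
have lo : bern u n (fun k => 2 * m / n%:R * lin k + 0 * sq k + c) <=
    bern u n (fun k => possq (k%:R / n%:R - 1 / 2)).
  apply: bern_le => // k; have := tay k; rewrite dE -/c -/m => /andP[h _].
  by rewrite mul0r; lra.
have hi : bern u n (fun k => possq (k%:R / n%:R - 1 / 2)) <=
    bern u n (fun k => 2 * m / n%:R * lin k + n%:R^-1 ^+ 2 * sq k + c).
  apply: bern_le => // k; have := tay k; rewrite dE -/c -/m => /andP[_ h].
  move: h; rewrite exprMn mulrC -/(sq k); lra.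
move: lo hi; rewrite !bern_affine bern_id bern_sqr subrr mulr0 expr0n mul0r !add0r => lo hi.
apply/andP; split; first by lra.
have : n%:R^-1 ^+ 2 * (n%:R * u * (1 - u)) <= n%:R^-1.
  have -> : n%:R^-1 ^+ 2 * (n%:R * u * (1 - u)) = n%:R^-1 * (u * (1 - u)).
    by field; rewrite gt_eqF.
  by rewrite ler_piMr ?invr_ge0 ?(ltW np) //; nra.
lra.
Qed.

(** The substitution u = (1 + v) / 2 maps [-1, 1] to [0, 1], and u - 1/2 = v / 2. *)
Definition bernpoly v n : {poly R} :=
  bern (2^-1 *: (1 + v)) n (fun k => (possq (k%:R / n%:R - 1 / 2))%:P).

Lemma horner_bern (U : {poly R}) n h x :
  (bern U n (fun k => (h k)%:P)).[x] = bern U.[x] n h.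
Proof.
elim: n h => [|n IH] h /=; first by rewrite hornerC.
by rewrite hornerD !hornerM (IH h) (IH (fun k => h k.+1)) hornerD hornerN -[(1 : {poly R})]polyC1 hornerC.
Qed.

Lemma size_bern (U : {poly R}) n h d : (size U <= d)%N -> (0 < d)%N ->
  (size (bern U n (fun k => (h k)%:P))%R <= 1 + n * d)%N.
Proof.
move=> sU d0; elim: n h => [|n IH] h /=; first by rewrite size_polyC; case: (_ != 0).
have s1 : (size (1 - U)%R <= d)%N.
  by apply: size_add_le; rewrite ?size_polyN // size_poly1.
have h1 := size_mul_le s1 (IH h); have h2 := size_mul_le sU (IH (fun k => h k.+1)).
by apply: size_add_le; [apply: leq_trans h1 _ | apply: leq_trans h2 _]; lia.
Qed.

Lemma bernpoly_approx v n x : -1 <= v.[x] <= 1 -> (0 < n)%N ->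
  0 <= (bernpoly v n).[x] - possq (v.[x] / 2) <= n%:R^-1.
Proof.
move=> /andP[v0 v1] n0; rewrite /bernpoly horner_bern hornerZ hornerD -[(1 : {poly R})]polyC1 hornerC.
have -> : v.[x] / 2 = 2^-1 * (1 + v.[x]) - 1 / 2 by field.
by apply: bern_possq => //; apply/andP; split; lra.
Qed.

(** Cauchy-Schwarz over the n possible frequencies, obtained from the nonnegativity of a variance,
    followed by Bessel's inequality. *)
Lemma sum_norm_ccoef (P : {poly R}) n (A c : R) : 0 <= c -> 0 <= A ->
  (size P <= n)%N -> supI_le P A -> n%:R * A ^+ 2 <= c ^+ 2 -> nle 1 (ccoef P) c.
Proof.
move=> c0 A0 sP PA hc K.
rewrite powRr1 //; under eq_bigr do rewrite powRr1 //.
have le1 : \sum_(k < K) `|ccoef P k| <= \sum_(k < n) `|ccoef P k|.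
  have [Kn|nK] := leqP K n.
    rewrite -!(big_mkord xpredT (fun k => `|ccoef P k|)).
    by rewrite [leRHS](@big_cat_nat _ _ _ K) //= lerDl sumr_ge0.
  rewrite -!(big_mkord xpredT (fun k => `|ccoef P k|)).
  rewrite (@big_cat_nat _ _ _ n 0%N K) ?(ltnW nK) //= [X in _ + X]big_nat_cond [X in _ + X]big1 ?addr0 //.
  by move=> k /andP[/andP[nk _] _]; rewrite ccoef_eq0 ?normr0 // (leq_trans sP).
apply: le_trans le1 _.
set t := \sum_(k < n) _; have t0 : 0 <= t by rewrite sumr_ge0.
have t2 : t ^+ 2 <= n%:R * \sum_(k < n) ccoef P k ^+ 2.
  pose m := t / n%:R.
  have [n0|n0] := posnP n; first by rewrite /t n0 !big_ord0 expr0n mul0r.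
  have np : 0 < n%:R :> R by rewrite ltr0n.
  have : 0 <= \sum_(k < n) (`|ccoef P k| - m) ^+ 2 by rewrite sumr_ge0 // => k _; rewrite sqr_ge0.
  rewrite (eq_bigr (fun k : 'I_n => ccoef P k ^+ 2 + (- (2 * m)) * `|ccoef P k| + m ^+ 2)); last first.
    by move=> k _; rewrite sqrrB real_normK ?num_real // -mulr_natl; ring.
  rewrite !big_split /= -mulr_sumr -/t sumr_const card_ord.
  set sq := \sum_(k < n) _ => h.
  have e : n%:R * (sq + - (2 * m) * t + m ^+ 2 *+ n) = n%:R * sq - t ^+ 2.
    by rewrite -[_ *+ n]mulr_natr /m; field; rewrite gt_eqF.
  by rewrite -subr_ge0 -e mulr_ge0 // ltW.
have : t ^+ 2 <= c ^+ 2.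
  apply: le_trans hc; apply: (le_trans t2); rewrite ler_wpM2l //.
  by apply: le_trans (bessel _ _) _; apply: mean_sqr_le.
by rewrite ler_pXn2r ?nnegrE.
Qed.

(* Bernstein polynomials of order 4^j approximate within 4^(-j); by Cauchy-Schwarz
   the l^1 norms of the coefficients of their successive differences are
   O(2^(-j)). *)
Lemma possq_cseries v : (forall x, -1 <= x <= 1 -> -1 <= v.[x] <= 1) ->
  exists (be : nat -> R) (M : R), [/\ 0 < M, nle 1 be M &
    forall x, -1 <= x <= 1 -> cseries be x = possq (v.[x] / 2)].
Proof.
move=> vI; pose d := maxn 1 (size v).
have d0 : (0 < d)%N by rewrite /d leq_max.
have dR : 1 <= d%:R :> R by rewrite ler1n.
pose Q j := bernpoly v (4 ^ j)%N.
have f0 j : (0 < 4 ^ j)%N by rewrite expn_gt0.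
have sQ j : (size (Q j) <= 1 + 4 ^ j * d)%N.
  apply: size_bern => //; apply: size_scale_le; apply: size_add_le; rewrite /d ?leq_maxr //.
  by rewrite size_poly1 leq_max.
have appr j x : -1 <= x <= 1 -> 0 <= (Q j).[x] - possq (v.[x] / 2) <= (4 ^ j)%:R^-1.
  by move=> hx; apply: bernpoly_approx => //; apply: vI.
have inv4 j : (4 ^ j)%:R^-1 = (2 ^+ j)^-1 ^+ 2 :> R.
  by rewrite natrX exprVn -exprM mulnC exprM; congr ((_ ^+ _)^-1); ring.
have step j : nle 1 (fun k => ccoef (Q j.+1) k - ccoef (Q j) k) (8 * d%:R / 2 ^+ j).
  apply: (@nle_ext _ _ (ccoef (Q j.+1 - Q j))); first by move=> k; rewrite ccoefB.
  apply: (@sum_norm_ccoef _ (1 + 4 ^ j.+1 * d) (4 ^ j)%:R^-1).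
  - by rewrite divr_ge0 ?mulr_ge0 ?exprn_ge0.
  - by rewrite invr_ge0.
  - apply: size_add_le; first exact: sQ.
    rewrite size_polyN; apply: leq_trans (sQ j) _; rewrite leq_add2l leq_mul2r; apply/orP; right.
    by rewrite leq_exp2l.
  - move=> x hx; rewrite hornerD hornerN.
    have := appr j x hx; have := appr j.+1 x hx.
    have : (4 ^ j.+1)%:R^-1 <= (4 ^ j)%:R^-1 :> R by rewrite lef_pV2 ?posrE ?ltr0n // ler_nat leq_exp2l.
    by rewrite ler_norml; lra.
  - have -> : (8 * d%:R / 2 ^+ j) ^+ 2 = 64 * d%:R ^+ 2 * (4 ^ j)%:R^-1 :> R.
      by rewrite inv4 !exprMn; ring.
    have p4 : 0 < (4 ^ j)%:R :> R by rewrite ltr0n.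
    rewrite natrD natrM expnS natrM expr2 mulrA ler_wpM2r ?invr_ge0 // mulrDl mul1r.
    have -> : 4%:R * (4 ^ j)%:R * d%:R / (4 ^ j)%:R = 4 * d%:R :> R by field; rewrite gt_eqF.
    have h1 : (4 ^ j)%:R^-1 <= 1 :> R by rewrite invf_le1 // ler1n.
    have h2 : d%:R <= d%:R ^+ 2 :> R by rewrite expr2 ler_peMr.
    by lra.
pose c : R := 8 * d%:R.
have c0 : 0 < c by rewrite /c; lra.
have cauchy := @telescope_nle R 1 (fun j => ccoef (Q j)) (fun j => c / 2 ^+ j) (fun J => 2 * c / 2 ^+ J)
  (lexx _) (fun j => divr_gt0 c0 (exprn_gt0 j (ltr0n R 2))) step (fun J n => geometric_tail J n (ltW c0)).
have E0 J : 0 <= 2 * c / 2 ^+ J by rewrite divr_ge0 ?mulr_ge0 ?exprn_ge0 ?(ltW c0).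
have [be hbe] := @coefs_limit R (fun j => ccoef (Q j)) _
  (fun J J' k JJ' => nle_coef k ltr01 (E0 J) (cauchy J J' JJ')) (geometric_cvg0 (2 * c)).
have lim J : nle 1 (fun k => be k - ccoef (Q J) k) (2 * (2 * c / 2 ^+ J)).
  by apply: (nle_lim ltr01 (E0 J) hbe); exists J => // J' /= JJ'; apply: cauchy.
have [Q0 Q0p Q0P] : exists2 M : R, 0 < M & nle 1 (ccoef (Q 0%N)) M.
  have [B B0 hB] := supI_ex (Q 0%N).
  pose n := size (Q 0%N); exists ((1 + n%:R) * B); first by rewrite mulr_gt0 // ltr_pwDl.
  apply: (@sum_norm_ccoef _ n B) => //; try exact: ltW.
    by rewrite mulr_ge0 ?(ltW B0) // addr_ge0.
  rewrite exprMn ler_wpM2r ?sqr_ge0 // expr2.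
  have : 0 <= n%:R :> R by []. 
  by nra.
have EE J : 0 < 2 * (2 * c / 2 ^+ J) by rewrite mulr_gt0 // divr_gt0 ?exprn_gt0 // mulr_gt0.
have beM : nle 1 be (Q0 + 2 * (2 * c / 2 ^+ 0)).
  apply: (@nle_ext _ _ (fun k => ccoef (Q 0%N) k + (be k - ccoef (Q 0%N) k))).
    by move=> k; rewrite addrC subrK.
  by apply: nleD.
exists be, (Q0 + 2 * (2 * c / 2 ^+ 0)); split => //; first by rewrite addr_gt0.
move=> x hx; apply/eqP; rewrite -subr_eq0 -normr_le0; apply/ler_addgt0Pl => eps eps0; rewrite addr0.
have ec : 0 < 2 * (2 * (2 * c)) + 1 by lra.
have /cvgrPdist_lt/(_ _ (divr_gt0 eps0 ec)) [J _ hJ] := geometric_cvg0 (1 : R).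
have := hJ J (leqnn J); rewrite /= sub0r normrN ger0_norm ?divr_ge0 ?exprn_ge0 // => hJ1.
have QM : nle 1 (ccoef (Q J)) (Q0 + 2 * c / 2 ^+ 0).
  apply: (@nle_ext _ _ (fun k => ccoef (Q 0%N) k + (ccoef (Q J) k - ccoef (Q 0%N) k))).
    by move=> k; rewrite addrC subrK.
  apply: nleD => //; last exact: cauchy.
  by rewrite divr_gt0 ?exprn_gt0 // mulr_gt0.
have d1 := @cseries_diff R be (ccoef (Q J)) _ _ _ x (ltW (addr_gt0 Q0p (EE 0%N)))
   (addr_ge0 (ltW Q0p) (E0 0%N)) (ltW (EE J)) beM QM (lim J) hx.
rewrite cseries_poly in d1.
have d2 := appr J x hx.
have d3 : (4 ^ J)%:R^-1 <= 1 / 2 ^+ J :> R.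
  by rewrite inv4 expr2 mul1r ler_piMr ?invr_ge0 ?exprn_ge0 // invf_le1 ?exprn_gt0 // exprn_ege1 // ler1n.
have d4 : `|cseries be x - possq (v.[x] / 2)| <= (2 * (2 * (2 * c)) + 1) * (1 / 2 ^+ J).
  have -> : cseries be x - possq (v.[x] / 2) = (cseries be x - (Q J).[x]) + ((Q J).[x] - possq (v.[x] / 2)) by ring.
  have -> : (2 * (2 * (2 * c)) + 1) * (1 / 2 ^+ J) = 2 * (2 * (2 * c / 2 ^+ J)) + 1 / 2 ^+ J by field; rewrite gt_eqF // exprn_gt0.
  apply: (le_trans (ler_normD _ _)); apply: lerD => //.
  by rewrite ger0_norm; lra.
apply: (le_trans d4); rewrite mulrC -ler_pdivlMr //; exact: ltW.
Qed.

End Bernstein.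

(** * Trigonometric polynomials are cyclic in l^p *)

Section LpSum.
Variable R : realType.
Implicit Types (p : R) (c d : int -> R[i]) (s : seq (R[i] * int)).

(** The p-th power of [lpnorm]. Working without the root, a triangle inequality up to the factor 2^p
    is enough for all density arguments. *)
Definition lpsum p c : \bar R :=
  \esum_(n in [set: int]) ((Normc.normc (c n)) `^ p)%:E.

Lemma normc_ge0 (z : R[i]) : 0 <= Normc.normc z.
Proof. by case: z => x y; rewrite /= sqrtr_ge0. Qed.

Lemma esum_scale_le (I : choiceType) (A : set I) (k : R) (f : I -> \bar R) : 0 <= k ->
  (forall i, (0 <= f i)%E) ->
  (\esum_(i in A) (k%:E * f i) <= k%:E * \esum_(i in A) f i)%E.
Proof.
move=> k0 f0; apply: ub_ereal_sup => _ [X XA <-].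
rewrite -ge0_mule_fsumr //; apply: lee_wpmul2l; first by rewrite lee_fin.
by apply: esum_ge; exists X.
Qed.

Lemma lpsum_ge0 p c : (0 <= lpsum p c)%E.
Proof. by apply: esum_ge0 => n _; rewrite lee_fin powR_ge0. Qed.

Lemma lpsum_scale p (k : R) c d : 0 <= k ->
  (forall n, Normc.normc (c n) `^ p <= k * Normc.normc (d n) `^ p) ->
  (lpsum p c <= k%:E * lpsum p d)%E.
Proof.
move=> k0 h; apply: le_trans (esum_scale_le _ k0 _); last by move=> n; rewrite lee_fin powR_ge0.
by apply: le_esum => n _; rewrite -EFinM lee_fin.
Qed.

Lemma lpsumD p c d : 0 < p ->
  (lpsum p (fun n => c n + d n)%R <= (2 `^ p)%:E * (lpsum p c + lpsum p d))%E.
Proof.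
move=> p0; rewrite -esumD; [|by move=> n _; rewrite lee_fin powR_ge0..].
apply: le_trans (esum_scale_le _ (powR_ge0 2 p) _); last first.
  by move=> n; rewrite adde_ge0 // lee_fin powR_ge0.
apply: le_esum => n _; rewrite -EFinD -EFinM lee_fin.
set x := Normc.normc (c n); set y := Normc.normc (d n).
have x0 : 0 <= x by apply: normc_ge0.
have y0 : 0 <= y by apply: normc_ge0.
apply: (@le_trans _ _ ((2 * Num.max x y) `^ p)).
  apply: ge0_ler_powR; rewrite ?nnegrE ?normc_ge0 ?(ltW p0) //.
    by rewrite mulr_ge0 // le_max x0.
  apply: (le_trans (le_normcD _ _)); rewrite -/x -/y mulr_natl mulr2n.
  by apply: lerD; rewrite le_max lexx ?orbT.
rewrite powRM ?le_max ?x0 // ler_wpM2l ?powR_ge0 //.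
by case: (leP x y) => _; rewrite ?lerDr ?lerDl powR_ge0.
Qed.

Lemma lpsum_ext p c d : c =1 d -> lpsum p c = lpsum p d.
Proof. by move=> h; apply: eq_esum => n _; rewrite h. Qed.

Lemma lpsum_translate p m c : lpsum p (translate m c) = lpsum p c.
Proof.
rewrite /lpsum [RHS](@reindex_esum R int int [set: int] [set: int] (fun n => n - m)) //.
split => //; first by move=> i j _ _ /addIr.
by move=> n _; exists (n + m) => //; rewrite addrK.
Qed.

Lemma lpsum_int_le p c (A B : R) :
  (forall K, \sum_(k < K) Normc.normc (c (Posz k)) `^ p <= A) ->
  (forall K, \sum_(k < K) Normc.normc (c (Negz k)) `^ p <= B) ->
  (lpsum p c <= (A + B)%:E)%E.
Proof.
move=> hA hB; rewrite /lpsum (esumID [set n : int | 0 <= n]); last first.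
  by move=> n _; rewrite lee_fin powR_ge0.
have nat_le (f : nat -> R) (C : R) : (forall k, 0 <= f k) -> (forall K, \sum_(k < K) f k <= C) ->
    (\esum_(k in [set: nat]) (f k)%:E <= C%:E)%E.
  move=> f0 hf; rewrite -nneseries_esumT; last by move=> k; rewrite lee_fin.
  apply: lime_le; first by apply: is_cvg_nneseries => k _ _; rewrite lee_fin.
  by near=> K; rewrite sumEFin lee_fin big_mkord.
rewrite EFinD; apply: leeD; rewrite setTI.
  rewrite (@reindex_esum R nat int [set: nat] _ Posz); first by apply: nat_le => // k; exact: powR_ge0.
  split => //; first by move=> i j _ _ [].
  by case=> k //= _; exists k.
rewrite (@reindex_esum R nat int [set: nat] _ Negz); first by apply: nat_le => // k; exact: powR_ge0.
split => //; first by move=> i j _ _ [].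
by case=> k //= h; exists k.
Unshelve. all: by end_near. Qed.

Lemma lpsum_emb_le p (be : nat -> R) (A : R) : nle p be A ->
  (lpsum p (emb be) <= (A `^ p + A `^ p)%:E)%E.
Proof.
move=> h.
have nE (x : R) : Normc.normc x%:C = `|x| by rewrite /= expr0n addr0 sqrtr_sqr.
apply: lpsum_int_le => K.
  by under eq_bigr do rewrite /emb nE; apply: h.
apply: le_trans (h K.+1); rewrite big_ord_recl ler_wpDl ?powR_ge0 //.
by apply: ler_sum => k _; rewrite /emb nE.
Qed.

Definition conv s c : int -> R[i] := fun n => \sum_(k <- s) k.1 * c (n - k.2).

Lemma conv_span s c : translates_span c (conv s c).
Proof. by exists s. Qed.

Lemma convD s c d n : conv s (fun n => c n + d n) n = conv s c n + conv s d n.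
Proof. by rewrite /conv -big_split /=; apply: eq_bigr => k _; rewrite mulrDr. Qed.

Lemma lpsum_conv p s : 0 < p -> exists2 C : R, 0 <= C &
  forall c, (lpsum p (conv s c) <= C%:E * lpsum p c)%E.
Proof.
move=> p0; elim: s => [|k s [C C0 IH]].
  exists 0 => // c; rewrite mul0e /lpsum esum1 // => n _.
  by rewrite /conv big_nil Normc.normc0 powR0 // gt_eqF.
exists (2 `^ p * (Normc.normc k.1 `^ p + C)).
  by rewrite mulr_ge0 ?powR_ge0 // addr_ge0 ?powR_ge0.
move=> c.
have -> : lpsum p (conv (k :: s) c) = lpsum p (fun n => k.1 * translate k.2 c n + conv s c n).
  by apply: lpsum_ext => n; rewrite /conv big_cons.
apply: (le_trans (lpsumD _ _ p0)).
rewrite EFinM -muleA; apply: lee_wpmul2l; first by rewrite lee_fin powR_ge0.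
rewrite EFinD ge0_muleDl ?lee_fin ?powR_ge0 //; apply: leeD; last exact: IH.
rewrite -(lpsum_translate p k.2 c); apply: lpsum_scale; first exact: powR_ge0.
by move=> n; rewrite Normc.normcM powRM ?normc_ge0.
Qed.

Definition delta0 : int -> R[i] := fun n => (n == 0)%:R.

Definition pseq (Q : {poly R[i]}) : int -> R[i] := fun n => if n is Posz k then Q`_k else 0.

Lemma pseqB (P Q : {poly R[i]}) n : pseq (P - Q) n = pseq P n - pseq Q n.
Proof. by case: n => k /=; rewrite ?coefB ?subr0. Qed.

Lemma pseqD (P Q : {poly R[i]}) n : pseq (P + Q) n = pseq P n + pseq Q n.
Proof. by case: n => k /=; rewrite ?coefD ?addr0. Qed.

Definition plist (G : {poly R[i]}) : seq (R[i] * int) := [seq (G`_i, Posz i) | i <- iota 0 (size G)].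

Lemma pseq_conv (G Q : {poly R[i]}) n : pseq (G * Q) n = conv (plist G) (pseq Q) n.
Proof.
rewrite /conv /plist big_map /=.
case: n => k; last first.
  rewrite big1 // => i _; have -> : Negz k - Posz i = Negz (k + i) by lia.
  by rewrite mulr0.
rewrite /= coefM -(big_mkord xpredT (fun i => G`_i * Q`_(k - i))) -/(index_iota 0 _).
have -> : iota 0 (size G) = index_iota 0 (size G) by rewrite /index_iota subn0.
pose F i := G`_i * pseq Q (Posz k - Posz i).
have e1 : \sum_(0 <= i < k.+1) G`_i * Q`_(k - i) = \sum_(0 <= i < k.+1) F i.
  apply: eq_big_nat => i /andP[_ ik]; rewrite /F.
  by have -> : Posz k - Posz i = Posz (k - i) by lia.
have ext m l : (m <= l)%N -> (forall i, (m <= i)%N -> F i = 0) ->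
    \sum_(0 <= i < l) F i = \sum_(0 <= i < m) F i.
  move=> ml h; rewrite (@big_cat_nat _ _ _ m 0%N l) //= [X in _ + X]big_nat_cond [X in _ + X]big1 ?addr0 //.
  by move=> i /andP[/andP[mi _] _]; apply: h.
rewrite e1; pose l := maxn k.+1 (size G).
rewrite -(ext k.+1 l) ?leq_maxl //; last first.
  move=> i ki; rewrite /F; have -> : Posz k - Posz i = Negz (i - k.+1) by lia.
  by rewrite mulr0.
rewrite (ext (size G) l) ?leq_maxr // => i si.
by rewrite /F nth_default ?mul0r.
Qed.

Lemma pseq_shift (Q : {poly R[i]}) m : pseq ('X^m * Q) =1 translate m (pseq Q).
Proof.
move=> [k|k]; rewrite /translate /=.
  rewrite coefXnM; case: ltnP => km.
    by have -> : Posz k - Posz m = Negz (m - k.+1) by lia.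
  by have -> : Posz k - Posz m = Posz (k - m) by lia.
by have -> : Negz k - Posz m = Negz (k + m) by lia.
Qed.

Lemma lpsum_pseq_le p (D : {poly R[i]}) n (b : R) : 0 < p -> 0 <= b -> (size D <= n)%N ->
  (forall k, Normc.normc D`_k <= b) -> (lpsum p (pseq D) <= (n%:R * b `^ p)%:E)%E.
Proof.
move=> p0 b0 sD hb; rewrite -[X in (X%:E)%E]addr0; apply: lpsum_int_le => K; last first.
  by rewrite big1 // => k _; rewrite /= expr0n addr0 sqrtr0 powR0 // gt_eqF.
apply: (@le_trans _ _ (\sum_(k < K) (k < n)%N%:R * b `^ p)).
  apply: ler_sum => k _ /=; case: ltnP => kn.
    by rewrite mul1r; apply: ge0_ler_powR; rewrite ?nnegrE ?normc_ge0 ?hb // ltW.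
  by rewrite nth_default ?(leq_trans sD) // Normc.normc0 powR0 ?mul0r // gt_eqF.
rewrite -mulr_suml ler_wpM2r ?powR_ge0 //.
rewrite -natr_sum ler_nat; elim: K => [|K IH]; first by rewrite big_ord0.
case: (ltnP K n) => Kn.
  apply: (@leq_trans K.+1) => //; rewrite -[X in (_ <= X)%N]card_ord -sum1_card.
  by apply: leq_sum => k _; case: (_ < _)%N.
by rewrite big_ord_recr /= ltnNge Kn /= addn0.
Qed.

Lemma large_ex p (eps : R) : 1 < p -> 0 < eps ->
  exists2 M, (0 < M)%N & M.+1%:R * (1 / M%:R) `^ p <= eps.
Proof.
move=> p1 e0; have p0 : 0 < p by lra.
pose ee := (eps / 2) `^ p^-1.
have ee0 : 0 < ee by rewrite powR_gt0 // divr_gt0.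
have eep : ee `^ p = eps / 2 by rewrite /ee -powRrM mulVf ?gt_eqF // powRr1 // divr_ge0 // ltW.
have h2 : 0 < 1 / 2 :> R by lra.
pose M := (Num.truncn (((2 * (1 / 2) * ee) `^ (- p)) `^ (p - 1)^-1)).+1.
have M0 : (0 < M)%N by [].
have MR : 0 < M%:R :> R by rewrite ltr0n.
exists M => //.
have := freq_pnorm p1 h2 ee0 M0 (ltW (truncnS_gt _)); rewrite eep.
have -> : 1 / (2 * M%:R * (1 / 2)) = 1 / M%:R :> R by field; rewrite gt_eqF.
move: (powR_ge0 (1 / M%:R) p); set t := (1 / M%:R) `^ p => t0 h.
have : M.+1%:R <= 2 * M%:R :> R by rewrite -natr1 mulr_natl mulr2n lerD2l ler1n.
by move=> /(ler_wpM2r t0); lra.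
Qed.

Lemma normcX (z : R[i]) n : Normc.normc (z ^+ n) = Normc.normc z ^+ n.
Proof.
elim: n => [|n IH]; first by rewrite !expr0 Normc.normc1.
by rewrite !exprS Normc.normcM IH.
Qed.

Lemma normc_nat n : Normc.normc (n%:R : R[i]) = n%:R.
Proof.
have -> : (n%:R : R[i]) = (n%:R)%:C by rewrite rmorph_nat.
by rewrite /= expr0n addr0 sqrtr_sqr ger0_norm.
Qed.

(* [X^M] (or [1]) minus the mean of the monomials [z^(M-j) X^j] vanishes at [z],
   while this mean has small [l^p] norm because [p > 1]. *)
Lemma linear_cyclic p (z : R[i]) (eps : R) : 1 < p -> 0 < eps ->
  exists (G : {poly R[i]}) M, (lpsum p (pseq (G * ('X - z%:P) - 'X^M)) <= eps%:E)%E.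
Proof.
move=> p1 e0; have p0 : 0 < p by lra.
have [M M0 hM] := large_ex p1 e0.
have MC : (M%:R : R[i]) != 0 by rewrite pnatr_eq0 -lt0n.
have b0 : 0 <= 1 / M%:R :> R by rewrite divr_ge0.
suff [m [D [sD hD rD]]] : exists m (D : {poly R[i]}),
    [/\ (size D <= M.+1)%N, forall k, Normc.normc D`_k <= 1 / M%:R & root ('X^m - D) z].
  have /dvdpP [G hG] : ('X - z%:P %| 'X^m - D)%R by rewrite dvdp_XsubCl.
  exists G, m; apply: (@le_trans _ _ (M.+1%:R * (1 / M%:R) `^ p)%:E); last by rewrite lee_fin.
  rewrite -hG; have -> : 'X^m - D - 'X^m = - D by ring.
  apply: lpsum_pseq_le => //; rewrite ?size_polyN //.
  by move=> k; rewrite coefN; move: (hD k); case: (D`_k) => x y /=; rewrite !sqrrN.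
have nM : Normc.normc (M%:R^-1 : R[i]) = 1 / M%:R by rewrite Normc.normcV normc_nat div1r.
have [z1|z1] := leP (Normc.normc z) 1.
  exists M, (\poly_(j < M) (M%:R^-1 * z ^+ (M - j))); split.
  - by rewrite (leq_trans (size_poly _ _)).
  - move=> k; rewrite coef_poly; case: ifP => _; last by rewrite Normc.normc0.
    rewrite Normc.normcM nM normcX ler_piMr // exprn_ile1 //; exact: normc_ge0.
  - rewrite rootE hornerD hornerN hornerXn horner_poly subr_eq0.
    rewrite (eq_bigr (fun=> M%:R^-1 * z ^+ M)); last first.
      by move=> j _; rewrite -mulrA -exprD subnK // ltnW.
    by rewrite sumr_const card_ord -[_ *+ M]mulr_natl mulrA mulfV // mul1r.
have z0 : z != 0 by apply: contraTneq z1 => ->; rewrite Normc.normc0 -leNgt ler01.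
exists 0%N, (\poly_(j < M.+1) (if j == 0%N then 0 else M%:R^-1 * z ^- j)); split.
- exact: size_poly.
- move=> k; rewrite coef_poly; case: ifP => _; last by rewrite Normc.normc0.
  case: ifP => _; first by rewrite Normc.normc0.
  rewrite Normc.normcM nM Normc.normcV normcX ler_piMr // invf_le1.
    by rewrite exprn_ege1 // ltW.
  by rewrite exprn_gt0 // (lt_trans ltr01).
- rewrite rootE hornerD hornerN expr0 -[(1 : {poly R[i]})]polyC1 hornerC horner_poly subr_eq0.
  rewrite big_ord_recl /= mul0r add0r (eq_bigr (fun=> M%:R^-1)); last first.
    by move=> j _; rewrite /bump /= -mulrA mulVf ?mulr1 // expf_neq0.
  by rewrite sumr_const card_ord -[_ *+ M]mulr_natl mulfV.
Qed.

(** Induction on the roots. The multiplier G2 of the remaining factors is found before that of the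
    new linear factor, whose error is then made small relative to the norm of convolution by G2
    Q'. *)
Lemma poly_cyclic p (Q : {poly R[i]}) (eps : R) : 1 < p -> Q != 0 -> 0 < eps ->
  exists (G : {poly R[i]}) M, (lpsum p (pseq (G * Q - 'X^M)) <= eps%:E)%E.
Proof.
move=> p1 Q0; have p0 : 0 < p by lra.
have [r ->] := closed_field_poly_normal Q.
have c0 : lead_coef Q != 0 by rewrite lead_coef_eq0.
move: (lead_coef Q) c0 => c c0.
elim: r eps => [|z r IH] eps e0.
  exists (c^-1)%:P, 0%N; rewrite big_nil -mul_polyC mulr1 -polyCM mulVf // expr0 polyC1 subrr.
  apply: le_trans (lpsum_pseq_le (n := 0%N) (b := 0) p0 (lexx _) _ _) _; rewrite ?size_poly0 //.
    by move=> k; rewrite coef0 Normc.normc0.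
  by rewrite mul0r lee_fin ltW.
set Q' := c *: \prod_(z <- r) ('X - z%:P) in IH.
have -> : c *: \prod_(z <- z :: r) ('X - z%:P) = ('X - z%:P) * Q'.
  by rewrite big_cons /Q' scalerAr.
have t0 : 0 < 2 `^ p :> R by rewrite powR_gt0.
have [|G2 [M2 h2]] := IH (eps / 2 / 2 `^ p); first by rewrite !divr_gt0.
have [C C0 hC] := lpsum_conv (plist (G2 * Q')) p0.
have [|G1 [M1 h1]] := @linear_cyclic p z (eps / 2 / 2 `^ p / (C + 1)) p1.
  by rewrite !divr_gt0 //; lra.
exists (G1 * G2), (M1 + M2)%N.
have -> : G1 * G2 * (('X - z%:P) * Q') - 'X^(M1 + M2) =
   (G2 * Q') * (G1 * ('X - z%:P) - 'X^M1) + 'X^M1 * (G2 * Q' - 'X^M2).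
  by rewrite exprD; ring.
rewrite (@lpsum_ext p _ (fun n => conv (plist (G2 * Q')) (pseq (G1 * ('X - z%:P) - 'X^M1)) n +
    translate M1 (pseq (G2 * Q' - 'X^M2)) n)); last first.
  by move=> n; rewrite pseqD pseq_conv pseq_shift.
apply: (le_trans (lpsumD _ _ p0)); rewrite lpsum_translate.
apply: (@le_trans _ _ ((2 `^ p)%:E * ((C * (eps / 2 / 2 `^ p / (C + 1)))%:E + (eps / 2 / 2 `^ p)%:E))%E).
  apply: lee_wpmul2l; first by rewrite lee_fin ltW.
  apply: leeD => //; apply: (le_trans (hC _)); rewrite EFinM.
  by apply: lee_wpmul2l => //; rewrite lee_fin.
rewrite -EFinD -EFinM lee_fin.
have -> : 2 `^ p * (C * (eps / 2 / 2 `^ p / (C + 1)) + eps / 2 / 2 `^ p) = (eps / 2) * (C / (C + 1)) + eps / 2.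
  by field; rewrite !gt_eqF //; lra.
have : C / (C + 1) <= 1 by rewrite ler_pdivrMr //; lra.
have e2 : 0 <= eps / 2 by rewrite divr_ge0 // ltW.
by move=> /(ler_wpM2l e2); lra.
Qed.

(** One combination of translates serves a whole l^p neighbourhood of the coefficients of a, since
    convolution by it is bounded; this is what survives in the limit. *)
Lemma cosine_poly_cyclic p (a : {poly R}) (tau : R) : 1 < p -> mean a != 0 -> 0 < tau ->
  exists s (eps : R), 0 < eps /\ forall d : int -> R[i], (lpsum p d <= eps%:E)%E ->
    (lpsum p (fun n => conv s (fun n => emb (ccoef a) n + d n)%R n - delta0 n)%R <= tau%:E)%E.
Proof.
move=> p1 a0 tau0; have p0 : 0 < p by lra.
pose sz := size a.
pose Z := \poly_(j < (sz + sz).+1) emb (ccoef a) (Posz j - Posz sz).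
have Z0 : Z != 0.
  apply/eqP => /(congr1 (fun P : {poly R[i]} => P`_sz)); rewrite coef_poly coef0.
  have -> : (sz < (sz + sz).+1)%N by lia.
  rewrite subrr /emb /= ccoef0 => /(congr1 (@complex.Re R)) /= h.
  by rewrite h eqxx in a0.
have ZE n : pseq Z n = translate sz (emb (ccoef a)) n.
  rewrite /translate /emb; case: n => k /=; last by rewrite ccoef_eq0 //; rewrite /sz; lia.
  rewrite coef_poly; case: ltnP => // kz; rewrite ccoef_eq0 //.
  by move: kz; rewrite /sz; lia.
have t0 : 0 < 2 `^ p :> R by rewrite powR_gt0.
have [|G [M hG]] := @poly_cyclic p Z (tau / 2 / 2 `^ p) p1 Z0; first by rewrite !divr_gt0.
(* Z is the coefficient sequence of a moved by sz, and G Z is close to X^M; the translation by sz -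
   M brings this monomial to the index 0. *)
pose s := [seq (k.1, k.2 + (Posz sz - Posz M)) | k <- plist G].
have sE c n : conv s c n = conv (plist G) c (n - (Posz sz - Posz M)).
  rewrite /conv /s big_map; apply: eq_bigr => k _ /=.
  by congr (_ * c _); rewrite opprD addrA addrAC.
have [C C0 hC] := lpsum_conv s p0.
exists s, (tau / 2 / 2 `^ p / (C + 1)); split; first by rewrite !divr_gt0 //; lra.
move=> d hd.
rewrite (@lpsum_ext p _ (fun n => translate (- Posz M) (pseq (G * Z - 'X^M)) n + conv s d n)); last first.
  move=> n; rewrite convD addrAC; congr (_ + _).
  rewrite /translate pseqB pseq_conv sE opprK; congr (_ - _).
    rewrite /conv; apply: eq_bigr => k _; rewrite ZE /translate; congr (_ * emb _ _).
    by rewrite opprB; clear; lia.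
  rewrite /delta0; case: n => n /=.
    by rewrite coefXn; have -> : (n + M == M)%N = (Posz n == 0) by clear; lia.
  case e : (Negz n + Posz M) => [j|j] //=.
  rewrite coefXn; have -> : (j == M) = false by clear -e; lia.
  by [].
apply: (le_trans (lpsumD _ _ p0)); rewrite lpsum_translate.
apply: (@le_trans _ _ ((2 `^ p)%:E * ((tau / 2 / 2 `^ p)%:E + (C * (tau / 2 / 2 `^ p / (C + 1)))%:E))%E).
  apply: lee_wpmul2l; first by rewrite lee_fin ltW.
  apply: leeD => //; apply: (le_trans (hC _)); rewrite EFinM.
  by apply: lee_wpmul2l => //; rewrite lee_fin.
rewrite -EFinD -EFinM lee_fin.
have -> : 2 `^ p * (tau / 2 / 2 `^ p + C * (tau / 2 / 2 `^ p / (C + 1))) = (tau / 2) * (C / (C + 1)) + tau / 2.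
  by field; rewrite !gt_eqF //; lra.
have : C / (C + 1) <= 1 by rewrite ler_pdivrMr //; lra.
have e2 : 0 <= tau / 2 by rewrite divr_ge0 // ltW.
by move=> /(ler_wpM2l e2); lra.
Qed.

End LpSum.

(** * Criteria for cyclicity *)

Section Criteria.
Variable R : realType.
Implicit Types (p q : R) (c d : int -> R[i]).

Lemma lpnorm_lt p c (eps : R) : 0 < p -> 0 < eps -> (lpnorm p c < eps%:E)%E ->
  (lpsum p c <= (eps `^ p)%:E)%E.
Proof.
move=> p0 e0; rewrite /lpnorm -/(lpsum p c); have := lpsum_ge0 p c.
case: (lpsum p c) => [r| |] //.
  rewrite lee_fin poweR_EFin lte_fin => r0 h; rewrite lee_fin.
  rewrite -[r](powRr1 r0) -(mulVf (lt0r_neq0 p0)) powRrM.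
  by apply: ge0_ler_powR; rewrite ?nnegrE ?powR_ge0 // ltW.
by move=> _; rewrite poweRyr ?invr_eq0 ?gt_eqF.
Qed.

Lemma lpsum_lt p c (eps : R) : 0 < p -> 0 < eps -> (lpsum p c <= ((eps / 2) `^ p)%:E)%E ->
  (lpnorm p c < eps%:E)%E.
Proof.
move=> p0 e0; rewrite /lpnorm -/(lpsum p c); have := lpsum_ge0 p c.
case: (lpsum p c) => [r| |] //.
rewrite lee_fin poweR_EFin lte_fin => r0; rewrite lee_fin => h.
apply: (@le_lt_trans _ _ (eps / 2)); last by lra.
have e2 : 0 <= eps / 2 by rewrite divr_ge0 // ltW.
have -> : eps / 2 = ((eps / 2) `^ p) `^ p^-1 by rewrite -powRrM mulfV ?gt_eqF // powRr1.
by apply: ge0_ler_powR; rewrite ?nnegrE ?powR_ge0 ?invr_ge0 // ltW.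
Qed.

Lemma lpsum_fin p c : 0 < p -> lp p c -> (lpsum p c < +oo)%E.
Proof.
by move=> p0; rewrite /lp /= /lpnorm -/(lpsum p c); apply: lty_poweRy; rewrite invr_eq0 gt_eqF.
Qed.

Lemma normcN1 (z : R[i]) : Normc.normc (- z) = Normc.normc z.
Proof. by case: z => u v /=; rewrite !sqrrN. Qed.

Lemma lpsumN p c d : (forall n, d n = - c n) -> lpsum p d = lpsum p c.
Proof. by move=> h; apply: eq_esum => n _; rewrite h normcN1. Qed.

Lemma conv_conv s t c : exists u, conv s (conv t c) = conv u c.
Proof.
exists [seq (k.1 * l.1, k.2 + l.2) | k <- s, l <- t].
apply/funext => n; rewrite /conv big_allpairs_dep /=; apply: eq_bigr => k _.
by rewrite mulr_sumr; apply: eq_bigr => l _ /=; rewrite mulrA opprD addrA.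
Qed.

Lemma finite_approx p (x : int -> R[i]) (tau : R) : 0 < p -> (lpsum p x < +oo)%E -> 0 < tau ->
  exists s : seq (R[i] * int), (lpsum p (fun n => x n - conv s (@delta0 R) n)%R <= tau%:E)%E.
Proof.
move=> p0 xfin tau0; pose f n := ((Normc.normc (x n)) `^ p)%:E.
have f0 n : (0 <= f n)%E by rewrite lee_fin powR_ge0.
have fn : lpsum p x \is a fin_num by rewrite ge0_fin_numE // lpsum_ge0.
have [_ [X [Xfin _] <-] hX] := ub_ereal_sup_adherent tau0 fn.
have := @esumID R int X [set: int] f (fun n _ => f0 n); rewrite !setTI -[\esum_(i in [set: int]) f i]/(lpsum p x).
rewrite esum_fset // => xE.
have tail : (\esum_(i in ~` X) f i <= tau%:E)%E.
  have X0 : (\sum_(i \in X) f i)%E \is a fin_num.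
    rewrite ge0_fin_numE; last by apply: fsume_ge0.
    by apply: le_lt_trans xfin; rewrite xE leeDl // esum_ge0.
  have hX' : (lpsum p x - tau%:E < \sum_(i \in X) f i)%E by [].
  rewrite xE in hX'.
  have h2 : (\esum_(i in ~` X) f i)%E \is a fin_num.
    rewrite ge0_fin_numE; last by apply: esum_ge0.
    by apply: le_lt_trans xfin; rewrite xE leeDr // fsume_ge0.
  move: hX' X0 h2; case: (\sum_(i \in X) f i)%E => [u| |] //; case: (\esum_(i in ~` X) f i)%E => [v| |] //.
  by move=> h _ _; rewrite lee_fin; have : u + v - tau < u by []; lra.
have [s [su sX]] : exists s : seq int, uniq s /\ X = [set` s].
  have [s sX] := (finite_seqP X).1 Xfin; exists (undup s); split; first exact: undup_uniq.
  by rewrite sX; apply/seteqP; split => k /=; rewrite mem_undup.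
exists [seq (x k, k) | k <- s].
have convE n : conv [seq (x k, k) | k <- s] (@delta0 R) n = if n \in s then x n else 0.
  rewrite /conv big_map /delta0; case: ifPn => ns.
    rewrite (big_rem n) //= subrr eqxx mulr1 big_seq big1 ?addr0 // => k.
    rewrite mem_rem_uniq; last by [].
    by rewrite !inE subr_eq0 eq_sym => /andP[/negPf -> _]; rewrite mulr0.
  rewrite big_seq big1 // => k ks; rewrite subr_eq0; case: eqP => [e|]; last by rewrite mulr0.
  by rewrite e ks in ns.
apply: le_trans tail; rewrite /lpsum (esumID X); last by move=> n _; rewrite lee_fin powR_ge0.
rewrite !setTI esum1 ?add0e.
  apply: le_esum => n nX; rewrite convE; case: ifPn => [ns|]; last by rewrite subr0.
  by exfalso; apply: nX; rewrite sX.
move=> n; rewrite convE sX /= => ->.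
by rewrite subrr Normc.normc0 powR0 // gt_eqF.
Qed.

(** It suffices to approximate [delta0]: its finite combinations of translates are dense, and
    convolution by a fixed one, bounded on l^p, carries the approximation over. *)
Lemma cyclic_criterion p c : 0 < p ->
  (forall tau : R, 0 < tau -> exists s, (lpsum p (fun n => conv s c n - @delta0 R n)%R <= tau%:E)%E) ->
  cyclic p c.
Proof.
move=> p0 hc x xp eps e0.
have t0 : 0 < 2 `^ p :> R by rewrite powR_gt0.
pose tau : R := (eps / 2) `^ p / 2 / 2 `^ p.
have e2 : 0 < (eps / 2) `^ p by rewrite powR_gt0 // divr_gt0.
have tau0 : 0 < tau by rewrite /tau !divr_gt0.
have [s hs] := finite_approx p0 (lpsum_fin p0 xp) tau0.
have [C C0 hC] := lpsum_conv s p0.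
have [|t ht] := hc (tau / (C + 1)); first by rewrite divr_gt0 //; lra.
have [u hu] := conv_conv s t c.
exists (conv u c); first exact: conv_span.
apply: lpsum_lt => //; rewrite -hu.
rewrite (@lpsum_ext _ p _ (fun n => (x n - conv s (@delta0 R) n) + conv s (fun n => @delta0 R n - conv t c n) n)).
  apply: (le_trans (lpsumD _ _ p0)).
  apply: (@le_trans _ _ ((2 `^ p)%:E * (tau%:E + (C * (tau / (C + 1)))%:E))%E).
    apply: lee_wpmul2l; first by rewrite lee_fin ltW.
    apply: leeD => //; apply: (le_trans (hC _)); rewrite EFinM.
    apply: lee_wpmul2l; first by rewrite lee_fin.
    by rewrite (@lpsumN p (fun n => conv t c n - @delta0 R n)) // => n; rewrite opprB.
  rewrite -EFinD -EFinM lee_fin.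
  have h : C / (C + 1) <= 1 by rewrite ler_pdivrMr //; lra.
  have -> : 2 `^ p * (tau + C * (tau / (C + 1))) = (eps / 2) `^ p / 2 + (eps / 2) `^ p / 2 * (C / (C + 1)).
    by rewrite /tau; field; rewrite !gt_eqF //; lra.
  have e3 : 0 <= (eps / 2) `^ p / 2 by rewrite divr_ge0 // ltW.
  by have := ler_wpM2l e3 h; lra.
move=> n; have -> : conv s (fun n => @delta0 R n - conv t c n) n = conv s (@delta0 R) n - conv s (conv t c) n.
  by rewrite /conv -sumrB; apply: eq_bigr => k _; rewrite mulrBr.
by rewrite addrA subrK.
Qed.

(* The functional on sequences with coefficients [ccoef S `|n|]. *)
Definition pairing (S : {poly R}) c : R[i] :=
  (mean S)%:C * c 0 + \sum_(j < size S) (ccoef S j.+1)%:C * (c j.+1 + c (Negz j)).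

Lemma pairing_linear (S : {poly R}) (k : R[i]) c d :
  pairing S (fun n => k * c n + d n) = k * pairing S c + pairing S d.
Proof.
rewrite /pairing [k * (_ + \sum_(_ < _) _)]mulrDr mulr_sumr addrACA -big_split; congr (_ + _); first by ring.
by apply: eq_bigr => j _ /=; ring.
Qed.

Lemma pairing_conv S s c : pairing S (conv s c) = \sum_(k <- s) k.1 * pairing S (translate k.2 c).
Proof.
elim: s => [|k s IH].
  by rewrite big_nil /pairing /conv big_nil mulr0 add0r big1 // => j _; rewrite !big_nil addr0 mulr0.
rewrite big_cons -IH -pairing_linear; congr (pairing _ _).
by apply/funext => n; rewrite /conv big_cons.
Qed.

Lemma pairingB S c d : pairing S (fun n => c n - d n) = pairing S c - pairing S d.
Proof.
rewrite [RHS]addrC -mulN1r -pairing_linear; congr (pairing _ _).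
by apply/funext => n; rewrite mulN1r addrC.
Qed.

Lemma pairing_delta0 S : pairing S (@delta0 R) = (mean S)%:C.
Proof.
rewrite /pairing big1 ?addr0; first by rewrite /delta0 eqxx mulr1.
move=> j _; have -> : delta0 R j.+1 + delta0 R (Negz j) = 0.
  by rewrite /delta0 (_ : (Posz j.+1 == 0) = false) // (_ : (Negz j == 0) = false) // addr0.
by rewrite mulr0.
Qed.

(** The right-hand side is the pairing of S with the coefficients of P translated by m. Being a
    Fourier coefficient of S P, it is bounded by the supremum of |S P|. *)
Lemma ccoef_mul (S P : {poly R}) (m : int) : ccoef (S * P) `|m|%N =
  mean S * ccoef P `|0 - m|%N +
  \sum_(j < size S) ccoef S j.+1 * (ccoef P `|Posz j.+1 - m|%N + ccoef P `|Negz j - m|%N).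
Proof.
have sS : (size S <= (size S).+1)%N by [].
rewrite {1}(cheb_ccoef sS) mulrDl ccoefD mul_polyC ccoefZ sub0r abszN; congr (_ + _).
rewrite big_add1 /= big_mkord mulr_suml ccoef_sum; apply: eq_bigr => j _.
rewrite -scalerAl ccoefZ ccoef_chebM.
set i := `|m|%N.
have h : ccoef P (j.+1 + i) + ccoef P (ndist j.+1 i) = ccoef P `|Posz j.+1 - m|%N + ccoef P `|Negz j - m|%N.
  case: (leP 0 m) => m0.
    have -> : `|Posz j.+1 - m|%N = ndist j.+1 i by rewrite /ndist /i; lia.
    have -> : `|Negz j - m|%N = (j.+1 + i)%N by rewrite /i; lia.
    by rewrite addrC.
  have -> : `|Posz j.+1 - m|%N = (j.+1 + i)%N by rewrite /i; lia.
  by have -> : `|Negz j - m|%N = ndist j.+1 i by rewrite /ndist /i; lia.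
by rewrite -h; move: (ccoef S _) (ccoef P _) (ccoef P _) => u v w; rewrite mulr2n; field.
Qed.

Lemma nle1_tail (be : nat -> R) (M eps : R) : 0 <= M -> nle 1 be M -> 0 < eps ->
  exists N0, forall N, (N0 <= N)%N -> nle 1 (fun k => be k - ccoef (trunc_poly be N) k) eps.
Proof.
move=> M0 hb e0; pose u k := `|be k|.
have inc : {homo series u : n m / (n <= m)%N >-> n <= m}.
  by apply/nondecreasing_seqP => n; rewrite seriesSr lerDl /u.
have cv : cvgn (series u).
  apply: nondecreasing_is_cvgn => //; exists M => _ [n _ <-].
  by rewrite /series /= big_mkord; apply: nle1_sum.
have /cvgrPdist_lt/(_ _ e0) [N0 _ hN0] := cv.
exists N0 => N NN0 K.
have cE k : be k - ccoef (trunc_poly be N) k = if (k < N)%N then 0 else be k.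
  case: ltnP => kN; first by rewrite trunc_poly_coef // subrr.
  rewrite ccoef_eq0 ?subr0 //; apply: leq_trans kN.
  apply: (leq_trans (size_sum _ _ _)); apply/bigmax_leqP => j _.
  by apply: (leq_trans (size_scale_leq _ _)); rewrite size_cheb.
rewrite (powRr1 (ltW e0)); under eq_bigr => k _ do rewrite powRr1 // cE.
have hN := hN0 N NN0.
have := nondecreasing_cvgn_le inc cv (maxn K N) => hK.
have lim_le : limn (series u) - series u N <= eps.
  by apply: le_trans (ltW hN); rewrite ler_norm.
apply: (@le_trans _ _ (series u (maxn K N) - series u N)); last by lra.
apply: (@le_trans _ _ (\sum_(k < maxn K N) `|if (k < N)%N then 0 else be k|)).
  rewrite -!(big_mkord xpredT (fun k => `|if (k < N)%N then 0 else be k|)).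
  by rewrite [leRHS](@big_cat_nat _ _ _ K) ?leq_maxl //= lerDl sumr_ge0.
rewrite /series /= -(big_mkord xpredT (fun k => `|if (k < N)%N then 0 else be k|)).
rewrite [X in _ <= X - _](@big_cat_nat _ _ _ N) ?leq_maxr //= addrAC subrr add0r.
rewrite (@big_cat_nat _ _ _ N) ?leq_maxr //= big_nat_cond big1 ?add0r.
  rewrite le_eqVlt; apply/orP; left; apply/eqP; apply: eq_big_nat => k /andP[Nk _].
  by rewrite ltnNge Nk.
by move=> k /andP[/andP[_ kN] _]; rewrite kN normr0.
Qed.

(* The pairing is, in the limit, a Fourier coefficient of S times the series of
   be. *)
Lemma pairing_translate_le (S : {poly R}) (be : nat -> R) (M eta : R) (m : int) : 0 < M -> nle 1 be M ->
  (forall x : R, -1 <= x <= 1 -> `|S.[x] * cseries be x| <= eta) ->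
  Normc.normc (pairing S (translate m (emb be))) <= eta.
Proof.
move=> M0' hb hS; have M0 := ltW M0'; apply/ler_addgt0Pl => eps e0.
have [B B0 SB] := supI_ex S.
have e1 : 0 < eps / (2 * B) by rewrite divr_gt0 // mulr_gt0.
have [N0 hN0] := nle1_tail M0 hb e1.
pose N := (N0 + size S + `|m| + 1)%N.
have hN := hN0 N (leq_trans (leq_addr _ _) (leq_trans (leq_addr _ _) (leq_addr _ _))).
pose P := trunc_poly be N.
have -> : pairing S (translate m (emb be)) = (ccoef (S * P) `|m|%N)%:C.
  rewrite ccoef_mul rmorphD rmorphM rmorph_sum /pairing /translate /emb; congr (_ * _%:C + _).
    by rewrite trunc_poly_coef // /N; lia.
  apply: eq_bigr => j _; rewrite -rmorphD -rmorphM /=; have := ltn_ord j => js.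
  have h1 : (`|(Posz j.+1 - m)%R| < N)%N by rewrite /N; move: js; move: (size S) (nat_of_ord j) => u v; clear; lia.
  have h2 : (`|(Negz j - m)%R| < N)%N by rewrite /N; move: js; move: (size S) (nat_of_ord j) => u v; clear; lia.
  by rewrite /P trunc_poly_coef // trunc_poly_coef.
have nE (z : R) : Normc.normc z%:C = `|z| by rewrite /= expr0n addr0 sqrtr_sqr.
rewrite nE; apply: norm_ccoef => x hx; rewrite hornerM.
have PM : nle 1 (ccoef P) (M + eps / (2 * B)).
  have h : nle 1 (fun k => ccoef P k - be k) (eps / (2 * B)).
    by apply: (@nle_ext R 1 (fun k => - (be k - ccoef P k))) => [k|]; [rewrite opprB | apply: nleN].
  by apply: (nle_ext _ (nleD _ _ _ hb h)) => // k; rewrite addrC subrK.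
have A0 : 0 <= M + eps / (2 * B) by rewrite addr_ge0 // ltW.
have hd := cseries_diff M0 A0 (ltW e1) hb PM hN hx.
rewrite cseries_poly in hd.
have -> : S.[x] * P.[x] = S.[x] * cseries be x - S.[x] * (cseries be x - P.[x]) by ring.
apply: (le_trans (ler_normB _ _)); rewrite addrC; apply: lerD; last exact: hS.
rewrite normrM (_ : eps = B * (2 * (eps / (2 * B)))); last by field; rewrite gt_eqF.
by apply: ler_pM => //; apply: SB.
Qed.

Lemma lpsum_partial p c (e : nat -> int) K : injective e ->
  ((\sum_(k < K) Normc.normc (c (e k)) `^ p)%:E <= lpsum p c)%E.
Proof.
move=> ei; apply: ereal_sup_ubound; exists [set` map e (iota 0 K)].
  by split => //; apply: finite_seq.
rewrite -fsbig_seq; last by rewrite map_inj_uniq ?iota_uniq.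
rewrite big_map -{1}[K]subn0 -/(index_iota 0 K) big_mkord sumEFin.
by [].
Qed.

(** Young's inequality with the constants 1/p and 1/q dropped. With the free parameter lam it does
    the work of Hölder's inequality and applies term by term. *)
Lemma scaled_young p q (lam u v : R) : 1 < p -> 1 < q -> p^-1 + q^-1 = 1 -> 0 < lam ->
  0 <= u -> 0 <= v -> u * v <= lam `^ q * u `^ q + lam^-1 `^ p * v `^ p.
Proof.
move=> p1 q1 pq l0 u0 v0.
have p0 : 0 < p by lra.
have q0 : 0 < q by lra.
have l1 : 0 < lam^-1 by rewrite invr_gt0.
rewrite -!powRM ?(ltW l0) ?(ltW l1) //.
have -> : u * v = (lam^-1 * v) * (lam * u) by field; rewrite gt_eqF.
apply: (le_trans (conjugate_powR (mulr_ge0 (ltW l1) v0) (mulr_ge0 (ltW l0) u0) p0 q0 pq)).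
rewrite addrC; apply: lerD; rewrite ler_pdivrMr // ler_peMr ?powR_ge0 //; exact: ltW.
Qed.

Lemma normc_real (z : R) : Normc.normc z%:C = `|z|.
Proof. by rewrite /= expr0n addr0 sqrtr_sqr. Qed.

Lemma normc_sum_le n (f : nat -> R[i]) :
  Normc.normc (\sum_(j < n) f j) <= \sum_(j < n) Normc.normc (f j).
Proof.
elim: n => [|n IH]; first by rewrite !big_ord0 Normc.normc0.
by rewrite !big_ord_recr /=; apply: (le_trans (le_normcD _ _)); rewrite lerD2r.
Qed.

Lemma pairing_le p q (S : {poly R}) c (lam A L : R) : 1 < p -> 1 < q -> p^-1 + q^-1 = 1 -> 0 < lam ->
  nle q (ccoef S) A -> (lpsum p c <= L%:E)%E ->
  Normc.normc (pairing S c) <= 2 * (lam `^ q * A `^ q + lam^-1 `^ p * L).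
Proof.
move=> p1 q1 pq l0 hS hc.
have young (k : nat) (z : R[i]) : Normc.normc ((ccoef S k)%:C * z) <=
    lam `^ q * `|ccoef S k| `^ q + lam^-1 `^ p * Normc.normc z `^ p.
  by rewrite Normc.normcM normc_real; apply: scaled_young => //; apply: normc_ge0.
have hP K : \sum_(k < K) Normc.normc (c (Posz k)) `^ p <= L.
  by rewrite -lee_fin; apply: le_trans hc; apply: lpsum_partial => i j [].
have hN K : \sum_(k < K) Normc.normc (c (Negz k)) `^ p <= L.
  by rewrite -lee_fin; apply: le_trans hc; apply: lpsum_partial => i j [].
have aux (e : nat -> int) (f : nat -> nat) K :
    \sum_(k < K) `|ccoef S (f k)| `^ q <= A `^ q ->
    \sum_(k < K) Normc.normc (c (e k)) `^ p <= L ->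
    Normc.normc (\sum_(k < K) (ccoef S (f k))%:C * c (e k)) <= lam `^ q * A `^ q + lam^-1 `^ p * L.
  move=> h1 h2; apply: (le_trans (normc_sum_le _ (fun k => (ccoef S (f k))%:C * c (e k)))).
  apply: (@le_trans _ _ (\sum_(k < K) (lam `^ q * `|ccoef S (f k)| `^ q + lam^-1 `^ p * Normc.normc (c (e k)) `^ p))).
    by apply: ler_sum => k _; apply: young.
  by rewrite big_split /= -!mulr_sumr; apply: lerD; apply: ler_wpM2l; rewrite ?powR_ge0.
have -> : pairing S c = \sum_(k < (size S).+1) (ccoef S k)%:C * c k +
    \sum_(k < size S) (ccoef S k.+1)%:C * c (Negz k).
  rewrite /pairing big_ord_recl /= -addrA -big_split /=; congr (_ * _ + _).
    by rewrite /ccoef /= mulr1.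
  by apply: eq_bigr => j _; rewrite mulrDr.
apply: (le_trans (le_normcD _ _)); rewrite [leRHS]mulr_natl mulr2n; apply: lerD.
  by apply: (aux Posz id); [apply: hS | apply: hP].
apply: (aux Negz succn); last exact: hN.
apply: le_trans (hS (size S).+1); rewrite big_ord_recl lerDr powR_ge0 //.
Qed.

Lemma lp_lpsum p c (A : R) : (lpsum p c <= A%:E)%E -> lp p c.
Proof.
rewrite /lp /= /lpnorm -/(lpsum p c); have := lpsum_ge0 p c.
by case: (lpsum p c) => [r| |] // _ _; rewrite poweR_EFin ltry.
Qed.

Lemma lp_delta0 p : 0 < p -> lp p (@delta0 R).
Proof.
move=> p0; apply: (@lp_lpsum _ _ (1 + 0)); apply: lpsum_int_le => K.
  case: K => [|K]; first by rewrite big_ord0.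
  rewrite big_ord_recl big1 ?addr0 => [|j _].
    by rewrite /delta0 eqxx Normc.normc1 powR1.
  have -> : delta0 R (lift ord0 j) = 0 by [].
  by rewrite Normc.normc0 powR0 // gt_eqF.
rewrite big1 // => j _.
have -> : delta0 R (Negz j) = 0 by [].
by rewrite Normc.normc0 powR0 // gt_eqF.
Qed.

(** If a combination of translates were close to [delta0], pairing with S would give at least 1/2 on
    [delta0], almost 0 on the combination, and a small value on the difference. S is chosen after
    the combination, so tau may depend on its coefficients. *)
Lemma not_cyclic_criterion p q (be : nat -> R) (M : R) : 1 < p -> 1 < q -> p^-1 + q^-1 = 1 ->
  0 < M -> nle 1 be M ->
  (forall tau : R, 0 < tau -> exists S, [/\ nle q (ccoef S) 2, 1 / 2 <= mean S &
     forall x : R, -1 <= x <= 1 -> `|S.[x] * cseries be x| <= tau]) ->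
  ~ cyclic p (emb be).
Proof.
move=> p1 q1 pq M0 hM hS hc; have p0 : 0 < p by lra.
(* With lam = 1/32 both terms of [pairing_le] are at most 1/16, so the difference pairs to at most
   1/4; the combination adds at most 1/8, and 3/8 < 1/2. *)
pose L : R := (16 * 32 `^ p)^-1.
have t0 : 0 < 32 `^ p :> R by rewrite powR_gt0.
have L0 : 0 < L by rewrite invr_gt0 mulr_gt0.
have e0 : 0 < L `^ p^-1 by rewrite powR_gt0.
have [y [s ->]] := hc _ (lp_delta0 p0) _ e0.
rewrite -/(conv s (emb be)) => hy.
have {}hy : (lpsum p (fun n => @delta0 R n - conv s (emb be) n)%R <= L%:E)%E.
  by have := lpnorm_lt p0 e0 hy; rewrite -powRrM mulVf ?gt_eqF // powRr1 // ltW.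
pose K : R := \sum_(k <- s) Normc.normc k.1.
have K0 : 0 <= K by apply: sumr_ge0 => k _; apply: normc_ge0.
have [|S [S2 mS hx]] := hS (8 * (K + 1))^-1; first by rewrite invr_gt0 mulr_gt0 //; lra.
have l0 : 0 < 32^-1 :> R by rewrite invr_gt0.
have := pairing_le p1 q1 pq l0 S2 hy.
rewrite pairingB pairing_delta0 pairing_conv invrK.
have -> : 32 `^ p * L = 16^-1 by rewrite /L; field; rewrite gt_eqF.
rewrite -powRM ?invr_ge0 //.
have h16 : (32^-1 * 2) `^ q <= 16^-1 :> R.
  have -> : 32^-1 * 2 = 16^-1 :> R by field.
  have h : (16^-1) `^ q * 16 `^ q = 1 :> R by rewrite -powRM ?invr_ge0 // mulVf // powR1.
  have h' : 16 <= 16 `^ q :> R by apply: le1r_powR; lra.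
  have h'' : 0 <= (16^-1) `^ q :> R by apply: powR_ge0.
  by have := ler_wpM2l h'' h'; rewrite h => h3; rewrite -ler_pdivlMr // in h3; lra.
move=> h1.
have h2 : Normc.normc (\sum_(k <- s) k.1 * pairing S (translate k.2 (emb be))) <= K * (8 * (K + 1))^-1.
  move: (_^-1) hx => T hx.
  rewrite /K mulr_suml; elim: (s) => [|k s' IH]; first by rewrite !big_nil Normc.normc0.
  rewrite !big_cons; apply: (le_trans (le_normcD _ _)); apply: lerD => //.
  rewrite Normc.normcM; apply: ler_wpM2l; first exact: normc_ge0.
  exact: (pairing_translate_le _ M0 hM hx).
have h3 : K * (8 * (K + 1))^-1 <= 8^-1.
  by rewrite invfM mulrCA ler_piMr ?invr_ge0 // ler_pdivrMr; lra.
have h4 : mean S <= Normc.normc ((mean S)%:C).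
  by rewrite normc_real ler_norm.
have : Normc.normc (mean S)%:C <= Normc.normc ((mean S)%:C - \sum_(k <- s) k.1 * pairing S (translate k.2 (emb be)))
   + Normc.normc (\sum_(k <- s) k.1 * pairing S (translate k.2 (emb be))).
  by apply: le_trans (le_normcD _ _); rewrite subrK.
move: h1 h2 h3 h4 mS h16; move: ((32^-1 * 2) `^ q) (mean S)%:C => u z; move: (Normc.normc z) => v; move: (K * _) => w; move: (Normc.normc (_ - _)) => t; move: (Normc.normc _) => t1 h1 h2 h3 h4 h5 h6 h7; clear -h1 h2 h3 h4 h5 h6 h7; lra.
Qed.

End Criteria.

(** * The construction *)

Section Construction.
Variable R : realType.
Implicit Types (p q s : R) (a S : {poly R}).

Definition half (n : nat) : R := 2^-1 ^+ n.

Lemma half_gt0 n : 0 < half n.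
Proof. by rewrite /half exprn_gt0 ?invr_gt0. Qed.

Lemma halfS n : half n.+1 = half n / 2.
Proof. by rewrite /half exprSr. Qed.

Lemma half_le1 n : half n <= 1.
Proof. by rewrite /half exprn_ile1 ?invr_ge0 // invf_le1 // ler1n. Qed.

Definition level (n : nat) : R := (62 / 63) ^+ n.

Lemma level_gt0 n : 0 < level n.
Proof. by rewrite /level exprn_gt0 // divr_gt0. Qed.

Lemma levelS n : level n.+1 = 62 / 63 * level n.
Proof. by rewrite /level exprS. Qed.

Lemma level_le1 n : level n <= 1.
Proof. by rewrite /level exprn_ile1 ?divr_ge0 // ler_pdivrMr // mul1r ler_nat. Qed.

(** z is a budget for the later corrections: the limit will differ from a by an even sequence with
    l^p bound 4 z, for which [lpsum_emb_le] gives exactly this sum. *)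
Definition cyclic_radius p a (tau z : R) := exists s0 : seq (R[i] * int), forall d : int -> R[i],
  (lpsum p d <= ((4 * z) `^ p + (4 * z) `^ p)%:E)%E ->
  (lpsum p (fun n => conv s0 (fun n => emb (ccoef a) n + d n)%R n - delta0 R n)%R <= tau%:E)%E.

Lemma cyclic_radius_ex p a (tau z0 : R) : 1 < p -> mean a = 1 -> 0 < tau -> 0 < z0 ->
  exists z, [/\ 0 < z, z <= z0 / 2 & cyclic_radius p a tau z].
Proof.
move=> p1 a1 t0 z00; have p0 : 0 < p by lra.
have [|s0 [eps [e0 hs]]] := @cosine_poly_cyclic _ p a tau p1 _ t0; first by rewrite a1 oner_neq0.
pose t := (eps / 2) `^ p^-1 / 4.
have e2 : 0 < eps / 2 by rewrite divr_gt0.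
have tt0 : 0 < t by rewrite /t divr_gt0 // powR_gt0.
have m0 : 0 < Num.min (z0 / 2) t by rewrite lt_min tt0 andbT divr_gt0.
exists (Num.min (z0 / 2) t); split => //; first by rewrite ge_min lexx.
exists s0 => d hd; apply: hs; apply: le_trans hd _; rewrite lee_fin.
have h : (4 * Num.min (z0 / 2) t) `^ p <= eps / 2.
  have -> : eps / 2 = ((eps / 2) `^ p^-1) `^ p by rewrite -powRrM mulVf ?gt_eqF // powRr1 // ltW.
  have -> : (eps / 2) `^ p^-1 = 4 * t by rewrite /t; field.
  apply: ge0_ler_powR; rewrite ?nnegrE; [exact: ltW | by rewrite mulr_ge0 // ltW | by rewrite mulr_ge0 // ltW |].
  by rewrite ler_pM2l // ge_min lexx orbT.
by move: h; set u := _ `^ p; lra.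
Qed.

(* [st_z] bounds the l^p norm of the last correction and [st_S'] is the truncated
   multiplier of the previous stage. *)
Record stage := Stage { st_a : {poly R}; st_S : {poly R}; st_z : R; st_S' : {poly R} }.

(** The truncation doubles the mean square bound, so it moves S by at most half n / 64 in l^2, hence
    in l^q. The margins in [2 - half n] and [1 / 2 + half n / 2] pay for the two moves of a step,
    half n / 32 together. *)
Definition stage_inv q n (x : stage) :=
  [/\ dominated (st_S x) (st_a x) (level n) ((half n / 64) ^+ 2 / 2), mean (st_a x) = 1,
      0 < st_z x, nle q (ccoef (st_S x)) (2 - half n) & 1 / 2 + half n / 2 <= mean (st_S x)].

Definition stage_step p q K n (x y : stage) :=
  [/\ forall t : R, -1 <= t <= 1 -> 64 / 63 * level n <= `|(st_a x).[t]| -> `|(st_S' y).[t]| <= half n / 64,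
      nle q (ccoef (st_S' y)) 2 & 1 / 2 <= mean (st_S' y)] /\
  [/\ nle 1 (ccoef (st_a y - st_a x)) (K * level n), nle p (ccoef (st_a y - st_a x)) (st_z y),
      st_z y <= st_z x / 2 & cyclic_radius p (st_a x) (half n) (st_z y)].

Lemma stage_step_ex p q s : 1 < p -> 2 < q -> 0 < s <= 1 / 32 ->
  6 * qrate q s <= s ^+ 2 / (20 * 20) -> forall n x, stage_inv q n x ->
  exists y, stage_inv q n.+1 y /\ stage_step p q (64 / 63 * (1 / s)) n x y.
Proof.
move=> p1 q2 s01 hs n [a S z0 S0] [/= dom a1 z00 qS mS].
have q0 : 0 <= q by clear -q2; lra.
have q1 : 1 <= q by clear -q2; lra.
have q0' : 0 < q by clear -q2; lra.
have [z [zp zz cz]] := cyclic_radius_ex p1 a1 (half_gt0 n) z00.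
have h0 := half_gt0 n; have h1 := half_le1 n; have l0 := level_gt0 n; have l1 := level_le1 n.
have h64 : 0 < half n / 64 by rewrite divr_gt0.
(* The correction is g times 64/63 level n <= 2, so z / 2 keeps it within z in l^p. *)
pose eps := Num.min (half n / 64) (z / 2).
have eps0 : 0 < eps by rewrite lt_min h64 divr_gt0.
have eps1 : eps <= half n / 64 by rewrite ge_min lexx.
have eps2 : eps <= z / 2 by rewrite ge_min lexx orbT.
have e0 m : 0 < (half m / 64) ^+ 2 / 2 :> R.
  by rewrite divr_gt0 // exprn_gt0 // divr_gt0 // half_gt0.
have [S' [S2 [g [[hS' mSS qS2] [g1 gp mg dom']]]]] :=
  riesz_step p1 q2 s01 hs l0 (e0 n) (e0 n.+1) eps0 dom.
have [s0 _] := andP s01.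
have qSS : nle q (ccoef (S - S')) (half n / 64).
  apply: sum_qpow_le_mean; [exact: ltW | exact: ltW |].
  by apply: le_trans mSS _; rewrite mulrC divfK.
have qS2' : nle q (ccoef (S2 - S')) (half n / 64) by apply: nle_le qS2 => //; exact: ltW.
have c64 : 0 <= 64 / 63 * level n by rewrite mulr_ge0 ?divr_ge0 // ltW.
have h2 : 0 < 2 - half n by clear -h1; lra.
have qS' : nle q (ccoef S') (2 - half n + half n / 64).
  apply: (@nle_ext R q (fun k => ccoef S k + - ccoef (S - S') k)) => [k|].
    by rewrite ccoefB opprB addrC subrK.
  by apply: nleD => //; apply: nleN.
have qS2n : nle q (ccoef S2) (2 - half n + half n / 64 + half n / 64).
  apply: (@nle_ext R q (fun k => ccoef S' k + ccoef (S2 - S') k)) => [k|].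
    by rewrite ccoefB addrC subrK.
  by apply: nleD => //; clear -h2 h64; lra.
have m1 := nle_coef 0 q0' (ltW h64) qSS; have m2 := nle_coef 0 q0' (ltW h64) qS2'.
rewrite !ccoef0 !meanB in m1 m2; rewrite !ler_norml in m1 m2.
have [m11 m12] := andP m1; have [m21 m22] := andP m2.
exists (Stage (a - (64 / 63 * level n) *: g) S2 z S'); split; split => /=.
- by rewrite levelS.
- by rewrite meanB meanZ mg mulr0 subr0.
- by [].
- by apply: nle_le qS2n => //; rewrite ?halfS; clear -h0 h1; lra.
- by rewrite halfS; clear -mS m12 m21 h0; lra.
- split => [t ht hat| |]; [by apply: le_trans (hS' t ht hat) _ | | by clear -mS m12 h0; lra].
  by apply: nle_le qS' => //; clear -h0 h1; lra.
- have gE k : (64 / 63 * level n) * - ccoef g k = ccoef (a - (64 / 63 * level n) *: g - a) k.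
    by rewrite addrC addKr ccoefN ccoefZ mulrN.
  split => //.
    apply: (nle_ext gE); have -> : 64 / 63 * (1 / s) * level n = 64 / 63 * level n * (1 / s) by ring.
    by apply: nleZ => //; [rewrite divr_ge0 // ltW | apply: nleN].
  apply: (nle_ext gE); apply: (@nle_le _ _ _ (64 / 63 * level n * eps)).
  + by clear -p1; lra.
  + by rewrite mulr_ge0 // ltW.
  + have : 64 / 63 * level n <= 2 by clear -l1; lra.
    by move=> /(ler_wpM2r (ltW eps0)) hh; clear -hh eps2; lra.
  by apply: nleZ => //; [exact: ltW | apply: nleN].
Qed.

Lemma construction p q s : 1 < p -> 2 < q -> 0 < s <= 1 / 32 ->
  6 * qrate q s <= s ^+ 2 / (20 * 20) ->
  exists (a S : nat -> {poly R}) (z : nat -> R), forall n,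
  [/\ forall t : R, -1 <= t <= 1 -> 64 / 63 * level n <= `|(a n).[t]| -> `|(S n).[t]| <= half n,
      nle q (ccoef (S n)) 2 & 1 / 2 <= mean (S n)] /\
  [/\ nle 1 (ccoef (a n.+1 - a n)) (64 / 63 * (1 / s) * level n), nle p (ccoef (a n.+1 - a n)) (z n),
      0 < z n, z n.+1 <= z n / 2 & cyclic_radius p (a n) (half n) (z n)] /\ mean (a n) = 1.
Proof.
move=> p1 q2 s01 hs; pose K := 64 / 63 * (1 / s).
have [f hf] : {f : nat * stage -> stage & forall u, stage_inv q u.1 u.2 ->
    stage_inv q u.1.+1 (f u) /\ stage_step p q K u.1 u.2 (f u)}.
  apply: (@boolp.choice _ _ (fun u y => stage_inv q u.1 u.2 -> stage_inv q u.1.+1 y /\ stage_step p q K u.1 u.2 y)) => -[n x] /=.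
  have [hx|nx] := pselect (stage_inv q n x); last by exists x.
  by have [y hy] := stage_step_ex p1 q2 s01 hs hx; exists y.
(* For a = 1 at level 1 the set {|a| > 1} is empty, so S = 1 is dominated by W = 0. *)
pose x0 := Stage 1 1 1 1.
pose x := fix x n := if n is m.+1 then f (m, x m) else x0.
have inv n : stage_inv q n (x n).
  elim: n => [|n IH]; last by have [] := hf (n, x n) IH.
  have q0 : 0 < q by lra.
  split => /=; rewrite ?/half ?/level ?expr0.
  - exists 0; first by rewrite mean0 divr_ge0 // sqr_ge0.
    move=> t _; rewrite horner0; split => //; rewrite -[(1 : {poly R})]polyC1 hornerC normr1 ltxx //.
  - by rewrite -[(1 : {poly R})]polyC1 meanC.
  - by [].
  - have -> : 2 - 1 = 1 :> R by ring.
    have one : (1 : {poly R}) = cheb R 0 by rewrite cheb0.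
    move=> K'; rewrite powR1; case: K' => [|K']; first by rewrite big_ord0.
    rewrite big_ord_recl big1 => [|k _].
      by rewrite one ccoef_cheb addr0 /= (_ : (1 + 1) / 2 = 1) ?normr1 ?powR1 //; field.
    by rewrite one ccoef_cheb /= add0r mul0r normr0 powR0 // gt_eqF.
  - by rewrite -[(1 : {poly R})]polyC1 meanC; lra.
have stp n : stage_step p q K n (x n) (x n.+1) by have [] := hf (n, x n) (inv n).
(* The truncated multiplier and the l^p budget that belong to a n are recorded in the following
   stage. *)
exists (fun n => st_a (x n)), (fun n => st_S' (x n.+1)), (fun n => st_z (x n.+1)) => n.
have [[h1 h2 h3] [h4 h5 h6 h7]] := stp n.
have [_ hm z0 _ _] := inv n; have [_ _ z1 _ _] := inv n.+1.
have [_ [_ _ h8 _]] := stp n.+1.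
split; last by [].
split => // t ht hat; apply: le_trans (h1 t ht hat) _.
by have := half_gt0 n; lra.
Qed.

End Construction.

(** * Passage to the limit *)

Section Limits.
Variable R : realType.
Implicit Types (r : R) (g : nat -> nat -> R) (e E be : nat -> R).

Lemma tail_sum e E : (forall J, 0 <= E J) -> (forall J, e J + E J.+1 <= E J) ->
  forall J n, \sum_(i < n) e (J + i)%N <= E J.
Proof.
move=> E0 eE J n; suff h : \sum_(i < n) e (J + i)%N + E (J + n)%N <= E J.
  by apply: le_trans h; rewrite lerDl.
elim: n => [|n IH]; first by rewrite big_ord0 add0r addn0.
rewrite big_ord_recr /= addnS; have := eE (J + n)%N; lra.
Qed.

Lemma tail_cvg g e E (D c : R) : (forall J, 0 < e J) -> (forall J, 0 <= E J) ->
  (forall J, e J + E J.+1 <= E J) -> 0 <= c -> c < 1 -> (forall J, E J <= D * c ^+ J) ->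
  (forall j, nle 1 (fun k => g j.+1 k - g j k) (e j)) ->
  exists b : nat -> R, forall k, g ^~ k @ \oo --> b k.
Proof.
move=> e0 E0 eE c0 c1 EDc he; apply: (@coefs_limit R g (fun J => D * c ^+ J)).
  move=> J J' k JJ'; apply: le_trans (EDc J).
  have h := telescope_nle (lexx 1) e0 he (tail_sum E0 eE) JJ'.
  exact: (nle_coef k ltr01 (E0 J) h).
rewrite -[X in _ --> X](mulr0 D); apply: cvgM; first exact: cvg_cst.
by apply: cvg_expr; rewrite ger0_norm.
Qed.

Lemma tail_nle r g e E (b : nat -> R) : 1 <= r -> (forall J, 0 < e J) -> (forall J, 0 <= E J) ->
  (forall J, e J + E J.+1 <= E J) -> (forall j, nle r (fun k => g j.+1 k - g j k) (e j)) ->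
  (forall k, g ^~ k @ \oo --> b k) -> forall n, nle r (fun k => b k - g n k) (2 * E n).
Proof.
move=> r1 e0 E0 eE he gb n; have r0 : 0 < r by lra.
apply: (nle_lim r0 (E0 n) gb); exists n => // J /= nJ.
exact: (telescope_nle r1 e0 he (tail_sum E0 eE) nJ).
Qed.

Lemma nle1_poly (P : {poly R}) : exists2 M : R, 0 < M & nle 1 (ccoef P) M.
Proof.
exists (1 + \sum_(k < size P) `|ccoef P k|); first by rewrite ltr_wpDr ?sumr_ge0.
have s0 : 0 <= \sum_(k < size P) `|ccoef P k| by apply: sumr_ge0.
move=> K; rewrite powRr1; last by rewrite addr_ge0.
under eq_bigr do rewrite powRr1 //.
apply: (@le_trans _ _ (\sum_(k < maxn (size P) K) `|ccoef P k|)).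
  rewrite -!(big_mkord xpredT (fun k => `|ccoef P k|)).
  by rewrite [leRHS](@big_cat_nat _ _ _ K) ?leq_maxr //= lerDl sumr_ge0.
rewrite -!(big_mkord xpredT (fun k => `|ccoef P k|)).
rewrite (@big_cat_nat _ _ _ (size P)) ?leq_maxl //= [X in _ + X <= _]big_nat_cond [X in _ + X <= _]big1.
  by rewrite addr0 lerDr.
by move=> k /andP[/andP[sk _] _]; rewrite ccoef_eq0 // normr0.
Qed.

Lemma cseriesD be ga (M A x : R) : 0 < M -> 0 < A -> nle 1 be M -> nle 1 ga A ->
  -1 <= x <= 1 -> cseries (fun k => be k + ga k) x = cseries be x + cseries ga x.
Proof.
move=> M0 A0 hb hg hx.
have h := nleD (lexx 1) M0 A0 hb hg.
have := cseries_sub (ltW (addr_gt0 M0 A0)) (ltW A0) h hg hx.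
have -> : (fun k => be k + ga k - ga k) = be by apply/funext => k; rewrite addrK.
by move=> ->; rewrite subrK.
Qed.

Lemma cseriesZ be (c M x : R) : 0 <= M -> nle 1 be M -> -1 <= x <= 1 ->
  cseries (fun k => c * be k) x = c * cseries be x.
Proof.
move=> M0 hb hx; apply: cvg_lim => //.
have -> : series (cterm (fun k => c * be k) x) = (fun n => c * series (cterm be x) n).
  apply/funext => n; rewrite /series /= mulr_sumr; apply: eq_bigr => k _.
  by rewrite /cterm -mulrnAr mulrA.
apply: cvgM; first exact: cvg_cst.
exact: (cseries_cvg M0 hb hx).
Qed.

(** P^2 - r^2, scaled into [-1, 1], has a squared positive part that vanishes exactly where |P| <=
    r. *)
Lemma threshold_series (P : {poly R}) (r : R) : 0 < r ->
  exists be (M : R), [/\ 0 < M, nle 1 be M &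
    forall x : R, -1 <= x <= 1 -> 0 <= cseries be x /\ (cseries be x = 0 <-> `|P.[x]| <= r)].
Proof.
move=> r0; have B0 := bnd_gt0 P; have PB := @bndP _ P.
have D0 : 0 < bnd P ^+ 2 + r ^+ 2 by rewrite addr_gt0 // exprn_gt0.
pose v := (bnd P ^+ 2 + r ^+ 2)^-1 *: (P * P - (r ^+ 2)%:P).
have vE x : v.[x] = (bnd P ^+ 2 + r ^+ 2)^-1 * (`|P.[x]| ^+ 2 - r ^+ 2).
  by rewrite hornerZ hornerD hornerN hornerM hornerC real_normK ?num_real // expr2.
have sq x : -1 <= x <= 1 -> `|P.[x]| ^+ 2 <= bnd P ^+ 2.
  by move=> /PB h; rewrite lerXn2r // nnegrE ltW.
have [|be [M [M0 hM hF]]] := @possq_cseries _ v.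
  move=> x /sq h; rewrite vE mulrC ler_pdivlMr // ler_pdivrMr //.
  have := sqr_ge0 (`|P.[x]|); have := sqr_ge0 (bnd P); have := sqr_ge0 r.
  move: h; move: (_ ^+ 2) (_ ^+ 2) (_ ^+ 2) => u t w; lra.
exists be, M; split => // x hx; rewrite hF // /possq; split; first exact: sqr_ge0.
have key : (v.[x] / 2 <= 0) = (`|P.[x]| <= r).
  rewrite pmulr_lle0 ?invr_gt0 // vE pmulr_rle0 ?invr_gt0 // subr_le0.
  by rewrite ler_pXn2r // nnegrE ltW.
rewrite -key; split=> [/eqP|h]; last by rewrite max_l // expr0n.
by rewrite sqrf_eq0 => /eqP h; rewrite -h le_max lexx orbT.
Qed.

Lemma level_lt (D y : R) : 0 < D -> 0 < y -> exists n, D * level R n < y.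
Proof.
move=> D0 y0; have yD : 0 < y / D / 2 by rewrite !divr_gt0.
have [||m0 h] := @ex_exprn_le R (62 / 63) _ _ _ yD.
- by rewrite divr_ge0.
- by rewrite ltr_pdivrMr // mul1r ltr_nat.
exists m0; apply: (@le_lt_trans _ _ (D * (y / D / 2))); first by rewrite ler_pM2l // h.
have -> : D * (y / D / 2) = y / 2 by field; rewrite gt_eqF.
by lra.
Qed.

Lemma half_lt (D y : R) : 0 < D -> 0 < y -> exists n, forall m, (n <= m)%N -> D * half R m < y.
Proof.
move=> D0 y0; have yD : 0 < y / D / 2 by rewrite !divr_gt0.
have [||m0 h] := @ex_exprn_le R (2^-1) _ _ _ yD.
- by rewrite invr_ge0.
- by rewrite invf_lt1 // ltr1n.
exists m0 => m mm; apply: (@le_lt_trans _ _ (D * (y / D / 2))); first by rewrite ler_pM2l // h.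
have -> : D * (y / D / 2) = y / 2 by field; rewrite gt_eqF.
by lra.
Qed.

End Limits.

(** * The non-cyclic sequence with the same zeros *)

Section Companion.
Variable R : realType.

Lemma noncyclic_companion (p q : R) (a S : nat -> {poly R}) (al : nat -> R) (D : R) :
  1 < p -> 1 < q -> p^-1 + q^-1 = 1 -> 2 <= D ->
  (forall n (x : R), -1 <= x <= 1 -> `|cseries al x - (a n).[x]| <= D * level R n) ->
  (forall n (x : R), -1 <= x <= 1 -> 64 / 63 * level R n <= `|(a n).[x]| -> `|(S n).[x]| <= half R n) ->
  (forall n, nle q (ccoef (S n)) 2) -> (forall n, 1 / 2 <= mean (S n)) ->
  exists be (M : R), [/\ 0 < M, nle 1 be M, ~ cyclic p (emb be) &
    forall x : R, -1 <= x <= 1 -> (cseries al x = 0 <-> cseries be x = 0)].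
Proof.
move=> p1 q1 pq D2 ha hS qS mS; have D0 : 0 < D by lra.
have [th hth] : {th : nat -> (nat -> R) * R & forall n, [/\ 0 < (th n).2, nle 1 (th n).1 (th n).2 &
    forall x : R, -1 <= x <= 1 -> 0 <= cseries (th n).1 x /\
      (cseries (th n).1 x = 0 <-> `|(a n).[x]| <= 4 * D * level R n)]}.
  apply: (@boolp.choice _ _ (fun n (u : (nat -> R) * R) => [/\ 0 < u.2, nle 1 u.1 u.2 &
    forall x : R, -1 <= x <= 1 -> 0 <= cseries u.1 x /\
      (cseries u.1 x = 0 <-> `|(a n).[x]| <= 4 * D * level R n)])) => n.
  have [|be [M h]] := @threshold_series R (a n) (4 * D * level R n).
    by rewrite !mulr_gt0 // level_gt0.
  by exists (be, M).
pose F n x := cseries (th n).1 x.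
(* Halving gives convergence; the second bound makes the tail beyond index m harmless even after
   multiplication by the supremum of S m. *)
pose e := fix e n := if n is m.+1 then Num.min (e m / 2) (half R m / bnd (S m)) else 1.
have e0 n : 0 < e n.
  elim: n => [|n IH] //=; rewrite lt_min divr_gt0 //= divr_gt0 ?half_gt0 //; exact: bnd_gt0.
have eS n : e n.+1 <= e n / 2 by rewrite /= ge_min lexx.
have eb n : bnd (S n) * e n.+1 <= half R n.
  by rewrite mulrC -ler_pdivlMr ?bnd_gt0 //= ge_min lexx orbT.
have eh n : e n <= half R n.
  elim: n => [|n IH]; first by rewrite /half expr0.
  by apply: (le_trans (eS n)); rewrite halfS ler_pM2r ?invr_gt0.
pose w n := e n / (th n).2.
have w0 n : 0 < w n by rewrite /w divr_gt0 //; have [] := hth n.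
pose g J k := \sum_(n < J) w n * (th n).1 k.
have ge0 n : nle 1 (fun k => w n * (th n).1 k) (e n).
  have [M0 hM _] := hth n.
  have -> : e n = w n * (th n).2 by rewrite /w divfK // gt_eqF.
  by apply: nleZ => //; exact: ltW.
have gS n : nle 1 (fun k => g n.+1 k - g n k) (e n).
  by apply: nle_ext (ge0 n) => k; rewrite /g big_ord_recr /= addrAC subrr add0r.
pose E n := 2 * e n.
have E0 n : 0 <= E n by rewrite /E mulr_ge0 // ltW.
have eE n : e n + E n.+1 <= E n by rewrite /E; have := eS n; lra.
have h2 : 2^-1 < 1 :> R by rewrite invf_lt1 // ltr1n.
have h20 : 0 <= 2^-1 :> R by rewrite invr_ge0.
have Eh n : E n <= 2 * 2^-1 ^+ n by rewrite /E ler_pM2l //; exact: eh.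
have [be gb] := tail_cvg e0 E0 eE h20 h2 Eh gS.
have bg := tail_nle (lexx 1) e0 E0 eE gS gb.
have g0 k : g 0%N k = 0 by rewrite /g big_ord0.
have hbe : nle 1 be (2 * E 0%N) by apply: nle_ext (bg 0%N) => k; rewrite g0 subr0.
have M0 : 0 < 2 * E 0%N by rewrite /E /= !mulr_gt0.
have gM J : exists2 A, 0 < A & nle 1 (g J) A.
  elim: J => [|J [A A0 IH]].
    exists 1 => // K; rewrite powR1 big1 // => k _; by rewrite g0 normr0 powRr1.
  exists (A + e J); first by rewrite addr_gt0.
  apply: (nle_ext _ (nleD (lexx 1) A0 (e0 J) IH (ge0 J))) => k.
  by rewrite /g big_ord_recr.
have gE J x : -1 <= x <= 1 -> cseries (g J) x = \sum_(n < J) w n * F n x.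
  move=> hx; elim: J => [|J IH].
    rewrite big_ord0; apply: (@cseries_eventually _ _ _ _ 0%N) => m _.
    by rewrite /series /= big1 // => k _; rewrite /cterm g0 mul0rn mul0r.
  rewrite big_ord_recr -IH /=; have [A A0 hA] := gM J; have [T0 hT _] := hth J.
  rewrite -[w J * F J x](cseriesZ (w J) (ltW T0) hT hx) -(cseriesD A0 (e0 J) hA (ge0 J) hx).
  by congr (cseries _ _); apply/funext => k; rewrite /g big_ord_recr.
have tail J x : -1 <= x <= 1 -> `|cseries be x - \sum_(n < J) w n * F n x| <= 8 * e J.
  move=> hx; rewrite -gE //; have [A A0 hA] := gM J.
  have EJ : 0 <= 2 * E J by rewrite mulr_ge0.
  have := cseries_diff (ltW M0) (ltW A0) EJ hbe hA (bg J) hx.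
  by rewrite /E => h; apply: (le_trans h); lra.
have F0 n x : -1 <= x <= 1 -> 0 <= F n x.
  by move=> hx; have [_ _ h] := hth n; have [] := h x hx.
have FZ n x : -1 <= x <= 1 -> F n x = 0 <-> `|(a n).[x]| <= 4 * D * level R n.
  by move=> hx; have [_ _ h] := hth n; have [] := h x hx.
exists be, (2 * E 0%N); split => //; last first.
  move=> x hx; split=> [al0|be0].
    have Fx n : F n x = 0.
      apply/FZ => //; have := ha n x hx; rewrite al0 sub0r normrN => h.
      by apply: (le_trans h); rewrite ler_wpM2r ?(ltW (level_gt0 _ _)) //; lra.
    have le J : `|cseries be x| <= 8 * half R J.
      have := tail J x hx; rewrite big1 ?subr0 => [h|n _]; last by rewrite Fx mulr0.
      by apply: (le_trans h); rewrite ler_pM2l.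
    apply/eqP; rewrite -normr_le0 leNgt; apply/negP => pos.
    have [|n hn] := @half_lt R 8 _ _ pos; first by [].
    by have := lt_le_trans (hn n (leqnn n)) (le_refl _); rewrite ltNge le.
  apply/eqP; rewrite -normr_le0 leNgt; apply/negP => pos.
  (* Once the limit exceeds 5 D level n, |a n| exceeds the threshold 4 D level n, so F n is positive
     at x. *)
  have [|n hn] := @level_lt R (5 * D) _ _ pos; first by rewrite mulr_gt0.
  have Fn : 0 < F n x.
    rewrite lt_neqAle F0 // andbT eq_sym; apply/eqP => /(FZ _ _ hx).
    have := ha n x hx; have := ler_normB (cseries al x - (a n).[x]) (- (a n).[x]).
    rewrite opprK subrK normrN.
    move: hn; set l := level R n; move: (`|_|) (`|_|) (`|_|) => u v t; lra.
  have pos2 : 0 < w n * F n x by rewrite mulr_gt0.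
  have [|m hm] := @half_lt R 8 _ _ pos2; first by [].
  pose J := (n.+1 + m)%N.
  have := tail J x hx; rewrite be0 sub0r normrN ger0_norm; last first.
    by apply: sumr_ge0 => i _; rewrite mulr_ge0 ?F0 // ltW.
  apply/negP; rewrite -ltNge; apply: (@le_lt_trans _ _ (8 * half R J)); first by rewrite ler_pM2l.
  apply: (lt_le_trans (hm J _)); first by rewrite /J leq_addl.
  have nJ : (n < J)%N by rewrite /J addSn ltnS leq_addr.
  rewrite (bigD1 (Ordinal nJ)) //= lerDl sumr_ge0 // => i _.
  by rewrite mulr_ge0 ?F0 // ltW.
apply: (@not_cyclic_criterion _ p q be (2 * E 0%N)) => // tau tau0.
have [|m hm] := @half_lt R 16 _ _ tau0; first by [].
have {}hm := hm m (leqnn m).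
exists (S m); split => // x hx; rewrite normrM.
have h0 := half_gt0 R m.
have [good|bad] := leP (64 / 63 * level R m) `|(a m).[x]|.
  have h1 := hS m x hx good.
  have h3 := cseries_norm (ltW M0) hbe hx.
  have : `|(S m).[x]| * `|cseries be x| <= half R m * (2 * (2 * E 0%N)) by apply: ler_pM.
  by rewrite /E /=; lra.
(* For n <= m, passing from a m to the limit and then to a n costs D level m + D level n. As |a m| <
   64/63 level m <= D level n, |a n| stays below the threshold 4 D level n. Only the tail of the
   series from m + 1 on remains. *)
have Fz (n : 'I_m.+1) : F n x = 0.
  apply/FZ => //.
  have nm : (n <= m)%N by rewrite -ltnS.
  have lm : level R m <= level R n.
    by rewrite /level ler_wiXn2l ?divr_ge0 // ler_pdivrMr // mul1r ler_nat.
  have l0 := level_gt0 R n.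
  have h1 := ha n x hx; have h3 := ha m x hx.
  have h4 : D * level R m <= D * level R n by rewrite ler_pM2l.
  have h5 : 2 * level R n <= D * level R n by rewrite ler_pM2r.
  have := ler_normD ((a n).[x] - cseries al x) (cseries al x - (a m).[x] + (a m).[x]).
  have := ler_normD (cseries al x - (a m).[x]) (a m).[x].
  rewrite distrC in h1; rewrite subrK subrK.
  move: bad h1 h3 h4 h5 lm l0; rewrite -!mulrA; move: (level R m) (level R n) (D * _) (D * _) => u v t1 t2.
  lra.
have := tail m.+1 x hx; rewrite big1 ?subr0 => [h|i _]; last by rewrite Fz mulr0.
have Sb : `|(S m).[x]| <= bnd (S m) by apply: bndP.
apply: (@le_trans _ _ (bnd (S m) * (8 * e m.+1))); first by apply: ler_pM.
by have := eb m; move: hm h0; rewrite mulrCA; lra.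
Qed.

End Companion.

Theorem corollary1 (R : realType) (p : R) (p_gt1 : 1 < p) (p_lt2 : p < 2) :
  exists a b : int -> R[i],
    lp 1 a /\ lp 1 b /\
    cyclic p a /\ ~ cyclic p b /\
    [set t : circle R | fourier a t = 0] = [set t : circle R | fourier b t = 0].
Proof.
have p0 : 0 < p by lra.
have pm : 0 < p - 1 by lra.
pose q := p / (p - 1).
have q2 : 2 < q by rewrite /q ltr_pdivlMr //; lra.
have q1 : 1 < q by lra.
have pq : p^-1 + q^-1 = 1 by rewrite /q; field; rewrite !gt_eqF.
have [s s01 hs] := scale_ex q2.
have [a [S [z h]]] := construction p_gt1 q2 s01 hs.
have [s0 s1] := andP s01.
pose K : R := 64 / 63 * (1 / s).
have Ks : 32 <= K.
  have : 32 <= 1 / s by rewrite ler_pdivlMr //; lra.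
  by rewrite /K; lra.
have K0 : 0 < K by lra.
have l0 := @level_gt0 R.
pose g n k := ccoef (a n) k.
have g1 n : nle 1 (fun k => g n.+1 k - g n k) (K * level R n).
  by have [_ [[h1 _ _ _ _] _]] := h n; apply: nle_ext h1 => k; rewrite ccoefB.
have gp n : nle p (fun k => g n.+1 k - g n k) (z n).
  by have [_ [[_ h1 _ _ _] _]] := h n; apply: nle_ext h1 => k; rewrite ccoefB.
have z0 n : 0 < z n by have [_ [[_ _ ? _ _] _]] := h n.
have e0 n : 0 < K * level R n by rewrite mulr_gt0.
(* 63 is the sum of the geometric series of ratio 62/63. *)
have E0 n : 0 <= 63 * K * level R n by have := e0 n; lra.
have eE n : K * level R n + 63 * K * level R n.+1 <= 63 * K * level R n.
  by rewrite levelS le_eqVlt; apply/orP; left; apply/eqP; field.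
have r0 : 0 <= 62 / 63 :> R by rewrite divr_ge0.
have r1 : 62 / 63 < 1 :> R by rewrite ltr_pdivrMr // mul1r ltr_nat.
have [al gal] := tail_cvg e0 E0 eE r0 r1 (fun n => lexx _) g1.
have b1 := tail_nle (lexx 1) e0 E0 eE g1 gal.
(* One factor 2 sums the bounds z, which at least halve at each step; the other comes from
   [nle_lim]. *)
have bp n : nle p (fun k => al k - g n k) (2 * (2 * z n)).
  have Z0 m : 0 <= 2 * z m by rewrite mulr_ge0 // ltW.
  have zE m : z m + 2 * z m.+1 <= 2 * z m by have [_ [[_ _ _ ? _] _]] := h m; lra.
  by apply: (tail_nle (ltW p_gt1) z0 Z0 zE gp gal).
have [A A0 hA] := nle1_poly (a 0%N).
pose B := A + 2 * (63 * K * level R 0).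
have B0 : 0 < B by have := e0 0%N; rewrite /B; lra.
have hal : nle 1 al B.
  apply: (nle_ext _ (nleD (lexx 1) A0 _ hA (b1 0%N))); last by have := e0 0%N; lra.
  by move=> k; rewrite addrC subrK.
(* 252 = 4 * 63: a factor 2 for the passage to the limit and another for the two-sided series. *)
have close n (x : R) : -1 <= x <= 1 -> `|cseries al x - (a n).[x]| <= 252 * K * level R n.
  move=> hx; have [C C0 hC] := nle1_poly (a n).
  have E2 : 0 <= 2 * (63 * K * level R n) by rewrite mulr_ge0.
  have := cseries_diff (ltW B0) (ltW C0) E2 hal hC (b1 n) hx.
  by rewrite cseries_poly; lra.
have D2 : 2 <= 252 * K by lra.
have [be [M [M0 hbe ncyc hZ]]] := noncyclic_companion p_gt1 q1 pq D2 close
  (fun n => let: conj (And3 h1 _ _) _ := h n in h1)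
  (fun n => let: conj (And3 _ h1 _) _ := h n in h1)
  (fun n => let: conj (And3 _ _ h1) _ := h n in h1).
exists (emb al), (emb be); split; [|split; [|split; [|split]]] => //.
- exact: lp_lpsum (lpsum_emb_le hal).
- exact: lp_lpsum (lpsum_emb_le hbe).
- apply: cyclic_criterion => // tau t0.
  have [n hn] := @half_lt R 1 _ ltr01 t0.
  have [_ [[_ _ _ _ [s' hs']] _]] := h n.
  exists s'; pose d := emb (fun k => al k - g n k).
  have hd : (lpsum p d <= ((4 * z n) `^ p + (4 * z n) `^ p)%:E)%E.
    apply: lpsum_emb_le; have -> : 4 * z n = 2 * (2 * z n) by ring.
    exact: bp.
  have := hs' d hd.
  have -> : (fun m => emb (ccoef (a n)) m + d m) = emb al.
    by apply/funext => m; rewrite /d /emb -rmorphD /= addrC subrK.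
  move=> h1; apply: (le_trans h1); rewrite lee_fin.
  by have := hn n (leqnn n); rewrite mul1r => /ltW.
- apply/seteqP; split => t; rewrite /= /fourier (fourier_series_emb _ (ltW B0) hal)
    (fourier_series_emb _ (ltW M0) hbe); have hc : -1 <= cos (repr t) <= 1 by rewrite cos_geN1 cos_le1.
  + by case=> /(hZ _ hc) ->.
  + by case=> /(hZ _ hc) ->.
Qed.
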